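(* Consider the Poissonian smooth change-point model with transition lengths $\delta_n$, and suppose $n\delta_n\to0$ as $n\to+\infty$. Then the maximum likelihood estimator $\hat\theta_n$ has, uniformly with respect to $\theta\in\mathbb{K}$ for any compact $\mathbb{K}\subset\Theta$, the following properties: - $\hat\theta_n$ is consistent; - $\hat\theta_n$ converges at rate $1/n$ and its limiting distribution is that of the random variable $\eta_{a,b}=\operatorname{argsup}_{u\in\mathbb{R}}Z^\star_{a,b}(u)$, where $a=\psi(\theta)$ and $b=\psi(\theta)+r$, that is, under $\mathbf{P}_\theta^{(n)}$, $$n(\hat\theta_n-\theta)\Longrightarrow\eta_{a,b};$$ - the polynomial moments converge: for any $p>0$, $$\lim_{n\to+\infty}n^p\,\mathbf{E}_\theta|\hat\theta_n-\theta|^p=\mathbf{E}|\eta_{a,b}|^p.$$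
   Context: Model: $0<\alpha<\beta<\tau$ are known constants, $\psi$ is a known strictly positive continuous function on $[0,\tau]$, $r\neq0$ is a known constant with $r>-\min_{0\leq t\leq\tau}\psi(t)$, $(\delta_n)$ is a known sequence of positive numbers decreasing to $0$, and $\theta\in\Theta=(\alpha,\beta)$ is the unknown parameter. For each $n\in\mathbb{N}^*=\{1,2,\dots\}$ one observes $X^{(n)}=(X_1,\dots,X_n)$, where the $X_j=(X_j(t),\,0\leq t\leq\tau)$ are independent inhomogeneous Poisson processes on $[0,\tau]$ with intensity function $$\lambda_\theta^{(n)}(t)=\psi(t)+\frac{r}{\delta_n}(t-\theta)\mathbf{1}_{[\theta,\theta+\delta_n)}(t)+r\,\mathbf{1}_{[\theta+\delta_n,\tau]}(t),\qquad0\leq t\leq\tau.$$ $\mathbf{P}_\theta=\mathbf{P}_\theta^{(n)}$ is the law of $X^{(n)}$ and $\mathbf{E}_\theta$ the corresponding expectation. The likelihood (with respect to the law of $n$ independent unit-rate homogeneous Poisson processes) is $$L(\theta,X^{(n)})=\exp\Bigl\{\sum_{j=1}^n\int_0^\tau\ln\lambda_\theta^{(n)}(t)\,\mathrm{d}X_j(t)-n\int_0^\tau(\lambda_\theta^{(n)}(t)-1)\,\mathrm{d}t\Bigr\},$$ which is continuous in $\theta$ and extends continuously to $[\alpha,\beta]$. The maximum likelihood estimator $\hat\theta_n=\operatorname{argsup}_{\theta\in\Theta}L(\theta,X^{(n)})$ is any random variable (with values in $[\alpha,\beta]$) satisfying $L(\hat\theta_n,X^{(n)})=\sup_{t\in\Theta}L(t,X^{(n)})$.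 Limit process: for $a,b>0$, $a\neq b$, $$Z^\star_{a,b}(u)=\begin{cases}\exp\{\ln(a/b)\,Y^+(u)+(b-a)u\},&u\geq0,\\ \exp\{\ln(b/a)\,Y^-((-u)-)+(b-a)u\},&u\leq0,\end{cases}$$ where $Y^+$ and $Y^-$ are independent homogeneous Poisson processes on $\mathbb{R}_+$ (starting from $0$) with intensities $b$ and $a$ respectively, and $Y^-(x-)$ is the left limit at $x$ (equal to $0$ for $x=0$). $\operatorname{argsup}_{u}Z^\star_{a,b}(u)$ is the (almost surely unique) $\eta$ with $\max\{Z^\star_{a,b}(\eta-),Z^\star_{a,b}(\eta)\}=\sup_{u\in\mathbb{R}}Z^\star_{a,b}(u)$. Uniformity in $\theta\in\mathbb{K}$ means: $\sup_{\theta\in\mathbb{K}}\mathbf{P}_\theta(|\hat\theta_n-\theta|>\varepsilon)\to0$ for every $\varepsilon>0$; for every bounded continuous $g:\mathbb{R}\to\mathbb{R}$, $\mathbf{E}_\theta g(n(\hat\theta_n-\theta))\to\mathbf{E}g(\eta_{a,b})$ uniformly in $\theta\in\mathbb{K}$; and the moment convergence is uniform in $\theta\in\mathbb{K}$. *)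

(* Defs.v *)
From HB Require Import structures.
From mathcomp Require Import all_boot all_order all_algebra.
From mathcomp Require Import all_classical all_reals all_analysis.

Set Implicit Arguments.
Unset Strict Implicit.
Unset Printing Implicit Defensive.

Import Order.TTheory GRing.Theory Num.Theory.
Import numFieldNormedType.Exports.

Local Open Scope classical_set_scope.
Local Open Scope ring_scope.

Definition mutually_independent d (T : measurableType d) (R : realType)
    (P : probability T R) (I : eqType) (F : I -> set_system T) : Prop :=
  forall J : seq I, uniq J ->
  forall A : I -> set T, (forall i, i \in J -> F i (A i)) ->
  P (\bigcap_(i in [set` J]) A i) = (\prod_(i <- J) P (A i))%E.

Definition process_sigma_algebra (R : realType) d (T : measurableType d)
    (D : set R) (X : R -> T -> nat) : set_system T :=
  <<s \bigcup_(t in D) preimage_set_system setT (X t) measurable >>.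

Record counting_path (R : realType) (D : set R) (x : R -> nat) : Prop := {
  counting_path0 : x 0 = 0%N ;
  counting_path_homo : forall s t, D s -> D t -> s <= t -> (x s <= x t)%N ;
  counting_path_right : forall t, D t -> x @ within D t^'+ --> x t }.

(* The time set D is `[0, tau] or `[0, +oo[, and lam is positive on D.  The
   subtraction in nat is not truncating for s <= t in D, since every path is
   nondecreasing on D.  A finite sequence of times of D extends, by repeating
   its last term, to an infinite nondecreasing sequence. *)
Record poisson_process d (T : measurableType d) (R : realType)
    (P : probability T R) (D : set R) (lam : R -> R) (X : R -> T -> nat)
    : Prop := {
  poisson_process_measurable : forall t, D t -> measurable_fun setT (X t) ;
  poisson_process_path : forall w, counting_path D (X ^~ w) ;
  poisson_process_law : forall s t, D s -> D t -> s < t -> forall k : nat,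
    P [set w | (X t w - X s w)%N = k] =
    (poisson_pmf (\int[lebesgue_measure]_(u in `[s, t]) lam u) k)%:E ;
  poisson_process_indep : forall t : nat -> R,
    (forall i, D (t i)) -> nondecreasing_seq t ->
    mutually_independent P (fun i : nat =>
      g_sigma_algebra_preimage (fun w => (X (t i.+1) w - X (t i) w)%N)) }.

Definition left_lim (R : realType) (f : R -> R) (t : R) : R :=
  lim (f s @[s --> t^'-]).

Definition jump (R : realType) (x : R -> nat) (t : R) : R :=
  (x t)%:R - left_lim (fun s => (x s)%:R) t.

(* Integral over ]0, tau] of f with respect to a counting path x: the sum over
   the finitely many jump times of x, none of them at 0 since x 0 = 0. *)
Definition path_integral (R : realType) (tau : R) (f : R -> R) (x : R -> nat)
    : R :=
  \sum_(t \in `]0, tau]%classic) (f t * jump x t).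

(* dn stands for delta_n. *)
Definition intensity (R : realType) (tau : R) (psi : R -> R) (r dn theta t : R)
    : R :=
  psi t + r / dn * (t - theta) * \1_(`[theta, theta + dn[%classic) t
  + r * \1_(`[theta + dn, tau]%classic) t.

Definition likelihood (R : realType) (tau : R) (psi : R -> R) (r dn : R)
    (n : nat) (theta : R) (x : 'I_n -> R -> nat) : R :=
  let lam := intensity tau psi r dn theta in
  expR (\sum_(j < n) path_integral tau (fun t => ln (lam t)) (x j)
        - n%:R * \int[lebesgue_measure]_(t in `[0, tau]) (lam t - 1)).

Definition poisson_sample d (T : measurableType d) (R : realType)
    (P : probability T R) (tau : R) (lam : R -> R) (n : nat)
    (X : 'I_n -> R -> T -> nat) : Prop :=
  (forall j, poisson_process P `[0, tau] lam (X j)) /\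
  mutually_independent P (fun j => process_sigma_algebra `[0, tau] (X j)).

Definition maximum_likelihood (R : realType) (alpha beta tau : R)
    (psi : R -> R) (r dn : R) (n : nat) (T : Type) (X : 'I_n -> R -> T -> nat)
    (thetahat : T -> R) : Prop :=
  forall w : T,
    let L theta := likelihood tau psi r dn theta (fun j t => X j t w) in
    alpha <= thetahat w <= beta /\
    L (thetahat w) = sup [set L theta | theta in `]alpha, beta[].

(* yp and ym are the paths of Y^+ and Y^-.  At u = 0 the formula for u < 0
   would also give 1, under the convention that the left limit of Y^- at 0 is 0. *)
Definition Zstar (R : realType) (a b : R) (yp ym : R -> nat) (u : R) : R :=
  if 0 <= u then expR (ln (a / b) * (yp u)%:R + (b - a) * u)
  else expR (ln (b / a) * left_lim (fun s => (ym s)%:R) (- u) + (b - a) * u).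

Definition is_argsup (R : realType) (z : R -> R) (u : R) : Prop :=
  Num.max (left_lim z u) (z u) = sup (range z).

(* eta is a version of the almost surely unique argsup. *)
Record limit_argsup d (T : measurableType d) (R : realType)
    (Q : probability T R) (a b : R) (Yp Ym : R -> T -> nat) (eta : T -> R)
    : Prop := {
  limit_Yp : poisson_process Q `[0, +oo[ (cst b) Yp ;
  limit_Ym : poisson_process Q `[0, +oo[ (cst a) Ym ;
  limit_indep : mutually_independent Q (fun i : bool =>
    process_sigma_algebra `[0, +oo[ (if i then Yp else Ym)) ;
  limit_eta : {ae Q, forall w, is_argsup (Zstar a b (Yp ^~ w) (Ym ^~ w)) (eta w)} }.

(* Uniform convergence on K for the usual distance on real numbers, not for the
   library's (bounded) metric on \bar R.  An infinite value of f n theta or of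
   g theta makes the absolute difference +oo, so convergence includes the
   finiteness of g on K. *)
Definition cvg_unif_on (R : realType) (K : set R) (f : nat -> R -> \bar R)
    (g : R -> \bar R) : Prop :=
  forall e : R, 0 < e -> \forall n \near \oo, forall theta, K theta ->
    (`|f n theta - g theta| < e%:E)%E.

(* Main.v *)
(* Cut a window around theta into cells of length h / n.  The pooled numbers of
   jumps in the cells are independent Poisson variables, and since n delta_n -> 0
   the likelihood at a grid point compares with the likelihood at the maximizer as
   it would for a sharp jump: the logarithm of their ratio is a deterministic drift
   minus ln (hi / lo) times the number of jumps in between, up to errors of one
   cell.  The limit process Z* admits the same description on a grid of step h.

   Two consequences hold for both models at once.  First, Chernoff bounds give
   exponential moments of n (thetahat - theta) and of eta that are bounded
   uniformly in n and theta.  Secondly, outside the event that some cell contains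
   two jumps, or that two near maxima of the likelihood compete, the position of
   the maximizer is up to a few cells a function of the counts.  This event has
   probability O(h), so the mean of a bounded continuous function at the maximizer
   is close to a finite sum depending continuously on the Poisson means, and these
   means converge uniformly.  This gives the weak convergence; the exponential
   moments upgrade it to convergence of moments and yield consistency. *)
Require Import Defs.
From HB Require Import structures.
From mathcomp Require Import all_boot all_order all_algebra.
From mathcomp Require Import all_classical all_reals all_analysis.
From mathcomp Require Import measurable_realfun.
From mathcomp Require Import zify ring lra.

Set Implicit Arguments.
Unset Strict Implicit.
Unset Printing Implicit Defensive.

Import Order.TTheory GRing.Theory Num.Theory.
Import numFieldNormedType.Exports.

Local Open Scope classical_set_scope.
Local Open Scope ring_scope.

(** * Poisson counts *)

(** The usual route, weak convergence of the likelihood ratio process in a Skorokhod space followed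
    by continuity of argsup, is replaced by inequalities with explicit constants. They depend on
    [theta] only through bounds of the intensity and the distance of [K] to [alpha] and [beta],
    which is where uniformity comes from. The error O(h) has the following origin. A jump is worth
    [s = ln (hi / lo) / (rho * h)] cells of drift. Two distant near maxima both have a jump close to
    them, and an integer number [q] of jumps balances the drift between them; so two occupied cells
    lie at a distance close to [q * s]. There are about [1 / h] choices of the first cell, a number
    of values of [q] bounded independently of [h], boundedly many second cells for each, and every
    pair is occupied with probability O(h^2). The order of the choices is essential: the window,
    then [h], and only then [n]. Factors such as [2 ^ N], with [N] the number of cells, are then
    harmless. *)

Section poisson_pmf_facts.
Context {R : realType}.
Implicit Types a b : R.

Lemma poisson_pmfE a k : 0 < a ->
  poisson_pmf a k = a ^+ k / k`!%:R * expR (- a).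
Proof. by move=> a0; rewrite /poisson_pmf a0. Qed.

Lemma poisson_pmfD a b k : 0 < a -> 0 < b ->
  \sum_(l < k.+1) poisson_pmf a l * poisson_pmf b (k - l) =
  poisson_pmf (a + b) k.
Proof.
move=> a0 b0; rewrite poisson_pmfE ?addr_gt0//.
rewrite [a + b]addrC exprDn opprD expRD mulr_suml mulr_suml.
apply: eq_bigr => -[l /=]; rewrite ltnS => lk _.
rewrite !poisson_pmfE// -(bin_fact lk) !natrM -mulr_natr.
have ne n : n`!%:R != 0 :> R by rewrite pnatr_eq0 -lt0n fact_gt0.
have nb : 'C(k, l)%:R != 0 :> R by rewrite pnatr_eq0 -lt0n bin_gt0.
by field; rewrite !ne nb.
Qed.

Lemma poisson_pmf_pgf a x : 0 < a -> 0 <= x ->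
  (\sum_(k <oo) (poisson_pmf a k * x ^+ k)%:E = (expR (a * (x - 1)))%:E)%E.
Proof.
move=> a0 x0.
transitivity ((expR (- a))%:E * \sum_(k <oo) (exp_coeff (a * x) k)%:E)%E.
  rewrite -nneseriesZl; last first.
    by move=> k _; rewrite lee_fin exp_coeff_ge0// mulr_ge0// ltW.
  apply: eq_eseriesr => k _; rewrite -EFinM poisson_pmfE// /exp_coeff /= exprMn.
  by congr EFin; rewrite !mulrA; ring.
rewrite mulrBr mulr1 expRD [expR (a * x) * _]mulrC EFinM; congr (_ * _)%E.
have c := @is_cvg_series_exp_coeff R (a * x).
rewrite [expR (a * x)]/expR -EFin_lim//; apply/congr_lim/funext => n /=.
by rewrite /series /= -sumEFin.
Qed.

Lemma poisson_pmf_le1 a k : poisson_pmf a k <= 1.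
Proof.
rewrite /poisson_pmf; case: ifPn => // a0.
rewrite expRN ler_pdivrMr ?expR_gt0// mul1r.
have := @exp_coeff_ge0 R a => /(_ _ (ltW a0)) p.
rewrite /expR.
apply: (@le_trans _ _ (series (exp_coeff a) k.+1)).
  rewrite /series /= big_nat_recr//= lerDr sumr_ge0// => i _; exact: p.
apply: nondecreasing_cvgn_le; last exact: is_cvg_series_exp_coeff.
apply/nondecreasing_seqP => n; rewrite /series /= big_nat_recr//= lerDl; exact: p.
Qed.

Lemma expR_lipN a b : 0 <= a -> 0 <= b -> `|expR (- a) - expR (- b)| <= `|a - b|.
Proof.
wlog ab : a b / a <= b.
  move=> W a0 b0; have [/W|/ltW/W] := leP a b; first exact.
  by rewrite distrC (distrC a); apply.
move=> a0 b0; rewrite ger0_norm; last by rewrite subr_ge0 ler_expR lerN2.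
rewrite distrC ger0_norm ?subr_ge0//.
have -> : expR (- a) - expR (- b) = expR (- a) * (1 - expR (- (b - a))).
  by rewrite mulrBr mulr1 -expRD; congr (_ - expR _); ring.
have h1 : expR (- a) <= 1 by rewrite -expR0 ler_expR oppr_le0.
have h2 : 1 - expR (- (b - a)) <= b - a.
  by have := expR_ge1Dx (- (b - a)); lra.
have h3 : 0 <= 1 - expR (- (b - a)).
  by rewrite subr_ge0 -expR0 ler_expR oppr_le0 subr_ge0.
have := expR_gt0 (- a); nra.
Qed.

(** Only the values 0 and 1 occur: cells with two jumps belong to the exceptional event, so a
    configuration is a boolean vector. This is the source of continuity in the Poisson means. *)
Lemma poisson_pmf_bool_lip a b (i : bool) : 0 < a -> 0 < b ->
  `|poisson_pmf a i - poisson_pmf b i| <= (1 + b) * `|a - b|.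
Proof.
move=> a0 b0; have L := expR_lipN (ltW a0) (ltW b0).
have h1 : expR (- a) <= 1 by rewrite -expR0 ler_expR oppr_le0 ltW.
have := expR_gt0 (- a).
rewrite !poisson_pmfE//; case: i => /=; rewrite ?fact0 ?fact1 ?expr0 ?expr1 !divr1 ?mul1r.
  move=> p; have -> : a * expR (- a) - b * expR (- b) =
    (a - b) * expR (- a) + b * (expR (- a) - expR (- b)) by ring.
  rewrite (le_trans (ler_normD _ _))// !normrM (gtr0_norm p) (gtr0_norm b0) mulrDl mul1r.
  by rewrite lerD// ?ler_pM2l// -[leRHS]mulr1 ler_wpM2l.
move=> _; rewrite ?mul1r; apply: (le_trans L).
by rewrite mulrDl mul1r lerDl mulr_ge0 // ltW.
Qed.

End poisson_pmf_facts.

Section counts.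
Context d (T : measurableType d) (R : realType) (P : probability T R).
Implicit Types (N : nat) (z : nat -> T -> nat) (mu : nat -> R) (E : set T).

Definition counts N z (v : nat -> nat) : set T :=
  [set w | forall i, (i < N)%N -> z i w = v i].

(* Conditioning on an event [E] of probability [C] is what makes inductions on
   the number of cells go through; the plain law is [E = setT], [C = 1]. *)
Definition poisson_counts_on E (C : R) N z mu :=
  forall v, P (E `&` counts N z v) =
    (C * \prod_(i < N) poisson_pmf (mu i) (v i))%:E.

Definition poisson_counts N z mu := poisson_counts_on setT 1 N z mu.

Lemma counts0 z v : counts 0 z v = setT.
Proof. by apply/seteqP; split. Qed.

Lemma countsS N z v : counts N.+1 z v =
  [set w | z 0%N w = v 0%N] `&` counts N (fun i => z i.+1) (fun i => v i.+1).
Proof.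
apply/seteqP; split => w.
  by move=> h; split => /=; [exact: h|move=> i iN; exact: h].
by move=> [/= h0 h1] [|i] //; exact: h1.
Qed.

Lemma measurable_eqn (f : T -> nat) k : measurable_fun setT f ->
  measurable [set w | f w = k].
Proof. by move=> mf; have := mf measurableT [set k] I; rewrite setTI. Qed.

Lemma measurable_counts N z v :
  (forall i, (i < N)%N -> measurable_fun setT (z i)) ->
  measurable (counts N z v).
Proof.
elim: N z v => [|N IH] z v mz; first by rewrite counts0.
rewrite countsS; apply: measurableI.
  by apply: measurable_eqn; exact: mz.
by apply: IH => i iN; exact: mz.
Qed.

(** The value of the first count joins the conditioning event, and its probability joins the
    constant. *)
Lemma poisson_counts_onS E C N z mu k : poisson_counts_on E C N.+1 z mu ->
  poisson_counts_on (E `&` [set w | z 0%N w = k]) (C * poisson_pmf (mu 0%N) k)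
    N (fun i => z i.+1) (fun i => mu i.+1).
Proof.
move=> h v; have := h (fun i => if i is j.+1 then v j else k).
by rewrite countsS setIA big_ord_recl /= mulrA => ->.
Qed.

(** Splitting [E] by the value of the first count makes the first factor constant on each piece,
    where the induction hypothesis applies by [poisson_counts_onS]. *)
Lemma integral_poisson_counts_on E C N z mu (f : nat -> nat -> R) (S : nat -> R) :
  0 <= C -> measurable E ->
  (forall i, (i < N)%N -> measurable_fun setT (z i)) ->
  (forall i k, 0 <= f i k) ->
  (forall i, (i < N)%N ->
    \sum_(k <oo) (poisson_pmf (mu i) k * f i k)%:E = (S i)%:E)%E ->
  poisson_counts_on E C N z mu ->
  (\int[P]_(w in E) (\prod_(i < N) f i (z i w))%:E = (C * \prod_(i < N) S i)%:E)%E.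
Proof.
elim: N E C z mu f S => [|N IH] E C z mu f S C0 mE mz f0 fS h.
  under eq_integral do rewrite big_ord0.
  have := h (fun=> 0%N); rewrite !big_ord0 counts0 setIT mulr1 => hE.
  by rewrite integral_cst// [X in (_ * X)%E]hE mul1e.
pose F k := E `&` [set w | z 0%N w = k].
have EF : E = \bigcup_k F k.
  apply/seteqP; split => w; first by move=> Ew; exists (z 0%N w).
  by move=> [k _ []].
have mF k : measurable (F k).
  by apply: measurableI => //; apply: measurable_eqn; exact: mz.
have mf i : (i < N.+1)%N -> measurable_fun setT (fun w => f i (z i w)).
  move=> iN; apply: (measurableT_comp (f := f i)) => //; exact: mz.
have mprod : measurable_fun setT (fun w => \prod_(i < N.+1) f i (z i w)).
  by apply: measurable_prod => i _; exact: mf.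
rewrite [in LHS]EF ge0_integral_bigcup//; last 3 first.
- rewrite -EF; apply: measurable_funS (subsetT _) _ => //.
  exact/measurable_EFinP.
- by move=> w _; rewrite lee_fin prodr_ge0.
- apply/trivIsetP => i j _ _ /eqP ij; apply/seteqP; split => w //.
  by move=> [[_ /= a] [_ /= b]]; apply: ij; rewrite -a -b.
transitivity (\sum_(k <oo)
    ((C * \prod_(i < N) S i.+1)%:E * (poisson_pmf (mu 0%N) k * f 0%N k)%:E))%E.
  apply: eq_eseriesr => k _.
  transitivity (\int[P]_(w in F k)
      ((f 0%N k)%:E * (\prod_(i < N) f i.+1 (z i.+1 w))%:E))%E.
    by apply: eq_integral => w /set_mem [_ /= <-]; rewrite big_ord_recl.
  rewrite ge0_integralZl_EFin//; last 2 first.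
  - by move=> w _; rewrite lee_fin prodr_ge0.
  - apply: measurable_funS (subsetT _) _ => //; apply/measurable_EFinP.
    by apply: measurable_prod => i _; apply: (mf i.+1); rewrite ltnS.
  rewrite (IH _ _ _ _ (fun i => f i.+1) (fun i => S i.+1) _ _ _ _ _ (poisson_counts_onS k h))//.
  - by rewrite -!EFinM; congr EFin; ring.
  - by rewrite mulr_ge0 // poisson_pmf_ge0.
  - exact: (mF k).
  - by move=> i iN; exact: mz.
  - by move=> i iN; exact: (fS i.+1).
rewrite nneseriesZl; last by move=> k _; rewrite lee_fin mulr_ge0// poisson_pmf_ge0.
by rewrite fS// -EFinM big_ord_recl; congr EFin; rewrite /= -mulrA [S _ * _]mulrC.
Qed.

Lemma measurable_sumn n (f : nat -> T -> nat) :
  (forall j, (j < n)%N -> measurable_fun setT (f j)) ->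
  measurable_fun setT (fun w => \sum_(j < n) f j w)%N.
Proof.
elim: n => [|n IH] mf; first by under eq_fun do rewrite big_ord0; exact: measurable_cst.
under eq_fun do rewrite big_ord_recr; apply: measurable_fun_addn; last exact: mf.
by apply: IH => j jn; apply: mf; rewrite ltnW.
Qed.

(** Superposition, cell by cell. The first cell is split by the share [l] of [z], the share of [z']
    then being [v 0 - l]; [poisson_pmfD] resums the pieces once the induction hypothesis has treated
    the other cells. *)
Lemma poisson_counts_on_add E C N z z' mu mu' : measurable E ->
  (forall i, (i < N)%N -> measurable_fun setT (z i)) ->
  (forall i, (i < N)%N -> measurable_fun setT (z' i)) ->
  (forall i, 0 < mu i) -> (forall i, 0 < mu' i) ->
  (forall v v', P (E `&` (counts N z v `&` counts N z' v')) =
     (C * (\prod_(i < N) poisson_pmf (mu i) (v i) *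
           \prod_(i < N) poisson_pmf (mu' i) (v' i)))%:E) ->
  poisson_counts_on E C N (fun i w => z i w + z' i w)%N (fun i => mu i + mu' i).
Proof.
elim: N E C z z' mu mu' => [|N IH] E C z z' mu mu' mE mz mz' mu0 mu'0 h v.
  have := h v v; rewrite !counts0 !big_ord0 setIT mulr1 => ->.
  by rewrite mulr1.
pose F l := E `&` ([set w | z 0%N w = l] `&` [set w | z' 0%N w = (v 0%N - l)%N]).
pose cS := counts N (fun i w => z i.+1 w + z' i.+1 w)%N (fun i => v i.+1).
have mF l : measurable (F l).
  by apply: measurableI => //; apply: measurableI;
    apply: measurable_eqn; [exact: mz|exact: mz'].
have mcS : measurable cS.
  by apply: measurable_counts => i iN; apply: measurable_fun_addn; [exact: mz|exact: mz'].
have -> : E `&` counts N.+1 (fun i w => (z i w + z' i w)%N) v =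
    \big[setU/set0]_(l < (v 0%N).+1) (F l `&` cS).
  rewrite -(bigcup_mkord _ (fun l => F l `&` cS)) countsS.
  apply/seteqP; split => w.
    move=> [Ew [/= w0 wS]]; exists (z 0%N w); first by rewrite /= -w0 ltnS leq_addr.
    by split => //; split => //; split => //=; rewrite -w0 addKn.
  move=> [l /= lv] [[Ew [/= z0 z'0]] wS]; split => //; split => //=.
  by rewrite z0 z'0 subnKC.
rewrite measure_bigsetU_ord; last 2 first.
- by move=> l; apply: measurableI.
- apply/trivIsetP => i j _ _ /eqP ij; apply/seteqP; split => w //.
  move=> [[[_ [/= a _]] _] [[_ [/= b _]] _]]; apply: ij; apply/val_inj => /=.
  by rewrite -a -b.
rewrite big_ord_recl/= -poisson_pmfD// mulr_suml mulr_sumr -sumEFin.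
apply: eq_bigr => -[l /= lv] _.
rewrite (IH (F l) (C * (poisson_pmf (mu 0%N) l * poisson_pmf (mu' 0%N) (v 0%N - l)))
  (fun i => z i.+1) (fun i => z' i.+1) (fun i => mu i.+1) (fun i => mu' i.+1))//.
- by congr EFin; rewrite -!mulrA.
- by move=> i iN; exact: mz.
- by move=> i iN; exact: mz'.
move=> u u'.
have := h (fun i => if i is j.+1 then u j else l)
          (fun i => if i is j.+1 then u' j else (v 0%N - l)%N).
rewrite !countsS !big_ord_recl /= => H.
have -> : F l `&` (counts N (fun i => z i.+1) u `&` counts N (fun i => z' i.+1) u') =
  E `&` (([set w | z 0%N w = l] `&` counts N (fun i => z i.+1) u) `&`
  ([set w | z' 0%N w = (v 0%N - l)%N] `&` counts N (fun i => z' i.+1) u')).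
  by rewrite /F -setIA; congr (_ `&` _); rewrite setIACA.
by rewrite [LHS]H; congr EFin; ring.
Qed.

(** Iterated superposition; independence of the families is contained in their joint law. At least
    one family is required: an empty sum would have mean 0, outside the range of the Poisson
    formula. *)
Lemma poisson_counts_on_sum E C N n (z : nat -> nat -> T -> nat) mu :
  measurable E ->
  (forall j i, (j <= n)%N -> (i < N)%N -> measurable_fun setT (z j i)) ->
  (forall i, 0 < mu i) ->
  (forall v : nat -> nat -> nat,
     P (E `&` [set w | forall j, (j <= n)%N -> counts N (z j) (v j) w]) =
     (C * \prod_(j < n.+1) \prod_(i < N) poisson_pmf (mu i) (v j i))%:E) ->
  poisson_counts_on E C N (fun i w => \sum_(j < n.+1) z j i w)%N
    (fun i => n.+1%:R * mu i).
Proof.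
elim: n E C z => [|n IH] E C z mE mz mu0 h.
  rewrite (_ : (fun i => _ * mu i) = mu); last by apply/funext => i; rewrite mul1r.
  move=> v; have := h (fun=> v); rewrite big_ord1 => <-; congr (P (_ `&` _)).
  apply/seteqP; split => w /=.
    by move=> H j; rewrite leqn0 => /eqP -> i iN; rewrite -(H i iN) big_ord1.
  by move=> H i iN; rewrite big_ord1; exact: H.
have -> : (fun i w => \sum_(j < n.+2) z j i w)%N =
    (fun i w => z 0%N i w + \sum_(j < n.+1) z j.+1 i w)%N.
  by apply/funext => i; apply/funext => w; rewrite big_ord_recl.
have -> : (fun i => n.+2%:R * mu i) = (fun i => mu i + n.+1%:R * mu i).
  by apply/funext => i; rewrite -[n.+2%:R]natr1; ring.
apply: poisson_counts_on_add => //.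
- by move=> i iN; exact: mz.
- move=> i iN; apply: (measurable_sumn (f := fun j => z j.+1 i)) => j jn; exact: mz.
- by move=> i; rewrite mulr_gt0.
move=> v v'; rewrite setIA.
rewrite (IH (E `&` counts N (z 0%N) v) (C * \prod_(i < N) poisson_pmf (mu i) (v i))
  (fun j => z j.+1)).
- by rewrite mulrA.
- apply: measurableI => //; apply: measurable_counts => i iN; exact: mz.
- by move=> j i jn iN; exact: mz.
- by [].
move=> u; have := h (fun j => if j is j'.+1 then u j' else v).
rewrite big_ord_recl /= mulrA => <-; rewrite -setIA; congr (P (_ `&` _)).
apply/seteqP; split => w /=.
  by move=> [H0 HS] [|j] //= jn; exact: HS.
by move=> H; split; [exact: (H 0%N)|move=> j jn; exact: (H j.+1)].
Qed.

Lemma poisson_counts_eq E C N z z' mu mu' :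
  (forall i w, (i < N)%N -> z i w = z' i w) ->
  (forall i, (i < N)%N -> mu i = mu' i) ->
  poisson_counts_on E C N z mu -> poisson_counts_on E C N z' mu'.
Proof.
move=> zz' mumu' h v; have -> : counts N z' v = counts N z v.
  by apply/seteqP; split => w H i iN; [rewrite zz'|rewrite -zz']; rewrite ?H.
by rewrite h; congr (_ * _)%:E; apply: eq_bigr => i _; rewrite mumu'.
Qed.

(** For grids that run backwards in time: the increments of a process come in the order of
    increasing times. *)
Lemma poisson_counts_rev N z mu : poisson_counts N z mu ->
  poisson_counts N (fun i => z (N - i.+1)%N) (fun i => mu (N - i.+1)%N).
Proof.
move=> h v; have := h (fun i => v (N - i.+1)%N); rewrite !setTI => hv.
transitivity (P (counts N z (fun i => v (N - i.+1)%N))).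
  have rK i : (i < N)%N -> ((N - i.+1 < N) /\ (N - (N - i.+1).+1 = i))%N by lia.
  congr (P _); apply/seteqP; split => w H i iN; have [Ni Nii] := rK i iN.
    by have := H _ Ni; rewrite Nii.
  by rewrite (H _ Ni) Nii.
rewrite hv; congr (1 * _)%:E; rewrite (reindex_inj rev_ord_inj) /=.
by apply: eq_bigr => i _; rewrite /= subnSK// subKn// ltnW.
Qed.

Lemma integral_poisson_counts_pgf N z mu (x : nat -> R) :
  (forall i, (i < N)%N -> measurable_fun setT (z i)) ->
  (forall i, (i < N)%N -> 0 < mu i) -> (forall i, 0 <= x i) ->
  poisson_counts N z mu ->
  (\int[P]_w (\prod_(i < N) x i ^+ z i w)%:E =
   (expR (\sum_(i < N) mu i * (x i - 1)))%:E)%E.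
Proof.
move=> mz mu0 x0 h.
rewrite (integral_poisson_counts_on (f := fun i k => x i ^+ k)
  (S := fun i => expR (mu i * (x i - 1))) _ _ _ _ _ h)//.
- by rewrite mul1r expR_sum.
- by move=> i k; exact: exprn_ge0.
- by move=> i iN; apply: poisson_pmf_pgf => //; exact: mu0.
Qed.

(** Markov's inequality for a product of powers. The bases may lie on either side of 1, which serves
    right tails, left tails and events in a few chosen cells alike. *)
Lemma poisson_counts_chernoff N z mu (x : nat -> R) K (A : set T) :
  measurable A ->
  (forall i, (i < N)%N -> measurable_fun setT (z i)) ->
  (forall i, (i < N)%N -> 0 < mu i) -> (forall i, 0 <= x i) -> 0 <= K ->
  poisson_counts N z mu ->
  (forall w, A w -> 1 <= K * \prod_(i < N) x i ^+ z i w) ->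
  (P A <= (K * expR (\sum_(i < N) mu i * (x i - 1)))%:E)%E.
Proof.
move=> mA mz mu0 x0 K0 h AK.
have mp : measurable_fun setT (fun w => \prod_(i < N) x i ^+ z i w).
  apply: measurable_prod => i _; apply: (measurableT_comp (f := fun k => x i ^+ k)) => //.
  exact: mz.
have p0 w : 0 <= \prod_(i < N) x i ^+ z i w.
  by apply: prodr_ge0 => i _; exact: exprn_ge0.
rewrite EFinM -(integral_poisson_counts_pgf mz mu0 x0 h) -ge0_integralZl_EFin//; last 2 first.
- by move=> w _; rewrite lee_fin.
- exact/measurable_EFinP.
rewrite -[leLHS]mul1e -integral_cst//.
apply: (@le_trans _ _ (\int[P]_(w in A)
    (K%:E * (\prod_(i < N) x i ^+ z i w)%:E))%E); last first.
  apply: ge0_subset_integral => //.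
  - by apply: emeasurable_funM => //; apply/measurable_EFinP.
  - by move=> w _; rewrite mule_ge0 ?lee_fin.
apply: ge0_le_integral => //.
  by apply: emeasurable_funM => //; apply/measurable_EFinP;
     apply: measurable_funS (subsetT _) _.
Qed.

(* Chernoff's bound with the base [1 / m]. *)
Lemma poisson_counts_two N z mu m p q : (p < N)%N -> (q < N)%N ->
  (forall i, (i < N)%N -> measurable_fun setT (z i)) ->
  (forall i, (i < N)%N -> 0 < mu i <= m) -> m <= 1 ->
  poisson_counts N z mu ->
  (P [set w | (2 <= if p == q then z p w else z p w + z q w)%N] <=
   (expR 2 * m ^+ 2)%:E)%E.
Proof.
move=> pN qN mz mum m1 h.
have m0 : 0 < m by have /andP[a b] := mum _ pN; exact: lt_le_trans b.
pose x i := if (i == p) || (i == q) then m^-1 else 1.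
have x0 i : 0 <= x i by rewrite /x; case: ifP => // _; rewrite invr_ge0 ltW.
have mi1 : 1 <= m^-1 by rewrite invf_ge1.
have zE w : \prod_(i < N) x i ^+ z i w =
    m^-1 ^+ (if p == q then z p w else z p w + z q w).
  rewrite (bigD1 (Ordinal pN))//= {1}/x eqxx /=.
  have [pq|pq] := eqVneq p q.
    rewrite big1 ?mulr1// => i /eqP ip; rewrite /x -pq orbb.
    by case: eqP => [ip'|]; [case: ip; exact: val_inj|rewrite expr1n].
  rewrite (bigD1 (Ordinal qN))/=; last by rewrite -val_eqE /= eq_sym.
  rewrite {1}/x eqxx orbT big1 ?mulr1 ?exprD// => i /andP[/eqP ip /eqP iq].
  rewrite /x; case: eqP => [ip'|_]; first by case: ip; exact: val_inj.
  by case: eqP => [ip'|]; [case: iq; exact: val_inj|rewrite expr1n].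
have sE : \sum_(i < N) mu i * (x i - 1) <= 2.
  have b i : (i < N)%N -> mu i * (m^-1 - 1) <= 1.
    move=> /mum /andP[mu0 mm]; rewrite (le_trans (ler_wpM2r _ mm)) ?subr_ge0//.
    by rewrite mulrBr mulr1 mulfV ?gt_eqF//; lra.
  rewrite (bigD1 (Ordinal pN))//= {1}/x eqxx /=.
  have [pq|pq] := eqVneq p q.
    rewrite big1 ?addr0 => [|i /eqP ip]; first by rewrite (le_trans (b _ pN))// ler1n.
    rewrite /x -pq orbb; case: eqP => [ip'|]; first by case: ip; exact: val_inj.
    by rewrite subrr mulr0.
  rewrite (bigD1 (Ordinal qN))/=; last by rewrite -val_eqE /= eq_sym.
  rewrite {1}/x eqxx orbT big1 ?addr0 => [|i /andP[/eqP ip /eqP iq]].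
    by have := b _ pN; have := b _ qN; lra.
  rewrite /x; case: eqP => [ip'|_]; first by case: ip; exact: val_inj.
  by case: eqP => [ip'|]; [case: iq; exact: val_inj|rewrite subrr mulr0].
apply: (@le_trans _ _ (m ^+ 2 * expR (\sum_(i < N) mu i * (x i - 1)))%:E).
  apply: poisson_counts_chernoff => //; last 3 first.
  - by move=> i /mum /andP[].
  - by rewrite exprn_ge0// ltW.
  - move=> w /= h2; rewrite zE exprVn ler_pdivlMr ?exprn_gt0// mul1r.
    by rewrite ler_wiXn2l// ltW.
  have -> : [set w | (2 <= if p == q then z p w else z p w + z q w)%N] =
      (fun w => if p == q then z p w else (z p w + z q w)%N) @^-1` [set k | (2 <= k)%N].
    by [].
  rewrite -[X in measurable X]setTI.
  suff : measurable_fun setT (fun w => if p == q then z p w else (z p w + z q w)%N).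
    by apply.
  have [_|_] := boolP (p == q); first exact: mz.
  by apply: measurable_fun_addn; exact: mz.
  exact: mz.
by rewrite lee_fin mulrC ler_wpM2r ?exprn_ge0 ?(ltW m0)// ler_expR.
Qed.

End counts.

(** * Maximizers determined by cell counts *)

Section near_argmax_cells.
Context {R : realType}.
Implicit Types (s : R) (z : nat -> nat) (N k : nat).

(** What the counts reveal when a near maximizer lies in cell [k]: no grid point [j] beats it. The
    unit is one cell of drift, and a jump is worth [s] units. Cells next to the end points are left
    out on one side and added on the other, since the position of their jumps is not known precisely
    enough; the 3 absorbs rounding and the variation of the jump sizes. *)
Definition argmax_cell N s z k := forall j, (0 < j <= N)%N ->
  ((k < j)%N ->
     s * (\sum_(k.+2 <= m < j.-1) z m)%:R <= j%:R - k%:R + 3) /\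
  ((j < k)%N ->
     k%:R - j%:R - 3 <= s * (\sum_(j.-1 <= m < k.+2) z m)%:R).

(* Two occupied cells whose distance is close to a multiple of [s]: this is
   what the coincidence of two well separated near maxima entails. *)
Definition resonance N s z := exists p p' q : nat,
  [/\ (p < p' < N)%N, (0 < z p)%N, (0 < z p')%N, (0 < q)%N &
      `|p'%:R - p%:R - q%:R * s| <= 12].

Lemma argmax_cell_eq N s z z' k : (k.+2 < N)%N ->
  (forall i, (i < N)%N -> z i = z' i) ->
  argmax_cell N s z k -> argmax_cell N s z' k.
Proof.
move=> kN zz' H j jN; have [H1 H2] := H j jN; split => kj.
  have := H1 kj; rewrite (eq_big_nat _ _ (F2 := z'))// => i /andP[_ ij].
  by apply: zz'; lia.
have := H2 kj; rewrite (eq_big_nat _ _ (F2 := z'))// => i /andP[_ ij].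
by apply: zz'; lia.
Qed.

(** Compare with the grid point [k - 4]: four cells of drift less the tolerance 3 must be paid for
    by at least one jump, in one of the cells [k - 5] to [k + 1]. *)
Lemma argmax_cell_occupied N s z k : (4 < k)%N -> (k <= N)%N ->
  argmax_cell N s z k ->
  exists p, (0 < z p)%N /\ (k <= p + 5)%N /\ (p <= k.+1)%N.
Proof.
move=> k4 kN H; have /H[_ H2] : (0 < k - 4 <= N)%N by lia.
have : (0 < \sum_((k - 4).-1 <= m < k.+2) z m)%N.
  rewrite lt0n; apply/negP => /eqP e0; have /H2 : (k - 4 < k)%N by lia.
  by rewrite e0 mulr0 natrB; [lra|lia].
rewrite lt0n sum_nat_seq_neq0 => /hasP[p].
rewrite mem_index_iota => /andP[p1 p2] /=; rewrite -lt0n => zp.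
by exists p; split => //; lia.
Qed.

(** The grid points [k' + 3] for [k] and [k + 3] for [k'] make both comparisons involve the same
    number [q] of jumps, those in the cells [k + 2] to [k' + 1]. Hence [q * s] is within 6 of
    [k' - k]; passing to the occupied cells near [k] and [k'] costs at most 6 more, whence the 12 in
    [resonance]. *)
Lemma argmax_cell_unique N s z k k' : (4 < k)%N -> (k + 7 <= k')%N ->
  (k' + 3 <= N)%N -> argmax_cell N s z k -> argmax_cell N s z k' ->
  resonance N s z.
Proof.
move=> k4 kk' kN H H'.
have kN1 : (k <= N)%N by lia.
have k'4 : (4 < k')%N by lia.
have k'N : (k' <= N)%N by lia.
have [p [zp [kp pk]]] := argmax_cell_occupied k4 kN1 H.
have [p' [zp' [kp' pk']]] := argmax_cell_occupied k'4 k'N H'.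
have /H[+ _] : (0 < k' + 3 <= N)%N by lia.
have kk3 : (k < k' + 3)%N by lia.
move=> /(_ kk3) H1.
have /H'[_ +] : (0 < k + 3 <= N)%N by lia.
have kk4 : (k + 3 < k')%N by lia.
move=> /(_ kk4) H2.
move: H1 H2; have -> : ((k' + 3).-1 = k'.+2)%N by lia.
have -> : ((k + 3).-1 = k.+2)%N by lia.
rewrite !natrD; set q := (\sum_(_ <= m < _) _)%N => H1 H2.
have q0 : (0 < q)%N.
  rewrite lt0n; apply/eqP => q0; move: H2; rewrite q0 mulr0.
  have : (k + 7)%:R <= k'%:R :> R by rewrite ler_nat.
  by rewrite natrD; lra.
exists p, p', q; split => //; first lia.
move: H1 H2 kp pk kp' pk'; rewrite -[k.+1]addn1 -[k'.+1]addn1 -!(ler_nat R) !natrD => *.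
by rewrite ler_norml; apply/andP; split; lra.
Qed.

End near_argmax_cells.

(** * Exceptional events and means at the maximizer *)

Section bounds_in_probability.
Context d (T : measurableType d) (R : realType) (P : probability T R).
Implicit Types (X Y : T -> R) (A : nat -> set T).

Lemma union_bound n A (eps : R) : (forall i, (i < n)%N -> measurable (A i)) ->
  (forall i, (i < n)%N -> (P (A i) <= eps%:E)%E) ->
  (P (\big[setU/set0]_(i < n) A i) <= (n%:R * eps)%:E)%E.
Proof.
move=> mA PA; apply: le_trans (Boole_inequality _ mA) _.
apply: (@le_trans _ _ (\sum_(i < n) eps%:E)); first by apply: lee_sum => i _; exact: PA.
by rewrite sumEFin lee_fin sumr_const card_ord mulr_natl.
Qed.

Lemma integrable_bounded X B : measurable_fun setT X ->
  (forall w, `|X w| <= B) -> P.-integrable setT (EFin \o X).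
Proof.
move=> mX XB; apply: measurable_bounded_integrable => //.
  by apply: le_lt_trans (probability_le1 P measurableT) (ltry 1).
exists B; split => [|x Bx w _]; first exact: num_real.
by apply: le_trans (XB w) _; exact: ltW.
Qed.

Lemma expectation_close X Y B e (A : set T) : measurable_fun setT X ->
  measurable_fun setT Y -> measurable A -> 0 <= e ->
  (forall w, `|X w| <= B) -> (forall w, `|Y w| <= B) ->
  (forall w, ~ A w -> `|X w - Y w| <= e) ->
  (`|\int[P]_w (X w)%:E - \int[P]_w (Y w)%:E| <= e%:E + (2 * B)%:E * P A)%E.
Proof.
move=> mX mY mA e0 XB YB XYe.
have B0 : 0 <= B by apply: le_trans (XB point).
rewrite -integralB_EFin//; [|exact: integrable_bounded XB|exact: integrable_bounded YB].
apply: le_trans (le_abse_integral _ _ _) _ => //.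
  by apply: emeasurable_funB; apply/measurable_EFinP.
have -> : (e%:E + (2 * B)%:E * P A = \int[P]_w (e + 2 * B * \1_A w)%:E)%E.
  under eq_integral do rewrite EFinD EFinM.
  rewrite ge0_integralD//; last 2 first.
  - by move=> w _; rewrite -EFinM lee_fin !mulr_ge0.
  - apply: emeasurable_funM => //; exact/measurable_EFinP.
  rewrite [X in (_ = X + _)%E](_ : _ = e%:E); last first.
    by rewrite integral_cst// [X in (_ * X)%E](probability_setT P) mule1.
  congr (_ + _)%E.
  rewrite ge0_integralZl_EFin//; last 2 first.
  - exact/measurable_EFinP.
  - by rewrite mulr_ge0.
  by rewrite integral_indic// setIT.
apply: ge0_le_integral => //.
- apply: measurableT_comp => //; apply: emeasurable_funB; exact/measurable_EFinP.
- by apply/measurable_EFinP; apply: measurable_funD => //; apply: measurable_funM.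
move=> w _; rewrite -EFinB /= lee_fin indicE; have [wA|] := boolP (w \in A).
  rewrite mulr1; apply: le_trans (ler_normB _ _) _.
  by have := XB w; have := YB w; lra.
by rewrite mulr0 addr0 => /negP wA; apply: XYe => Aw; apply: wA; rewrite inE.
Qed.

End bounds_in_probability.

Section resonance_probability.
Context d (T : measurableType d) (R : realType) (P : probability T R).
Variables (N : nat) (z : nat -> T -> nat) (mu : nat -> R) (m : R).
Hypothesis mz : forall i, (i < N)%N -> measurable_fun setT (z i).
Hypothesis mum : forall i, (i < N)%N -> 0 < mu i <= m.
Hypothesis m1 : m <= 1.
Hypothesis hz : poisson_counts P N z mu.

Let pair_event p p' : set T := if (p < p' < N)%N
  then [set w | (0 < z p w)%N] `&` [set w | (0 < z p' w)%N] else set0.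

Let mpos p : (p < N)%N -> measurable [set w | (0 < z p w)%N].
Proof.
move=> pN; rewrite -[X in measurable X]setTI.
exact: (mz pN measurableT (Y := [set k | (0 < k)%N])).
Qed.

Let mpair p p' : measurable (pair_event p p').
Proof.
rewrite /pair_event; case: ifP => // /andP[pp' p'N].
by apply: measurableI; apply: mpos => //; apply: ltn_trans p'N.
Qed.

Let Ppair p p' : (P (pair_event p p') <= (expR 2 * m ^+ 2)%:E)%E.
Proof.
rewrite /pair_event; case: ifPn => [/andP[pp' p'N]|_]; last first.
  by rewrite measure0 lee_fin mulr_ge0 ?expR_ge0 ?sqr_ge0.
have pN := ltn_trans pp' p'N.
apply: le_trans (poisson_counts_two pN p'N mz mum m1 hz).
have mtwo : measurable [set w | (2 <= if p == p' then z p w else z p w + z p' w)%N].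
  rewrite ltn_eqF// -[X in measurable X]setTI.
  exact: (measurable_fun_addn (mz pN) (mz p'N) measurableT (Y := [set k | (2 <= k)%N])).
apply: le_measure; rewrite ?inE//; first by apply: measurableI; apply: mpos.
by move=> w [/= ? ?]; rewrite ltn_eqF//; lia.
Qed.

(** Given [p] and [q], at most 25 integers [p'] satisfy the inequality of [resonance], and [q] is at
    most [Q] because [q * s] cannot exceed [N + 12]. A union bound over the triples concludes, two
    given cells being both occupied with probability O(m^2). *)
Lemma resonance_bound (s : R) Q : 0 < s -> (N%:R + 12 <= Q%:R * s) ->
  exists2 A : set T, measurable A &
    (forall w, resonance N s (z ^~ w) -> A w) /\
    (P A <= (N%:R * Q.+1%:R * 25 * (expR 2 * m ^+ 2))%:E)%E.
Proof.
move=> s0 NQ.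
(* [i] counts down from the largest admissible [p'], the integer part of [p + q * s + 12]. *)
pose F p q i := pair_event p (Num.truncn (p%:R + q%:R * s + 12) - i)%N.
exists (\big[setU/set0]_(p < N) \big[setU/set0]_(q < Q.+1) \big[setU/set0]_(i < 25) F p q i).
  by do 3!(apply: bigsetU_measurable => ? _); exact: mpair.
split => [w [p [p' [q [/andP[pp' p'N] zp zp' q0 dist]]]]|].
  rewrite -(bigcup_mkord N (fun p => \big[setU/set0]_(q < Q.+1)
    \big[setU/set0]_(i < 25) F p q i)); exists p => /=; first exact: ltn_trans p'N.
  have {}dist := dist; move: dist; rewrite ler_norml => /andP[d1 d2].
  rewrite -(bigcup_mkord Q.+1 (fun q => \big[setU/set0]_(i < 25) F p q i)).
  exists q => /=.
    rewrite ltnS -(ler_nat R) -(ler_pM2r s0); apply: le_trans NQ.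
    have : p'%:R <= N%:R :> R by rewrite ler_nat ltnW.
    by have := ler0n R p; lra.
  rewrite -(bigcup_mkord 25 (fun i => F p q i)).
  have y0 : 0 <= p%:R + q%:R * s + 12 by rewrite !addr_ge0// mulr_ge0// ltW.
  have /andP[t1 t2] := truncn_itv y0.
  set t := Num.truncn _ in t1 t2 *.
  have p't : (p' <= t)%N.
    have : p'%:R < t.+1%:R :> R by apply: le_lt_trans t2; lra.
    by rewrite ltr_nat.
  exists (t - p')%N => /=.
    have : t%:R < (p' + 25)%:R :> R by rewrite natrD; apply: le_lt_trans t1 _; lra.
    by rewrite ltr_nat; lia.
  by rewrite /F -/t subKn// /pair_event pp' p'N.
have b3 p q : (P (\big[setU/set0]_(i < 25) F p q i) <= (25 * (expR 2 * m ^+ 2))%:E)%E.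
  by apply: union_bound => i _; [exact: mpair|exact: Ppair].
have b2 p : (P (\big[setU/set0]_(q < Q.+1) \big[setU/set0]_(i < 25) F p q i) <=
    (Q.+1%:R * (25 * (expR 2 * m ^+ 2)))%:E)%E.
  apply: (union_bound (A := fun q => \big[setU/set0]_(i < 25) F p q i)) => q _ //.
  by apply: bigsetU_measurable => i _; exact: mpair.
rewrite -!mulrA; apply: (union_bound
  (A := fun p => \big[setU/set0]_(q < Q.+1) \big[setU/set0]_(i < 25) F p q i)) => p _.
  by do 2!(apply: bigsetU_measurable => ? _); exact: mpair.
exact: b2.
Qed.

End resonance_probability.

Section cell_choice.
Context {R : realType}.

(** Any admissible cell will do, since two of them differ by at most 6 outside the resonances; what
    matters is that the choice depends on the counts alone. The default 0 is taken only on the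
    exceptional event. *)
Definition cell_choice N (s : R) (z : nat -> nat) : nat :=
  xget 0%N [set k | (4 < k)%N /\ (k + 3 <= N)%N /\ argmax_cell N s z k].

Definition cells01 N (v : {ffun 'I_N -> bool}) (i : nat) : nat :=
  if insub i is Some j then v j else 0%N.

(* The mean of [g] at the chosen cell when the counts are independent Poisson
   variables restricted to the configurations with at most one point per cell. *)
Definition cell_mean N M (h s : R) (g : R -> R) (mu : nat -> R) : R :=
  \sum_(v : {ffun 'I_N -> bool})
    g (((cell_choice N s (cells01 v))%:R - M%:R) * h) *
    \prod_(i < N) poisson_pmf (mu i) (cells01 v i).

Lemma cells01E N (v : {ffun 'I_N -> bool}) (i : 'I_N) : cells01 v i = v i.
Proof. by rewrite /cells01 valK. Qed.

Lemma prod_lip N (a b : nat -> R) e : (forall i, (i < N)%N -> 0 <= a i <= 1) ->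
  (forall i, (i < N)%N -> 0 <= b i <= 1) ->
  (forall i, (i < N)%N -> `|a i - b i| <= e) ->
  `|\prod_(i < N) a i - \prod_(i < N) b i| <= N%:R * e.
Proof.
elim: N => [|N IH] ha hb hab; first by rewrite !big_ord0 subrr normr0 mul0r.
rewrite !big_ord_recr /=; set A := \prod_(i < N) a i; set B := \prod_(i < N) b i.
have -> : A * a N - B * b N = (A - B) * a N + B * (a N - b N) by ring.
have /andP[a0 a1] := ha N (ltnSn N).
have IHN : `|A - B| <= N%:R * e.
  by apply: IH => i iN; [apply: ha|apply: hb|apply: hab]; rewrite ltnW.
have B01 : 0 <= B <= 1.
  have hb' (i : 'I_N) : 0 <= b i <= 1 by apply: hb; apply: ltnW; exact: ltn_ord.
  apply/andP; split; first by apply: prodr_ge0 => i _; have /andP[] := hb' i.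
  by apply: prodr_ile1 => i _; exact: hb'.
rewrite (le_trans (ler_normD _ _))// !normrM (ger0_norm a0).
have /andP[B0 B1] := B01; rewrite (ger0_norm B0).
have := hab N (ltnSn N); have := normr_ge0 (A - B); have := normr_ge0 (a N - b N).
by rewrite -natr1 mulrDl mul1r; nra.
Qed.

(** A sum over the [2 ^ N] configurations of products of [N] Lipschitz factors with values in
    [0, 1]. *)
Lemma cell_mean_lip N M h s (g : R -> R) B mu mu' e m :
  (forall x, `|g x| <= B) ->
  (forall i, (i < N)%N -> 0 < mu i) -> (forall i, (i < N)%N -> 0 < mu' i <= m) ->
  (forall i, (i < N)%N -> `|mu i - mu' i| <= e) ->
  `|cell_mean N M h s g mu - cell_mean N M h s g mu'| <=
  (2 ^ N)%:R * (B * (N%:R * ((1 + m) * e))).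
Proof.
move=> gB mu0 mu'0 mue; rewrite /cell_mean -sumrB.
rewrite (le_trans (ler_norm_sum _ _ _))//.
have -> : (2 ^ N)%N = #|{ffun 'I_N -> bool}| by rewrite card_ffun card_bool card_ord.
rewrite mulr_natl -sumr_const; apply: ler_sum => v _.
rewrite -mulrBr normrM ler_pM//.
apply: (prod_lip (a := fun i => poisson_pmf (mu i) (cells01 v i))
  (b := fun i => poisson_pmf (mu' i) (cells01 v i))) => i iN.
- by rewrite poisson_pmf_ge0 poisson_pmf_le1.
- by rewrite poisson_pmf_ge0 poisson_pmf_le1.
rewrite (cells01E v (Ordinal iN)); have /andP[mu'i mu'm] := mu'0 i iN.
apply: le_trans (poisson_pmf_bool_lip _ (mu0 _ iN) mu'i) _.
by apply: ler_pM => //; [lra|rewrite lerD2l|exact: mue].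
Qed.

End cell_choice.

Section mean_at_argmax.
Context d (T : measurableType d) (R : realType) (P : probability T R).
Variables (N M : nat) (z : nat -> T -> nat) (mu : nat -> R) (m : R).
Hypothesis mz : forall i, (i < N)%N -> measurable_fun setT (z i).
Hypothesis mum : forall i, (i < N)%N -> 0 < mu i <= m.
Hypothesis m1 : m <= 1.
Hypothesis hz : poisson_counts P N z mu.
Variables (xi : T -> R) (g : R -> R) (B h s e t : R) (A0 : set T) (Q : nat).
Hypothesis mxi : measurable_fun setT xi.
Hypothesis mg : measurable_fun setT g.
Hypothesis gB : forall x, `|g x| <= B.
Hypothesis h0 : 0 < h.
Hypothesis s0 : 0 < s.
Hypothesis NQ : N%:R + 12 <= Q%:R * s.
Hypothesis e0 : 0 <= e.
Hypothesis mA0 : measurable A0.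
Hypothesis PA0 : (P A0 <= t%:E)%E.
Hypothesis xi_cell : forall w, ~ A0 w -> (forall i, (i < N)%N -> (z i w <= 1)%N) ->
  exists k, [/\ (4 < k)%N, (k + 3 <= N)%N, argmax_cell N s (z ^~ w) k
              & `|xi w - (k%:R - M%:R) * h| <= 3 * h].
Hypothesis g_close : forall w, ~ A0 w -> forall y, `|y - xi w| <= 9 * h ->
  `|g (xi w) - g y| <= e.

Let pos (v : {ffun 'I_N -> bool}) : R :=
  ((cell_choice N s (cells01 v))%:R - M%:R) * h.

(** As a finite sum over configurations it is visibly measurable, with mean [cell_mean]. It is [g]
    at the chosen cell, and 0 as soon as some cell contains two jumps. *)
Let Y (w : T) : R := \sum_(v : {ffun 'I_N -> bool})
  g (pos v) * \1_(counts N z (cells01 v)) w.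

Let v_of (w : T) : {ffun 'I_N -> bool} := [ffun i : 'I_N => z i w != 0%N].

Let YE w : (forall i, (i < N)%N -> (z i w <= 1)%N) -> Y w = g (pos (v_of w)).
Proof.
move=> z1; rewrite /Y (bigD1 (v_of w))//= big1 ?addr0 => [|v vw].
  rewrite indicE mem_set ?mulr1// => i iN.
  rewrite (cells01E _ (Ordinal iN)) ffunE /=.
  by have := z1 _ iN; case: (z i w) => [|[|]].
rewrite indicE memNset ?mulr0// => zv; case/eqP: vw; apply/ffunP => i.
by rewrite ffunE zv// cells01E; case: (v i).
Qed.

Let Y0 w : ~ (forall i, (i < N)%N -> (z i w <= 1)%N) -> Y w = 0.
Proof.
move=> z1; rewrite /Y big1// => v _; rewrite indicE memNset ?mulr0// => zv.
by apply: z1 => i iN; rewrite zv// (cells01E _ (Ordinal iN)); case: (v _).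
Qed.

Let YB w : `|Y w| <= B.
Proof.
have [z1|z1] := pselect (forall i, (i < N)%N -> (z i w <= 1)%N).
  by rewrite YE.
by rewrite Y0// normr0; apply: le_trans (gB point).
Qed.

Let mcnt (v : {ffun 'I_N -> bool}) : measurable (counts N z (cells01 v)).
Proof. exact: measurable_counts. Qed.

Let mY : measurable_fun setT Y.
Proof. by apply: measurable_sum => v; apply: measurable_funM. Qed.

Let EY : (\int[P]_w (Y w)%:E = (cell_mean N M h s g mu)%:E)%E.
Proof.
rewrite /Y; under eq_integral do rewrite -sumEFin.
rewrite integral_sum//; last first.
  move=> v; apply: (@integrable_bounded _ _ _ _
    (fun w => g (pos v) * \1_(counts N z (cells01 v)) w) B).
    by apply: measurable_funM => //; apply: measurable_indic.
  move=> w; rewrite normrM -[leRHS]mulr1 ler_pM// indicE.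
  by case: (_ \in _); rewrite ?normr1 ?normr0.
rewrite /cell_mean -sumEFin; apply: eq_bigr => v _.
under eq_integral do rewrite EFinM.
rewrite integralZl//; last first.
  apply: (@integrable_bounded _ _ _ _ (\1_(counts N z (cells01 v))) 1).
    exact: measurable_indic.
  by move=> w; rewrite indicE; case: (_ \in _); rewrite ?normr1 ?normr0.
rewrite integral_indic// setIT EFinM; congr (_ * _)%E.
by have := hz (cells01 v); rewrite setTI mul1r.
Qed.

(** Outside [A0], the cells with two jumps and the resonances, the chosen cell is within 6 cells of
    the cell [k] of [xi_cell], and [xi] is within [3 * h] of the latter; this makes the [9 * h] of
    [g_close]. On the exceptional event both variables are bounded by [B]. *)
Lemma mean_at_argmax :
  (`|\int[P]_w (g (xi w))%:E - (cell_mean N M h s g mu)%:E| <=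
   (e + 2 * B * (t + (N%:R * (expR 2 * m ^+ 2) +
      N%:R * Q.+1%:R * 25 * (expR 2 * m ^+ 2))))%:E)%E.
Proof.
have [A1 mA1 [resA1 PA1]] := resonance_bound mz mum m1 hz s0 NQ.
pose A2 := \big[setU/set0]_(i < N) [set w | (1 < z i w)%N].
have mtwo i : (i < N)%N -> measurable [set w | (1 < z i w)%N].
  move=> iN; rewrite -[X in measurable X]setTI.
  exact: (mz iN measurableT (Y := [set k | (1 < k)%N])).
have mA2 : measurable A2 by apply: bigsetU_measurable => i _; exact: mtwo.
have PA2 : (P A2 <= (N%:R * (expR 2 * m ^+ 2))%:E)%E.
  apply: (union_bound (A := fun i => [set w | (1 < z i w)%N])) => // i iN.
  by have := poisson_counts_two iN iN mz mum m1 hz; rewrite eqxx.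
have B0 : 0 <= B by apply: le_trans (gB point).
rewrite -EY; apply: le_trans (expectation_close (X := fun w => g (xi w)) (Y := Y)
  (A := A0 `|` (A2 `|` A1)) (B := B) (e := e) P _ _ _ _ _ _ _) _.
- exact: measurableT_comp.
- exact: mY.
- by apply: measurableU => //; exact: measurableU.
- exact: e0.
- by move=> w; exact: gB.
- exact: YB.
- move=> w nA; have nA0 : ~ A0 w by move=> a; apply: nA; left.
  have z1 i : (i < N)%N -> (z i w <= 1)%N.
    move=> iN; rewrite leqNgt; apply/negP => zi; apply: nA; right; left.
    by rewrite /A2 -(bigcup_mkord N (fun i => [set w | (1 < z i w)%N])); exists i.
  have [k [k4 kN ck xik]] := xi_cell nA0 z1.
  rewrite YE//; apply: g_close => //; rewrite /pos.
  have zv i : (i < N)%N -> z i w = cells01 (v_of w) i.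
    move=> iN; rewrite (cells01E _ (Ordinal iN)) ffunE /=.
    by have := z1 _ iN; case: (z i w) => [|[|]].
  have [|c4 [cN cc]] := @xgetPex _ 0%N
      [set k | (4 < k)%N /\ (k + 3 <= N)%N /\ argmax_cell N s (cells01 (v_of w)) k].
    by exists k; split => //; split => //; apply: argmax_cell_eq ck => //; lia.
  rewrite -/(cell_choice N s (cells01 (v_of w))) in c4 cN cc.
  set c := cell_choice _ _ _ in c4 cN cc *.
  have {}cc : argmax_cell N s (z ^~ w) c.
    by apply: argmax_cell_eq cc => [|i iN]; [lia|rewrite zv].
  have ck7 : (c <= k + 6)%N.
    rewrite leqNgt; apply/negP => kc; apply: nA; right; right; apply: resA1.
    by apply: (argmax_cell_unique k4 _ cN ck cc); lia.
  have kc7 : (k <= c + 6)%N.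
    rewrite leqNgt; apply/negP => kc; apply: nA; right; right; apply: resA1.
    by apply: (argmax_cell_unique c4 _ kN cc ck); lia.
  move: ck7 kc7; rewrite -!(ler_nat R) !natrD => ck7 kc7.
  move: xik; rewrite !ler_norml => /andP[x1 x2]; apply/andP; split; nra.
rewrite EFinD leeD2l// [leRHS]EFinM lee_wpmul2l ?lee_fin ?mulr_ge0//.
apply: le_trans (measureU2 _ _ _) _ => //; first exact: measurableU.
rewrite EFinD leeD//; apply: le_trans (measureU2 _ mA2 mA1) _.
by rewrite EFinD leeD.
Qed.

End mean_at_argmax.

(** * Counting paths *)

Section counting_paths.
Context {R : realType}.
Implicit Types (D : set R) (x : R -> nat) (s t u v : R) (f g : R -> R).

Lemma left_lim_cst f s t c : s < t -> (forall u, s < u < t -> f u = c) ->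
  left_lim f t = c.
Proof.
move=> st fc; apply: cvg_lim => //.
apply: cvg_near_cst; near=> u; apply: fc; apply/andP; split.
  by near: u; exact: nbhs_left_gt.
by near: u; exact: nbhs_left_lt.
Unshelve. all: by end_near.
Qed.

Lemma counting_path_right_cst D x t : counting_path D x -> D t ->
  exists2 e, 0 < e & forall u, D u -> t < u < t + e -> x u = x t.
Proof.
move=> px Dt; have /= cv := counting_path_right px Dt.
have /cv : nbhs (x t) [set x t] by [].
rewrite /nbhs /= => /nbhs_ballP[e /= e0 H]; exists e => // u Du /andP[tu ue].
apply: H => //=; rewrite /ball /= ler0_norm; lra.
Qed.

(** Induction on the increase [x t - x s]. If it is positive, let [u] be the infimum of the times at
    which the path has left the value [x s]; right continuity gives [x s < x u], so [u] is the first
    jump time and the induction hypothesis applies from [u] on. *)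
Lemma counting_path_jumps D x s t : counting_path D x -> s <= t ->
  (forall u, s <= u <= t -> D u) ->
  exists l : seq R, [/\ uniq l, forall u, u \in l -> s < u <= t,
    forall u, s < u <= t -> u \notin l -> jump x u = 0,
    forall u, s < u <= t -> 0 <= jump x u &
    forall u, s <= u <= t -> (x u)%:R - (x s)%:R = \sum_(v <- l | v <= u) jump x v].
Proof.
move=> px; move: {2}(x t - x s)%N (leqnn (x t - x s)) => n.
elim: n s => [|n IH] s xn st DD.
  have cst u : s <= u <= t -> x u = x s.
    move=> /andP[su ut]; have Ds : D s by apply: DD; rewrite lexx.
    have Dt : D t by apply: DD; rewrite lexx andbT.
    have Du : D u by apply: DD; rewrite su.
    have := counting_path_homo px Ds Du su; have := counting_path_homo px Du Dt ut.
    by move: xn; lia.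
  have j0 u : s < u <= t -> jump x u = 0.
    move=> /andP[su ut]; rewrite /jump (@left_lim_cst _ s u (x s)%:R)//.
      by rewrite cst ?subrr// ltW.
    by move=> v /andP[sv vu]; rewrite cst// (ltW sv) (le_trans (ltW vu)).
  exists [::]; split => //.
  - by move=> u /j0 ->.
  - by move=> u /j0 ->.
  move=> u sut; by rewrite big_nil cst// subrr.
have Ds : D s by apply: DD; rewrite lexx.
have Dt : D t by apply: DD; rewrite lexx andbT.
have [xs|xst] := eqVneq (x t) (x s); first by apply: IH => //; rewrite xs subnn.
have xslt : (x s < x t)%N.
  by rewrite ltn_neqAle eq_sym xst (counting_path_homo px).
pose S := [set v | s <= v <= t /\ (x s < x v)%N].
have St : S t by split => //; rewrite st lexx.
have lbS : lbound S s by move=> v [/andP[]].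
have hS : has_inf S by split; [exists t|exists s].
pose u := inf S.
have infS v : S v -> u <= v by move=> Sv; apply: ge_inf => //; exists s.
have su : s <= u by apply: lb_le_inf => //; exists t.
have ut : u <= t by exact: infS.
have Du : D u by apply: DD; rewrite su.
have xsu v : s <= v < u -> x v = x s.
  move=> /andP[sv vu]; apply/eqP; rewrite eqn_leq andbC (counting_path_homo px)//=; last first.
    by apply: DD; rewrite sv (le_trans (ltW vu)).
  rewrite leqNgt; apply/negP => xsv; move: (vu); rewrite ltNge => /negP; apply.
  by apply: infS; split => //; rewrite sv (le_trans (ltW vu)).
have xu : (x s < x u)%N.
  rewrite ltnNge; apply/negP => xus.
  have {}xus : x u = x s.
    by apply/eqP; rewrite eqn_leq xus (counting_path_homo px).
  have [e e0 He] := counting_path_right_cst px Du.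
  suff : u + e <= u by rewrite gerDl leNgt e0.
  apply: lb_le_inf; first by exists t.
  move=> v [/andP[sv vt] xsv]; rewrite leNgt; apply/negP => ve.
  have uv : u <= v by apply: infS; split => //; rewrite sv.
  move: uv; rewrite le_eqVlt => /orP[/eqP uv|uv].
    by move: xsv; rewrite -uv xus ltnn.
  have Dv : D v by apply: DD; rewrite sv.
  by move: xsv; rewrite (He v Dv) ?xus ?ltnn// uv ve.
have {}su : s < u.
  rewrite lt_neqAle su andbT; apply/eqP => su'; by move: xu; rewrite -su' ltnn.
have [] := IH u _ ut _.
- have := counting_path_homo px Du Dt ut; lia.
- by move=> v /andP[uv vt]; apply: DD; rewrite (le_trans (ltW su)).
move=> l [ul lin lj lj0 lsum].
have ll v : s < v < u -> left_lim (fun s => (x s)%:R) v = (x s)%:R.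
  move=> /andP[sv vu]; apply: (@left_lim_cst _ s) => // w /andP[sw wv].
  by rewrite xsu// (ltW sw) (lt_trans wv).
have llu : left_lim (fun s => (x s)%:R) u = (x s)%:R.
  apply: (@left_lim_cst _ s) => // w /andP[sw wv]; by rewrite xsu// (ltW sw).
have ju : jump x u = (x u)%:R - (x s)%:R by rewrite /jump llu.
have jlt v : s < v < u -> jump x v = 0.
  by move=> /andP[sv vu]; rewrite /jump ll ?sv// xsu ?subrr// (ltW sv).
exists (u :: l); split => /=.
- rewrite ul andbT; apply/negP => /lin; by rewrite ltxx.
- move=> v; rewrite inE => /predU1P[->|/lin/andP[uv ->]]; first by rewrite su.
  by rewrite (lt_trans su).
- move=> v /andP[sv vt]; rewrite inE negb_or => /andP[vu vl].
  move: vu; rewrite neq_lt => /orP[vu|uv]; first by rewrite jlt// sv.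
  by apply: lj => //; rewrite uv.
- move=> v /andP[sv vt]; have [vu|uv|->] := ltgtP v u.
  + by rewrite jlt// sv.
  + by apply: lj0; rewrite uv.
  + by rewrite ju subr_ge0 ler_nat ltnW.
move=> v /andP[sv vt]; rewrite big_cons; case: (leP u v) => uv.
  by rewrite -lsum ?uv// ju; ring.
rewrite xsu ?sv// subrr big_seq_cond big1// => w /andP[/lin/andP[uw _] wv].
by move: (lt_le_trans uw wv) uv; lra.
Qed.

End counting_paths.

Section path_integrals.
Context {R : realType}.
Variables (tau : R) (x : R -> nat).
Hypothesis tau0 : 0 <= tau.
Hypothesis px : counting_path `[0, tau] x.
Implicit Types f g : R -> R.

(** The finitely supported sum becomes a sum over a list of jump times that does not depend on [f];
    linearity and monotonicity of the integral are read off from it. *)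
Lemma path_integral_sum : exists l : seq R, [/\ forall u, u \in l -> 0 < u <= tau,
    forall u, u \in l -> 0 <= jump x u,
    forall f, path_integral tau f x = \sum_(v <- l) f v * jump x v &
    forall u, 0 <= u <= tau -> (x u)%:R = \sum_(v <- l | v <= u) jump x v].
Proof.
have [|l [ul lin lj lj0 lsum]] := counting_path_jumps px tau0.
  by move=> u u0; rewrite /= in_itv.
exists l; split => // [u /lin /lj0//|f|u u0]; last first.
  by rewrite -lsum// (counting_path0 px) subr0.
rewrite /path_integral (fsbigE l)//.
- rewrite big_mkcond big_seq [RHS]big_seq; apply: eq_bigr => t /lin tl.
  by rewrite mem_set//= in_itv.
- by move=> t; rewrite /= in_itv /= => t0 tl; rewrite lj// mulr0.
Qed.

Lemma path_integral_le f g : (forall t, 0 < t <= tau -> f t <= g t) ->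
  path_integral tau f x <= path_integral tau g x.
Proof.
move=> fg; have [l [lin lj lE _]] := path_integral_sum; rewrite !lE.
by rewrite !big_seq; apply: ler_sum => t tl; rewrite ler_wpM2r ?lj ?fg ?lin.
Qed.

Lemma path_integral_sumr (I : Type) (r : seq I) (c : I -> R) (F : I -> R -> R) :
  path_integral tau (fun t => \sum_(i <- r) c i * F i t) x =
  \sum_(i <- r) c i * path_integral tau (F i) x.
Proof.
have [l [_ _ lE _]] := path_integral_sum; rewrite lE.
under [RHS]eq_bigr do rewrite lE mulr_sumr.
rewrite exchange_big /=; apply: eq_bigr => t _; rewrite mulr_suml.
by apply: eq_bigr => i _; rewrite mulrA.
Qed.

Lemma path_integral_indic a b : 0 <= a -> a <= b -> b <= tau ->
  path_integral tau \1_(`]a, b]) x = (x b)%:R - (x a)%:R.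
Proof.
move=> a0 ab bt; have [l [_ _ lE xE]] := path_integral_sum; rewrite lE.
rewrite !xE ?a0 ?bt ?(le_trans ab) ?(le_trans a0)//.
rewrite [X in _ = X - _]big_mkcond [X in _ = _ - X]big_mkcond -sumrB.
apply: eq_bigr => t _; rewrite indicE mem_setE in_itv /=.
case: (leP t b) => tb; case: (leP t a) => ta /=; rewrite ?mul0r ?mul1r ?subr0 ?subrr//.
by move: (lt_le_trans tb (le_trans ta ab)); rewrite ltxx.
Qed.

End path_integrals.

(** * Ramps, grids and step functions *)

Section ramp.
Context {R : realType}.
Variables (tau dn : R).
Hypothesis dn0 : 0 < dn.
Implicit Types th t u v : R.

Definition ramp th t : R :=
  dn^-1 * (t - th) * \1_(`[th, th + dn[) t + \1_(`[th + dn, tau]) t.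

Lemma ramp_eq0 th t : t <= th -> ramp th t = 0.
Proof.
move=> tth; rewrite /ramp !indicE !mem_setE !in_itv /=.
have -> : (th + dn <= t) = false
  by apply/negbTE; rewrite -ltNge; have := dn0; lra.
rewrite andFb addr0; case: (leP th t) => tt; last by rewrite mulr0.
have -> : t = th by apply/le_anti; rewrite tth tt.
by rewrite subrr mulr0 mul0r.
Qed.

Lemma ramp_eq1 th t : t <= tau -> th + dn <= t -> ramp th t = 1.
Proof.
move=> tt tth; rewrite /ramp !indicE !mem_setE !in_itv /= tth tt.
by have -> : (t < th + dn) = false; [apply/negbTE; rewrite -leNgt|rewrite andbF mulr0 add0r].
Qed.

Lemma ramp_mid th t : th <= t < th + dn -> ramp th t = (t - th) / dn.
Proof.
move=> /andP[tt tth]; rewrite /ramp !indicE !mem_setE !in_itv /= tt tth /=.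
have -> : (th + dn <= t) = false by apply/negbTE; rewrite -ltNge.
by rewrite andFb addr0 mulr1 mulrC.
Qed.

Lemma ramp_itv th t : t <= tau -> 0 <= ramp th t <= 1.
Proof.
move=> tt; have [h|h] := leP t th; first by rewrite ramp_eq0 ?lexx ?ler01.
have [h'|h'] := leP (th + dn) t; first by rewrite ramp_eq1 ?lexx ?ler01.
rewrite ramp_mid ?h' ?(ltW h)// ler_pdivrMr// divr_ge0 ?(ltW dn0) ?subr_ge0 ?(ltW h)//=.
lra.
Qed.

Lemma ramp_le th th' t : t <= tau -> th <= th' -> ramp th' t <= ramp th t.
Proof.
move=> tt thth'; have /andP[r0 _] := ramp_itv th tt; have /andP[_ r1] := ramp_itv th' tt.
have [h|h] := leP t th'; first by rewrite (ramp_eq0 h).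
have [h'|h'] := leP (th + dn) t; first by rewrite (ramp_eq1 tt h').
rewrite !ramp_mid ?ler_pM2r ?invr_gt0//; first lra.
  by rewrite h'; lra.
by rewrite (ltW h); lra.
Qed.

Lemma measurable_ramp th D : measurable_fun D (ramp th).
Proof.
apply: measurable_funTS; apply: measurable_funD; last exact: measurable_indic.
apply: measurable_funM; last exact: measurable_indic.
by apply: measurable_funM => //; apply: measurable_funB.
Qed.

Lemma integrable_itv_bounded (f : R -> R) B u v : measurable_fun `[u, v] f ->
  (forall t, u <= t <= v -> `|f t| <= B) ->
  lebesgue_measure.-integrable `[u, v] (EFin \o f).
Proof.
move=> mf fB; apply: measurable_bounded_integrable => //.
  have := lebesgue_measure_itv `[u, v]; rewrite /= => -> /=.
  by case: ifP => _; rewrite ?ltry// -EFinB ltry.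
exists B; split => [|x Bx t /=]; first exact: num_real.
by rewrite in_itv /= => /fB ft; apply: le_trans ft _; exact: ltW.
Qed.

Lemma integrable_ramp th u v : v <= tau ->
  lebesgue_measure.-integrable `[u, v] (EFin \o ramp th).
Proof.
move=> vt; apply: (@integrable_itv_bounded _ 1); first exact: measurable_ramp.
move=> t /andP[_ tv]; have /andP[r0 r1] := ramp_itv th (le_trans tv vt).
by rewrite ger0_norm.
Qed.

Lemma Rintegral_itv_cst (c u v : R) : u <= v ->
  \int[lebesgue_measure]_(t in `[u, v]) c = c * (v - u).
Proof.
move=> uv; rewrite Rintegral_cst//; congr (_ * _).
have := lebesgue_measure_itv `[u, v]; rewrite /= => -> /=.
move: uv; rewrite lte_fin le_eqVlt => /predU1P[->|->//].
by rewrite ltxx subrr.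
Qed.

Lemma Rintegral_indic_itv u v : 0 <= u <= v -> v = tau ->
  \int[lebesgue_measure]_(t in `[0, tau]) \1_(`[u, v]) t = v - u.
Proof.
move=> /andP[u0 uv] vt; rewrite /Rintegral integral_indic//.
rewrite (_ : _ `&` _ = `[u, v]%classic); last first.
  apply/seteqP; split => t /=; rewrite !in_itv /=; first by case.
  by move=> /andP[ut tv]; rewrite (le_trans u0 ut) ut tv -vt.
have := lebesgue_measure_itv `[u, v]; rewrite /= => -> /=.
move: uv; rewrite lte_fin le_eqVlt => /predU1P[->|->//].
by rewrite ltxx subrr.
Qed.

(** The ramp lies between the indicators of [[th + dn, tau]] and [[th, tau]]. When [th + dn] exceeds
    [tau] the lower bound is negative. *)
Lemma Rintegral_ramp th : 0 <= th <= tau ->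
  tau - th - dn <= \int[lebesgue_measure]_(t in `[0, tau]) ramp th t <= tau - th.
Proof.
move=> /andP[th0 tht]; have int1 u v : lebesgue_measure.-integrable `[0, tau]
    (EFin \o (\1_(`[u, v]) : R -> R)).
  apply: (@integrable_itv_bounded _ 1); first exact: measurable_indic.
  by move=> t _; rewrite indicE; case: (_ \in _); rewrite ?normr1 ?normr0.
have intr := @integrable_ramp th 0 tau (lexx _).
apply/andP; split; last first.
  rewrite -(Rintegral_indic_itv (u := th) (v := tau))// ?th0//.
  apply: le_Rintegral => // t /=; rewrite in_itv /= => /andP[t0 tt].
  rewrite indicE mem_setE in_itv /= tt andbT; case: (leP th t) => h.
    by have /andP[] := ramp_itv th tt.
  by rewrite ramp_eq0// ltW.
have [h|h] := leP (th + dn) tau; last first.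
  apply: (@le_trans _ _ 0); first lra.
  by apply: Rintegral_ge0 => t /=; rewrite in_itv /= => /andP[_ /(ramp_itv th)/andP[]].
rewrite -addrA -opprD -(Rintegral_indic_itv (u := th + dn) (v := tau))//; last first.
  by apply/andP; split => //; have := dn0; lra.
apply: le_Rintegral => // t /=; rewrite in_itv /= => /andP[t0 tt].
rewrite indicE mem_setE in_itv /= tt andbT; case: (leP (th + dn) t) => h'.
  by rewrite ramp_eq1.
by have /andP[] := ramp_itv th tt.
Qed.

End ramp.

Section grids.
Context {R : realType}.
Implicit Types (sg : bool) (th eta u : R) (M m : nat) (x : R -> nat).

(** Used with [r < 0], or [b < a] in the limit, to treat both signs of [r] at once. For [r > 0] the
    log-likelihood, as a function of the parameter, falls at a jump and rises in between, so the
    axis is reversed; for [r < 0] it is kept. *)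
Definition orient sg : R := if sg then 1 else - 1.

Lemma normr_orient sg u : `|orient sg * u| = `|u|.
Proof. by rewrite normrM /orient; case: sg; rewrite ?normrN normr1 mul1r. Qed.

Lemma orientK sg u : orient sg * (orient sg * u) = u.
Proof. by rewrite mulrA /orient; case: sg; rewrite ?mulrNN !mul1r. Qed.

(* The direction of increasing indices is reversed when [sg] is false. *)
Definition grid sg th eta M m : R := th + orient sg * ((m%:R - M%:R) * eta).

(** Open at the earlier end in both orientations, so that the integral of its indicator is an
    increment of the path. *)
Definition cell sg th eta M m : interval R :=
  if sg then `]grid sg th eta M m, grid sg th eta M m.+1]
  else `]grid sg th eta M m.+1, grid sg th eta M m].

(* One of the two truncated differences is zero. *)
Definition cell_count sg th eta M x m : nat :=
  let a := x (grid sg th eta M m) in let b := x (grid sg th eta M m.+1) in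
  ((b - a) + (a - b))%N.

Lemma gridB sg th eta M i j : grid sg th eta M i - grid sg th eta M j =
  orient sg * ((i%:R - j%:R) * eta).
Proof. by rewrite /grid; ring. Qed.

Lemma grid_le sg th eta M i j : 0 < eta -> (i <= j)%N ->
  if sg then grid sg th eta M i <= grid sg th eta M j
  else grid sg th eta M j <= grid sg th eta M i.
Proof.
move=> eta0 ij; have ijR : (i%:R : R) <= j%:R by rewrite ler_nat.
have p : (i%:R - j%:R) * eta <= 0 by rewrite pmulr_lle0// subr_le0.
by rewrite -subr_le0 -[X in if _ then _ else X]subr_ge0 gridB /orient; case: sg; lra.
Qed.

Lemma crossing (p : pred nat) (m0 m1 : nat) : (m0 <= m1)%N -> ~~ p m0 -> p m1 ->
  exists m, [/\ (m0 <= m < m1)%N, ~~ p m & p m.+1].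
Proof.
elim: m1 => [|m1 IH]; first by rewrite leqn0 => /eqP -> /negP.
rewrite leq_eqVlt => /predU1P[-> /negP//|]; rewrite ltnS => m01 p0 p1.
have [pm|npm] := boolP (p m1); last by exists m1; rewrite m01 ltnSn.
have [m [/andP[a b] c e]] := IH m01 p0 pm.
by exists m; split => //; rewrite a ltnW.
Qed.

Lemma cell_cover sg th eta M m0 m1 u : (m0 <= m1)%N ->
  (if sg then grid sg th eta M m0 < u <= grid sg th eta M m1
   else grid sg th eta M m1 < u <= grid sg th eta M m0) ->
  exists2 m, (m0 <= m < m1)%N & u \in cell sg th eta M m.
Proof.
move=> m01; rewrite /cell; case: sg => /andP[h1 h2].
  have [|m [mm p1 p2]] := @crossing (fun m => u <= grid true th eta M m) _ _ m01 _ h2.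
    by rewrite -ltNge.
  by exists m => //; rewrite in_itv /= p2 andbT ltNge.
have [|m [mm p1 p2]] := @crossing (fun m => grid false th eta M m < u) _ _ m01 _ h1.
  by rewrite -leNgt.
by exists m => //; rewrite in_itv /= p2 leNgt.
Qed.

Lemma cell_disjoint sg th eta M i j u : 0 < eta ->
  u \in cell sg th eta M i -> u \in cell sg th eta M j -> i = j.
Proof.
move=> eta0; wlog ij : i j / (i < j)%N.
  move=> W ui uj; have [ij|ij|//] := ltngtP i j; first exact: W ij ui uj.
  exact/esym/(W _ _ ij uj ui).
have := grid_le sg th M eta0 ij; rewrite /cell.
case: sg => g; rewrite !in_itv /= => /andP[a b] /andP[c e].
  by move: (lt_le_trans c b); rewrite ltNge g.
by move: (lt_le_trans a e); rewrite ltNge g.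
Qed.

Lemma step_le (I : eqType) (r : seq I) (C : I -> interval R) (c : I -> R) y u :
  uniq r -> (forall i j, u \in C i -> u \in C j -> i = j) -> 0 <= y ->
  (forall i, i \in r -> u \in C i -> c i <= y) ->
  \sum_(i <- r) c i * \1_[set` C i] u <= y.
Proof.
move=> ur dC y0 cy.
have [/hasP[i ir ui]|/hasPn nu] := boolP (has (fun i => u \in C i) r).
  rewrite (bigD1_seq i)//= indicE mem_setE ui mulr1 big1_seq ?addr0; first exact: cy.
  move=> j /andP[/eqP ji _]; rewrite indicE mem_setE;
  have [uj|_] := boolP (u \in C j); last by rewrite mulr0.
  by case: ji; apply: dC.
rewrite big1_seq// => i /andP[_ /nu]; rewrite indicE mem_setE => /negbTE ->.
by rewrite mulr0.
Qed.

Lemma le_step (I : eqType) (r : seq I) (C : I -> interval R) (c : I -> R) y u :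
  (forall i, 0 <= c i) ->
  (0 < y -> exists i, [/\ i \in r, u \in C i & y <= c i]) ->
  y <= \sum_(i <- r) c i * \1_[set` C i] u.
Proof.
move=> c0 cy.
have s0 (s : seq I) : 0 <= \sum_(i <- s) c i * \1_[set` C i] u.
  by apply: sumr_ge0 => i _; rewrite mulr_ge0.
have [y0|/cy[i [ir ui yi]]] := leP y 0; first exact: le_trans (s0 r).
rewrite (big_rem i ir) /= indicE mem_setE ui mulr1.
by have := s0 (rem i r); lra.
Qed.

End grids.

Section path_integral_cells.
Context {R : realType}.
Variables (tau : R) (x : R -> nat) (sg : bool) (th eta : R) (M : nat).
Hypothesis px : counting_path `[0, tau] x.
Hypothesis eta0 : 0 < eta.
Local Notation t := (grid sg th eta M).
Local Notation C := (cell sg th eta M).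
Implicit Types (f : R -> R) (c : nat -> R).

Lemma path_integral_cell m : 0 <= t m <= tau -> 0 <= t m.+1 <= tau ->
  path_integral tau \1_[set` C m] x = (cell_count sg th eta M x m)%:R.
Proof.
move=> /andP[a0 a1] /andP[b0 b1]; have tau0 := le_trans a0 a1.
have xle a b : 0 <= a -> a <= b -> b <= tau -> (x a <= x b)%N.
  move=> a0' ab' bt'; apply: (counting_path_homo px) => //; rewrite /= in_itv /=.
    by rewrite a0' (le_trans ab').
  by rewrite bt' (le_trans a0').
have := grid_le sg th M eta0 (leqnSn m).
rewrite /cell /cell_count; case: sg a0 a1 b0 b1 => a0 a1 b0 b1 ab.
  have le := xle _ _ a0 ab b1; rewrite path_integral_indic// natrD natrB//.
  by move: le; rewrite -subn_eq0 => /eqP ->; rewrite addr0.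
have le := xle _ _ b0 ab a1; rewrite path_integral_indic// natrD [in RHS]addrC natrB//.
by move: le; rewrite -subn_eq0 => /eqP ->; rewrite addr0.
Qed.

Lemma path_integral_steps c m0 m1 : 0 <= tau ->
  (forall i, (m0 <= i <= m1)%N -> 0 <= t i <= tau) ->
  path_integral tau (fun u => \sum_(m0 <= m < m1) c m * \1_[set` C m] u) x =
  \sum_(m0 <= m < m1) c m * (cell_count sg th eta M x m)%:R.
Proof.
move=> tau0 tin; rewrite (path_integral_sumr tau0 px).
by apply: eq_big_nat => m mm; congr (_ * _); apply: path_integral_cell; apply: tin; lia.
Qed.

(** For a lower bound the values of [f] on the chosen cells suffice, [f] being nonnegative
    elsewhere; the upper bound that follows needs these cells to cover the set where [f] is
    positive. *)
Lemma path_integral_ge_cells f c m0 m1 : 0 <= tau ->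
  (forall i, (m0 <= i <= m1)%N -> 0 <= t i <= tau) ->
  (forall u, 0 < u <= tau -> 0 <= f u) ->
  (forall u m, 0 < u <= tau -> (m0 <= m < m1)%N -> u \in C m -> c m <= f u) ->
  \sum_(m0 <= m < m1) c m * (cell_count sg th eta M x m)%:R <= path_integral tau f x.
Proof.
move=> tau0 tin f0 cf; rewrite -path_integral_steps//.
apply: (path_integral_le tau0 px) => u u0; apply: step_le.
- exact: iota_uniq.
- by move=> i j; exact: cell_disjoint.
- exact: f0.
- by move=> i; rewrite mem_index_iota => im; exact: cf.
Qed.

Lemma path_integral_le_cells f c m0 m1 : 0 <= tau ->
  (forall i, (m0 <= i <= m1)%N -> 0 <= t i <= tau) ->
  (forall m, 0 <= c m) ->
  (forall u, 0 < u <= tau -> 0 < f u ->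
     exists m, [/\ (m0 <= m < m1)%N, u \in C m & f u <= c m]) ->
  path_integral tau f x <= \sum_(m0 <= m < m1) c m * (cell_count sg th eta M x m)%:R.
Proof.
move=> tau0 tin c0 cf; rewrite -path_integral_steps//.
apply: (path_integral_le tau0 px) => u u0; apply: le_step => // /(cf u u0).
by move=> [m [mm um fc]]; exists m; rewrite mem_index_iota.
Qed.

End path_integral_cells.

(** * The likelihood ratio *)

Section likelihood_ratio.
Context {R : realType}.
Variables (tau : R) (psi : R -> R) (r dn : R).
Hypothesis tau0 : 0 <= tau.
Hypothesis dn0 : 0 < dn.
Hypothesis psi0 : forall t : R, 0 <= t <= tau -> 0 < psi t.
Hypothesis psir0 : forall t : R, 0 <= t <= tau -> 0 < psi t + r.
Hypothesis intpsi : lebesgue_measure.-integrable `[0, tau] (EFin \o psi).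
Implicit Types th t u : R.

Definition lo t : R := Num.min (psi t) (psi t + r).
Definition hi t : R := Num.max (psi t) (psi t + r).
Definition log_jump t : R := ln (hi t / lo t).

Local Notation lam := (intensity tau psi r dn).
Local Notation rho := (ramp tau dn).

Lemma intensityE th t : lam th t = psi t + r * rho th t.
Proof. by rewrite /intensity /ramp; ring. Qed.

Lemma hi_lo t : hi t = lo t + `|r|.
Proof.
rewrite /hi /lo; case: (leP 0 r) => r0.
  by rewrite ger0_norm// min_l ?max_r ?lerDl.
by rewrite ltr0_norm// min_r ?max_l ?gerDl ?(ltW r0)// addrK.
Qed.

Lemma lo_gt0 t : 0 <= t <= tau -> 0 < lo t.
Proof. by move=> tt; rewrite /lo lt_min psi0 ?psir0. Qed.

Lemma intensity_bounds th t : 0 <= t <= tau -> lo t <= lam th t <= hi t.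
Proof.
move=> /andP[t0 tt]; have /andP[r0 r1] := ramp_itv dn0 th tt.
rewrite hi_lo intensityE /lo; have [r'|r'] := leP 0 r.
  by rewrite ger0_norm// min_l ?lerDl//; apply/andP; split; nra.
by rewrite ltr0_norm// min_r ?gerDl ?(ltW r')//; apply/andP; split; nra.
Qed.

Lemma intensity_gt0 th t : 0 <= t <= tau -> 0 < lam th t.
Proof.
by move=> tt; have /andP[h _] := intensity_bounds th tt; exact: lt_le_trans (lo_gt0 tt) h.
Qed.

Lemma log_jump_ge0 t : 0 <= t <= tau -> 0 <= log_jump t.
Proof.
move=> tt; have l0 := lo_gt0 tt.
by rewrite /log_jump ln_ge0// ler_pdivlMr// mul1r hi_lo lerDl.
Qed.

(* Oriented so as to be nonnegative for [th <= th']: a jump of the observed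
   process moves the log-likelihood in the same direction whatever the sign of
   [r]. *)
Definition log_ratio th th' t : R :=
  orient (r < 0) * (ln (lam th' t) - ln (lam th t)).

Lemma log_ratio_eq0 th th' t : th <= th' -> 0 < t <= tau ->
  t <= th \/ th' + dn <= t -> log_ratio th th' t = 0.
Proof.
move=> thth' /andP[t0 tt] h; rewrite /log_ratio !intensityE.
suff -> : rho th' t = rho th t by rewrite subrr mulr0.
case: h => h; first by rewrite !ramp_eq0// (le_trans h).
by rewrite !ramp_eq1//; lra.
Qed.

Lemma log_ratio_itv th th' t : th <= th' -> 0 < t <= tau ->
  0 <= log_ratio th th' t <= log_jump t.
Proof.
move=> thth' /andP[t0 tt]; have tin : 0 <= t <= tau by rewrite ltW.
have l0 := lo_gt0 tin; have l1 := intensity_gt0 th tin; have l2 := intensity_gt0 th' tin.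
have /andP[b1 b2] := intensity_bounds th tin; have /andP[b3 b4] := intensity_bounds th' tin.
have h0 : 0 < hi t by rewrite hi_lo ltr_wpDr.
have rle := ramp_le dn0 tt thth'.
have lnle (a b : R) : 0 < a -> a <= b -> ln a <= ln b.
  by move=> a0 ab; rewrite ler_ln ?posrE// (lt_le_trans a0).
rewrite /log_ratio /log_jump ln_div ?posrE//.
have := lnle _ _ l0 b1; have := lnle _ _ l1 b2.
have := lnle _ _ l0 b3; have := lnle _ _ l2 b4.
rewrite /orient; have [r0|r0] := ltP r 0; rewrite ?mul1r ?mulN1r => *.
  have : ln (lam th t) <= ln (lam th' t) by apply: lnle => //; rewrite !intensityE; nra.
  by move=> *; apply/andP; split; lra.
have : ln (lam th' t) <= ln (lam th t) by apply: lnle => //; rewrite !intensityE; nra.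
by move=> *; apply/andP; split; lra.
Qed.

(** After the ramp started at [th] and before the one at [th'], the two intensities are exactly the
    two sides of a sharp jump. *)
Lemma log_ratio_full th th' t : 0 < t <= tau -> th + dn <= t <= th' ->
  log_ratio th th' t = log_jump t.
Proof.
move=> /andP[t0 tt] /andP[h1 h2]; have tin : 0 <= t <= tau by rewrite ltW.
have l0 := lo_gt0 tin; have h0 : 0 < hi t by rewrite hi_lo ltr_wpDr.
rewrite /log_ratio /log_jump ln_div ?posrE// !intensityE ramp_eq0// ramp_eq1// mulr0 mulr1 addr0.
rewrite /hi /lo /orient; have [r0|r0] := ltP r 0.
  by rewrite mul1r max_l ?min_r ?gerDl ?ltW.
by rewrite mulN1r opprB max_r ?min_l ?lerDl.
Qed.

Lemma integrable_rramp th :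
  lebesgue_measure.-integrable `[0, tau] (EFin \o (fun t => r * rho th t)).
Proof.
apply: (@integrable_itv_bounded _ _ `|r|).
  by apply: measurable_funM => //; exact: measurable_ramp.
move=> t /andP[_ /(ramp_itv dn0 th)/andP[r0 r1]].
by rewrite normrM (ger0_norm r0) -[leRHS]mulr1 ler_wpM2l.
Qed.

Lemma integrable_intensity th : lebesgue_measure.-integrable `[0, tau] (EFin \o lam th).
Proof.
have -> : EFin \o lam th = ((EFin \o psi) \+ (EFin \o (fun t => (r * rho th t)%R)))%E.
  by apply/funext => t /=; rewrite intensityE EFinD.
by apply: integrableD => //; exact: integrable_rramp.
Qed.

(** [J] is the difference of the integrals of two ramps, each known up to [dn]; this is the whole
    effect of the transition on the drift. *)
Lemma intensity_integral_diff th th' : 0 <= th -> th <= th' -> th' <= tau ->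
  exists2 J, th' - th - dn <= J <= th' - th + dn &
  \int[lebesgue_measure]_(t in `[0, tau]) (lam th' t - 1) -
  \int[lebesgue_measure]_(t in `[0, tau]) (lam th t - 1) = - (r * J).
Proof.
move=> th0 thth' th't.
have intr w : lebesgue_measure.-integrable `[0, tau] (EFin \o rho w).
  exact: integrable_ramp.
have int1 : lebesgue_measure.-integrable `[0, tau] (EFin \o (cst 1 : R -> R)).
  by apply: (@integrable_itv_bounded _ _ `|1|).
have E w : \int[lebesgue_measure]_(t in `[0, tau]) (lam w t - 1) =
    \int[lebesgue_measure]_(t in `[0, tau]) psi t -
    \int[lebesgue_measure]_(t in `[0, tau]) 1 +
    r * \int[lebesgue_measure]_(t in `[0, tau]) rho w t.
  rewrite RintegralB//; last exact: integrable_intensity.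
  under eq_Rintegral do rewrite intensityE.
  rewrite RintegralD// ?RintegralZl//; first by ring.
  exact: integrable_rramp.
exists (\int[lebesgue_measure]_(t in `[0, tau]) rho th t -
        \int[lebesgue_measure]_(t in `[0, tau]) rho th' t); last by rewrite !E; ring.
have /andP[a1 a2] := Rintegral_ramp dn0 (th := th) (tau := tau)
  ltac:(by rewrite th0 (le_trans thth')).
have /andP[a3 a4] := Rintegral_ramp dn0 (th := th') (tau := tau)
  ltac:(by rewrite th't (le_trans th0)).
by apply/andP; split; lra.
Qed.

End likelihood_ratio.

Lemma cell_index_bounds (R : numDomainType) k m j : (k.+2 <= m < j.-1)%N ->
  k%:R + 2 <= m%:R :> R /\ m%:R + 2 <= j%:R :> R.
Proof. by move=> mm; split; rewrite -natrD ler_nat; lia. Qed.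

Section log_likelihood.
Context {R : realType}.
Variables (tau : R) (psi : R -> R) (r dn : R) (n : nat) (x : 'I_n -> R -> nat).
Hypothesis tau0 : 0 <= tau.
Hypothesis dn0 : 0 < dn.
Hypothesis psi0 : forall t : R, 0 <= t <= tau -> 0 < psi t.
Hypothesis psir0 : forall t : R, 0 <= t <= tau -> 0 < psi t + r.
Hypothesis intpsi : lebesgue_measure.-integrable `[0, tau] (EFin \o psi).
Hypothesis px : forall j, counting_path `[0, tau] (x j).

Definition log_likelihood (th : R) : R :=
  \sum_(j < n) path_integral tau (fun t => ln (intensity tau psi r dn th t)) (x j)
  - n%:R * \int[lebesgue_measure]_(t in `[0, tau]) (intensity tau psi r dn th t - 1).

(** An exact splitting into jumps and drift; the orientation turns [r] into its absolute value. *)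
Lemma log_likelihood_diff (th th' : R) : 0 <= th -> th <= th' -> th' <= tau ->
  exists2 J, th' - th - dn <= J <= th' - th + dn &
  orient (r < 0) * (log_likelihood th' - log_likelihood th) =
  \sum_(j < n) path_integral tau (log_ratio tau psi r dn th th') (x j) - n%:R * `|r| * J.
Proof.
move=> th0 thth' th't.
have [J hJ eJ] := intensity_integral_diff r dn0 intpsi th0 thth' th't.
exists J => //; rewrite /log_likelihood.
have -> : \sum_(j < n) path_integral tau (log_ratio tau psi r dn th th') (x j) =
  orient (r < 0) * (\sum_(j < n) path_integral tau
      (fun t => ln (intensity tau psi r dn th' t)) (x j) -
   \sum_(j < n) path_integral tau (fun t => ln (intensity tau psi r dn th t)) (x j)).
  rewrite -sumrB mulr_sumr; apply: eq_bigr => j _.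
  have [l [_ _ lE _]] := path_integral_sum tau0 (px j).
  rewrite !lE -sumrB mulr_sumr; apply: eq_bigr => t _.
  by rewrite /log_ratio; ring.
set S' := \sum_(j < n) _; set S := \sum_(j < n) _.
set I' := Rintegral _ _ _ in eJ *; set I := Rintegral _ _ _ in eJ *.
have -> : S' - n%:R * I' - (S - n%:R * I) = S' - S - n%:R * (I' - I) by ring.
rewrite eJ /orient; have [r0|r0] := ltP r 0.
  by rewrite ltr0_norm//; ring.
by rewrite ger0_norm//; ring.
Qed.

Variables (th eta : R) (M N : nat).
Hypothesis eta0 : 0 < eta.
Hypothesis dn_eta : dn <= eta.
Local Notation sg := (r < 0).
Local Notation t := (grid sg th eta M).
Local Notation C := (cell sg th eta M).
Hypothesis tin : forall i, (i <= N)%N -> 0 <= t i <= tau.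
Variables (wm wp : nat -> R).
Hypothesis wp0 : forall m, 0 <= wp m.
Hypothesis w_cell : forall m u, (m < N)%N -> 0 < u <= tau -> u \in C m ->
  wm m <= log_jump psi r u <= wp m.

Definition pooled_count (m : nat) : nat :=
  \sum_(j < n) cell_count sg th eta M (x j) m.

Lemma pooled_ge f m0 m1 : (m1 <= N)%N ->
  (forall u, 0 < u <= tau -> 0 <= f u) ->
  (forall u m, 0 < u <= tau -> (m0 <= m < m1)%N -> u \in C m -> wm m <= f u) ->
  \sum_(m0 <= m < m1) wm m * (pooled_count m)%:R <=
  \sum_(j < n) path_integral tau f (x j).
Proof.
move=> m1N f0 fw; have [m01|m01] := leqP m0 m1; last first.
  rewrite big_geq ?(ltnW m01)//; apply: sumr_ge0 => j _.
  have [l [lin lj lE _]] := path_integral_sum tau0 (px j).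
  by rewrite lE big_seq; apply: sumr_ge0 => u ul; rewrite mulr_ge0 ?f0 ?lin ?lj.
under eq_bigr do rewrite /pooled_count natr_sum mulr_sumr.
rewrite exchange_big /=; apply: ler_sum => j _.
apply: path_integral_ge_cells => // i /andP[_ im]; apply: tin; exact: leq_trans m1N.
Qed.

Lemma pooled_le f m0 m1 : (m1 <= N)%N ->
  (forall u, 0 < u <= tau -> 0 < f u ->
     exists m, [/\ (m0 <= m < m1)%N, u \in C m & f u <= wp m]) ->
  \sum_(j < n) path_integral tau f (x j) <=
  \sum_(m0 <= m < m1) wp m * (pooled_count m)%:R.
Proof.
move=> m1N fw.
under [leRHS]eq_bigr do rewrite /pooled_count natr_sum mulr_sumr.
rewrite exchange_big /=; apply: ler_sum => j _.
apply: path_integral_le_cells => // i /andP[_ im]; apply: tin; exact: leq_trans m1N.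
Qed.

Variables (thh : R) (k : nat).
Hypothesis thh_in : 0 <= thh <= tau.
Hypothesis thh_cell :
  (k%:R - M%:R) * eta <= orient sg * (thh - th) <= (k.+1%:R - M%:R) * eta.

(** [log_ratio] is nonnegative, so dropping cells only lowers the sum. The cells kept are at least
    one cell, hence at least [dn], away from both end points: cell [k + 1] makes room for a ramp at
    the estimator, cell [j - 1] for one at [t j]. The orientation decides which of the two ramps
    lies in between. *)
Lemma mle_cell_right j : (k < j <= N)%N -> log_likelihood (t j) <= log_likelihood thh ->
  \sum_(k.+2 <= m < j.-1) wm m * (pooled_count m)%:R <=
  n%:R * `|r| * ((j%:R - k%:R + 1) * eta).
Proof.
move=> /andP[kj jN] Lj; have /andP[tj0 tj1] := tin jN.
have /andP[h0 h1] := thh_in; have /andP[c1 c2] := thh_cell.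
have kjR : k%:R + 1 <= j%:R :> R by rewrite natr1 ler_nat.
have nr0 : 0 <= n%:R * `|r| by rewrite mulr_ge0.
have key : (j%:R - k%:R - 1) * eta >= 0 by rewrite mulr_ge0 ?(ltW eta0)//; lra.
have mb m : (k.+2 <= m < j.-1)%N ->
    (m%:R - k%:R - 2) * eta >= 0 /\ (j%:R - m%:R - 2) * eta >= 0.
  move=> mm; have [m1 m2] := cell_index_bounds R mm.
  by split; rewrite mulr_ge0 ?(ltW eta0)//; lra.
(* [a] and [b] are the estimator and the grid point in the order of time. *)
have [a [b [a0 ab bt Lab [bau cab]]]] : exists a b,
    [/\ 0 <= a, a <= b, b <= tau,
        orient sg * (log_likelihood b - log_likelihood a) =
          log_likelihood (t j) - log_likelihood thh &
        b - a <= (j%:R - k%:R) * eta /\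
        forall m u, (k.+2 <= m < j.-1)%N -> u \in C m -> a + dn <= u <= b].
  move: tj0 tj1 Lj c1 c2; rewrite /cell /grid -!natr1 /orient.
  case: (r < 0); rewrite ?mul1r ?mulN1r => tj0 tj1 Lj c1 c2.
    exists thh, (th + (j%:R - M%:R) * eta); split => //; [lra|by rewrite mul1r|split; first lra].
      move=> m u mm; rewrite in_itv /= -natr1 => /andP[u1 u2]; have [m1 m2] := mb m mm.
      have de := dn_eta; apply/andP; split; lra.
  exists (th - (j%:R - M%:R) * eta), thh; split => //; [lra|by rewrite mulN1r opprB|split; first lra].
  move=> m u mm; rewrite in_itv /= -natr1 => /andP[u1 u2]; have [m1 m2] := mb m mm.
    have de := dn_eta; apply/andP; split; lra.
have [J /andP[J1 J2] eJ] := log_likelihood_diff a0 ab bt.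
apply: (@le_trans _ _ (\sum_(i < n) path_integral tau (log_ratio tau psi r dn a b) (x i))).
  apply: pooled_ge; first by rewrite (leq_trans (leq_pred _)).
    by move=> u u0; have /andP[] := log_ratio_itv dn0 psi0 psir0 ab u0.
  move=> u m u0 mm um; rewrite log_ratio_full// ?(cab m)//.
  have mN : (m < N)%N by move: mm jN; clear; lia.
  by have /andP[] := w_cell mN u0 um.
have -> : \sum_(i < n) path_integral tau (log_ratio tau psi r dn a b) (x i) =
    log_likelihood (t j) - log_likelihood thh + n%:R * `|r| * J by rewrite -Lab eJ; ring.
apply: (@le_trans _ _ (n%:R * `|r| * J)); first by rewrite gerDr subr_le0.
by rewrite ler_wpM2l// mulrDl mul1r (le_trans J2)// lerD.
Qed.

(** Now the sum is bounded from above. [log_ratio] vanishes outside []a, b + dn[], and the ramp at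
    [b] may spill over into cell [k + 1] or into cell [j - 1] according to the orientation, so both
    are included. *)
Lemma mle_cell_left j : (0 < j <= k)%N -> (k.+2 <= N)%N ->
  log_likelihood (t j) <= log_likelihood thh ->
  n%:R * `|r| * ((k%:R - j%:R - 1) * eta) <=
  \sum_(j.-1 <= m < k.+2) wp m * (pooled_count m)%:R.
Proof.
move=> /andP[j0 jk] kN Lj; have jN : (j <= N)%N by move: jk kN; clear; lia.
have /andP[tj0 tj1] := tin jN.
have /andP[h0 h1] := thh_in; have /andP[c1 c2] := thh_cell.
have jkR : j%:R <= k%:R :> R by rewrite ler_nat.
have nr0 : 0 <= n%:R * `|r| by rewrite mulr_ge0.
have key : (k%:R - j%:R) * eta >= 0 by rewrite mulr_ge0 ?(ltW eta0)//; lra.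
have jE : j%:R = (j.-1)%:R + 1 :> R by rewrite natr1 prednK.
have [a [b [a0 ab bt Lab [bal cab]]]] : exists a b,
    [/\ 0 <= a, a <= b, b <= tau,
        orient sg * (log_likelihood b - log_likelihood a) =
          log_likelihood thh - log_likelihood (t j) &
        (k%:R - j%:R) * eta <= b - a /\
        forall u, a < u < b + dn ->
          exists2 m, (j.-1 <= m < k.+2)%N & u \in C m].
  have jk2 : (j.-1 <= k.+2)%N by move: jk; clear; lia.
  have cov := @cell_cover _ sg th eta M _ _ _ jk2.
  move: tj0 tj1 Lj c1 c2 cov; rewrite /cell /grid -!natr1 /orient.
  case: (r < 0); rewrite ?mul1r ?mulN1r => tj0 tj1 Lj c1 c2 cov.
    exists (th + (j%:R - M%:R) * eta), thh; split => //; [lra|by rewrite mul1r|split; first lra].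
    move=> u /andP[u1 u2]; apply: cov; have de := dn_eta; have e0 := eta0; rewrite jE in u1.
    by apply/andP; split; lra.
  exists thh, (th - (j%:R - M%:R) * eta); split => //; [lra|by rewrite mulN1r opprB|split; first lra].
  move=> u /andP[u1 u2]; apply: cov; have de := dn_eta; have e0 := eta0; rewrite jE in u2.
  by apply/andP; split; lra.
have [J /andP[J1 J2] eJ] := log_likelihood_diff a0 ab bt.
apply: (@le_trans _ _ (\sum_(i < n) path_integral tau (log_ratio tau psi r dn a b) (x i))); last first.
  apply: pooled_le => // u u0 fu.
  have [|m mm um] := cab u.
    apply/andP; split; rewrite ltNge; apply/negP => h; move: fu.
      by rewrite log_ratio_eq0 ?ltxx//; left.
    by rewrite log_ratio_eq0 ?ltxx//; right.
  exists m; split => //; have mN : (m < N)%N by move: mm kN; clear; lia.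
  have /andP[_] := w_cell mN u0 um; apply: le_trans.
  by have /andP[] := log_ratio_itv dn0 psi0 psir0 ab u0.
have -> : \sum_(i < n) path_integral tau (log_ratio tau psi r dn a b) (x i) =
    log_likelihood thh - log_likelihood (t j) + n%:R * `|r| * J by rewrite -Lab eJ; ring.
apply: (@le_trans _ _ (n%:R * `|r| * J)); last by rewrite lerDr subr_ge0.
by rewrite ler_wpM2l// mulrBl mul1r (le_trans _ J1)// lerB.
Qed.

End log_likelihood.

(** * Laws of the cell counts *)

Section increments.
Context d (T : measurableType d) (R : realType) (P : probability T R).
Variables (D : set R) (lam : R -> R) (X : R -> T -> nat).
Hypothesis hX : poisson_process P D lam X.
Variables (N : nat) (t : nat -> R).
Hypothesis Dt : forall i, (i <= N)%N -> D (t i).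
Hypothesis t_lt : forall i, (i < N)%N -> t i < t i.+1.

Definition increment (i : nat) (w : T) : nat := (X (t i.+1) w - X (t i) w)%N.

Lemma measurable_increment i : (i < N)%N -> measurable_fun setT (increment i).
Proof.
move=> iN; apply: measurable_fun_subn; apply: (poisson_process_measurable hX); apply: Dt => //.
exact: ltnW.
Qed.

(** The event is read in the measurable space generated by the process, where [measurable_counts]
    applies again. *)
Lemma increments_in_sigma_algebra v :
  process_sigma_algebra D X (counts N increment v).
Proof.
rewrite /process_sigma_algebra; set G := \bigcup_(_ in _) _.
have mX s : D s -> measurable_fun [set: g_sigma_algebraType G] (X s).
  move=> Ds _ B mB; apply: sub_sigma_algebra; exists s => //.
  by exists B.
suff : measurable (counts N increment v : set (g_sigma_algebraType G)) by [].
apply: measurable_counts => i iN; apply: measurable_fun_subn; apply: mX; apply: Dt => //.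
exact: ltnW.
Qed.

Lemma poisson_counts_increments : poisson_counts P N increment
  (fun i => \int[lebesgue_measure]_(u in `[t i, t i.+1]) lam u).
Proof.
move=> v; rewrite setTI mul1r.
(* The independence clause of [poisson_process] concerns infinite sequences of times, so the
   sequence is frozen after [N]. *)
pose t' i := t (minn i N).
have Dt' i : D (t' i) by apply: Dt; rewrite geq_minr.
have minE i : (i < N)%N -> minn i N = i /\ minn i.+1 N = i.+1.
  by move=> iN; split; apply/minn_idPl => //; exact: ltnW.
have nt' : nondecreasing_seq t'.
  apply/nondecreasing_seqP => i; rewrite /t'; have [iN|Ni] := ltnP i N.
    by have [_ ->] := minE i iN; rewrite ltW// t_lt.
  by rewrite (minn_idPr (leqW Ni)).
have t'E i : (i < N)%N -> t' i = t i /\ t' i.+1 = t i.+1.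
  by move=> /minE[e1 e2]; rewrite /t' e1 e2.
have /(_ (iota 0 N) (iota_uniq _ _) (fun i => [set w | increment i w = v i])) :=
  poisson_process_indep hX Dt' nt'.
have AE i : (i < N)%N -> P [set w | increment i w = v i] =
    (poisson_pmf (\int[lebesgue_measure]_(u in `[t i, t i.+1]) lam u) (v i))%:E.
  move=> iN; apply: (poisson_process_law hX); rewrite ?t_lt//; apply: Dt => //; exact: ltnW.
have -> : counts N increment v =
    \bigcap_(i in [set` iota 0 N]) [set w | increment i w = v i].
  apply/seteqP; split => w H i /=; first by rewrite mem_iota => /andP[_]; exact: H.
  by move=> iN; apply: (H i); rewrite /= mem_iota.
move=> -> => [|i]; last first.
  rewrite mem_iota add0n => /andP[_ /t'E[e1 e2]].
  by exists [set v i] => //; rewrite setTI e1 e2.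
rewrite -[N]subn0 -/(index_iota 0 N) big_mkord subn0 -prodEFin.
by apply: eq_bigr => i _; exact: AE.
Qed.

End increments.

Section pooled_increments.
Context d (T : measurableType d) (R : realType) (P : probability T R).
Variables (tau : R) (lam : R -> R) (n : nat) (X : 'I_n.+1 -> R -> T -> nat).
Hypothesis hX : poisson_sample P tau lam X.
Variables (N : nat) (t : nat -> R).
Hypothesis tin : forall i, (i <= N)%N -> 0 <= t i <= tau.
Hypothesis t_lt : forall i, (i < N)%N -> t i < t i.+1.
Let mu i := \int[lebesgue_measure]_(u in `[t i, t i.+1]) lam u.
Hypothesis mu0 : forall i, (i < N)%N -> 0 < mu i.

Lemma poisson_counts_pooled :
  poisson_counts P N (fun i w => \sum_(j < n.+1) increment (X j) t i w)%N
    (fun i => n.+1%:R * mu i).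
Proof.
have [hP hI] := hX.
have Dt i : (i <= N)%N -> `[0, tau]%classic (t i).
  by move=> iN; rewrite /= in_itv /=; exact: tin.
have -> : (fun i w => \sum_(j < n.+1) increment (X j) t i w)%N =
    (fun i w => \sum_(j < n.+1) increment (X (inord j)) t i w)%N.
  apply/funext => i; apply/funext => w; apply: eq_bigr => j _.
  by rewrite inord_val.
(* [poisson_counts_on_sum] asks for positive means at all indices, hence the value 1 from [N] on. *)
pose mu' i := if (i < N)%N then mu i else 1.
apply: (@poisson_counts_eq _ _ _ _ _ _ _ (fun i w =>
    \sum_(j < n.+1) increment (X (inord j)) t i w)%N _
  (fun i => n.+1%:R * mu' i)) => // [i iN|]; first by rewrite /mu' iN.
apply: (poisson_counts_on_sum (z := fun j => increment (X (inord j)) t)) => //.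
- by move=> j i _ iN; exact: (measurable_increment (hP _) Dt).
- by move=> i; rewrite /mu'; case: ifP => // /mu0.
move=> v; rewrite setTI mul1r.
have /(_ (index_enum 'I_n.+1) (index_enum_uniq _)
  (fun j => counts N (increment (X j) t) (v j))) := hI.
have -> : [set w | forall j, (j <= n)%N -> counts N (increment (X (inord j)) t) (v j) w] =
    \bigcap_(j in [set` index_enum 'I_n.+1]) counts N (increment (X j) t) (v j).
  apply/seteqP; split => w H j /=.
    move=> _; have := H j (ltn_ord j); by rewrite inord_val.
  move=> jn; have := H (inord j); rewrite /= mem_index_enum inordK//; exact.
move=> ->; last by move=> j _; exact: increments_in_sigma_algebra.
rewrite -prodEFin; apply: eq_bigr => j _.
have := poisson_counts_increments (hP j) Dt t_lt (v j).
rewrite setTI mul1r => ->; congr EFin; apply: eq_bigr => i _.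
by rewrite /mu' ltn_ord.
Qed.

End pooled_increments.

Section pooled_count_law.
Context d (T : measurableType d) (R : realType) (P : probability T R).
Variables (tau : R) (psi : R -> R) (r dn th : R).
Hypothesis tau0 : 0 <= tau.
Hypothesis dn0 : 0 < dn.
Hypothesis psi0 : forall t : R, 0 <= t <= tau -> 0 < psi t.
Hypothesis psir0 : forall t : R, 0 <= t <= tau -> 0 < psi t + r.
Hypothesis intpsi : lebesgue_measure.-integrable `[0, tau] (EFin \o psi).
Variables (l0 : R).
Hypothesis l0_gt0 : 0 < l0.
Hypothesis l0_le : forall t : R, 0 <= t <= tau -> l0 <= lo psi r t.
Variables (n : nat) (X : 'I_n.+1 -> R -> T -> nat).
Local Notation lam := (intensity tau psi r dn th).
Hypothesis hX : poisson_sample P tau lam X.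
Variables (eta : R) (M N : nat).
Hypothesis eta0 : 0 < eta.
Local Notation sg := (r < 0).
Local Notation t := (grid sg th eta M).
Hypothesis tin : forall i, (i <= N)%N -> 0 <= t i <= tau.

(** Closed at both ends, unlike [cell], since the mean of an increment is an integral over a closed
    interval. *)
Definition closed_cell (b : bool) (th' eta' : R) (M' m : nat) : interval R :=
  if b then `[grid b th' eta' M' m, grid b th' eta' M' m.+1]
  else `[grid b th' eta' M' m.+1, grid b th' eta' M' m].

Local Notation z := (fun m w => pooled_count r (fun j u => X j u w) th eta M m).

Lemma measurable_pooled_count m : (m < N)%N -> measurable_fun setT (z m).
Proof.
move=> mN; have [hP _] := hX.
rewrite (_ : z m = fun w => \sum_(j < n.+1)
    cell_count sg th eta M (fun u => X (inord j) u w) m)%N; last first.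
  by apply/funext => w; apply: eq_bigr => j _; rewrite inord_val.
apply: (measurable_sumn
  (f := fun j w => cell_count sg th eta M (fun u => X (inord j) u w) m)) => j _.
have mX i : (i <= N)%N -> measurable_fun setT (X (inord j) (t i)).
  by move=> iN; apply: (poisson_process_measurable (hP (inord j))); rewrite /= in_itv /=; exact: tin.
by apply: measurable_fun_addn; apply: measurable_fun_subn; apply: mX => //; exact: ltnW.
Qed.

(** The ramp contributes at most the absolute value of [r] times its length [dn], wherever it meets
    the interval. *)
Lemma intensity_cell_integral u v y e : 0 <= u -> u < v -> v <= tau ->
  (forall s, u <= s <= v -> `|lam s - y| <= e + `|r| * \1_(`[th, th + dn]) s) ->
  `|\int[lebesgue_measure]_(s in `[u, v]) lam s - y * (v - u)| <=
  e * (v - u) + `|r| * dn.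
Proof.
move=> u0 uv vt lam_y.
have intl : lebesgue_measure.-integrable `[u, v] (EFin \o lam).
  apply: integrableS (integrable_intensity r dn0 intpsi th) => //.
  move=> s /=; rewrite !in_itv /= => /andP[us sv].
  by rewrite (le_trans u0 us) (le_trans sv vt).
have intc c : lebesgue_measure.-integrable `[u, v] (EFin \o cst c).
  by apply: (@integrable_itv_bounded _ _ `|c|).
have intI : lebesgue_measure.-integrable `[u, v]
    (EFin \o (\1_(`[th, th + dn]) : R -> R)).
  apply: (@integrable_itv_bounded _ _ 1); first exact: measurable_indic.
  by move=> s _; rewrite indicE; case: (_ \in _); rewrite ?normr1 ?normr0.
have int1 c : lebesgue_measure.-integrable `[u, v] (EFin \o (fun s => c * \1_(`[th, th + dn]) s)).
  apply: (@integrable_itv_bounded _ _ `|c|).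
    by apply: measurable_funM => //; exact: measurable_indic.
  by move=> s _; rewrite normrM indicE -[leRHS]mulr1 ler_wpM2l//; case: (_ \in _);
    rewrite ?normr1 ?normr0.
rewrite -(Rintegral_itv_cst y (ltW uv)) -RintegralB//; last exact: intc.
apply: le_trans (le_normr_Rintegral _ _) _ => //.
  exact: (integrableB _ intl (intc y)).
apply: (@le_trans _ _ (\int[lebesgue_measure]_(s in `[u, v])
    (e + `|r| * \1_(`[th, th + dn]) s))).
  apply: le_Rintegral => //.
  - exact: (integrable_abse (integrableB _ intl (intc y))).
  - exact: (integrableD _ (intc e) (int1 _)).
rewrite RintegralD//; last exact: intc.
rewrite (Rintegral_itv_cst e (ltW uv)) lerD2l RintegralZl//.
rewrite ler_wpM2l// /Rintegral integral_indic//.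
rewrite -[leRHS]/(fine dn%:E) fine_le//.
- rewrite ge0_fin_numE//; apply: (@le_lt_trans _ _ (lebesgue_measure `[u, v]%classic)).
    by apply: le_measure; rewrite ?inE//; apply: measurableI.
  have := lebesgue_measure_itv `[u, v]; rewrite /= => -> /=.
  by case: ifP => _; rewrite ?ltry// -EFinB ltry.
apply: (@le_trans _ _ (lebesgue_measure `[th, th + dn]%classic)).
  by apply: le_measure; rewrite ?inE//; apply: measurableI.
have := lebesgue_measure_itv `[th, th + dn]; rewrite /= => -> /=.
by rewrite lte_fin ltrDl dn0 -EFinB lee_fin addrAC subrr add0r.
Qed.

(** The means stay implicit. What is retained is their positivity and their distance to
    [n.+1 * y * eta], for any constant [y] that approximates the intensity on the cell outside the
    ramp. *)
Lemma pooled_count_law : exists mu, poisson_counts P N z mu /\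
  forall m, (m < N)%N -> 0 < mu m /\
  forall y e, (forall s, s \in closed_cell sg th eta M m ->
      `|lam s - y| <= e + `|r| * \1_(`[th, th + dn]) s) ->
    `|mu m - n.+1%:R * (y * eta)| <= n.+1%:R * (e * eta + `|r| * dn).
Proof.
have [hP _] := hX.
have xle w (j : 'I_n.+1) a b : 0 <= a -> a <= b -> b <= tau -> (X j a w <= X j b w)%N.
  move=> a0 ab bt; apply: (counting_path_homo (poisson_process_path (hP j) w)) => //;
    rewrite /= in_itv /=; first by rewrite a0 (le_trans ab).
  by rewrite bt (le_trans a0).
(* The grid points in increasing order of time; when the grid runs backwards, the law is obtained
   along [q] and then reversed. *)
pose q i := if sg then t i else t (N - i)%N.
have qin i : (i <= N)%N -> 0 <= q i <= tau.
  by move=> iN; rewrite /q; case: ifP => _; apply: tin => //; rewrite leq_subr.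
have q_lt i : (i < N)%N -> q i.+1 - q i = eta.
  move=> iN; rewrite /q; case: (boolP sg) => s; rewrite gridB /orient.
    by rewrite mul1r -natr1; ring.
  by rewrite (natrB _ iN) (natrB _ (ltnW iN)) -natr1; ring.
have {}q_lt' i : (i < N)%N -> q i < q i.+1 by move=> /q_lt e; rewrite -subr_gt0 e.
pose mu i := \int[lebesgue_measure]_(u in `[q i, q i.+1]) lam u.
have muLU i y e : (i < N)%N -> (forall s, q i <= s <= q i.+1 ->
      `|lam s - y| <= e + `|r| * \1_(`[th, th + dn]) s) ->
    `|n.+1%:R * mu i - n.+1%:R * (y * eta)| <= n.+1%:R * (e * eta + `|r| * dn).
  move=> iN H; rewrite -mulrBr normrM ger0_norm// ler_pM2l//.
  rewrite -(q_lt i iN); apply: intensity_cell_integral => //.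
  - by have /andP[] := qin i (ltnW iN).
  - exact: q_lt'.
  - by have /andP[] := qin _ iN.
have mu0 i : (i < N)%N -> 0 < mu i.
  move=> iN.
  have Hlo s : q i <= s <= q i.+1 -> l0 <= lam s.
    move=> /andP[s1 s2]; have sin : 0 <= s <= tau.
      have /andP[a _] := qin i (ltnW iN); have /andP[_ b] := qin _ iN.
      by rewrite (le_trans a s1) (le_trans s2 b).
    apply: le_trans (l0_le sin) _; by have /andP[] := intensity_bounds psi r dn0 th sin.
  have pos : 0 < l0 * eta by rewrite mulr_gt0.
  apply: (lt_le_trans pos); rewrite -(q_lt i iN) -(Rintegral_itv_cst l0 (ltW (q_lt' i iN))).
  have isub : `[q i, q i.+1] `<=` `[0, tau]%classic.
    move=> s /=; rewrite !in_itv /= => /andP[us sv].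
    have /andP[a _] := qin i (ltnW iN); have /andP[_ b] := qin _ iN.
    by rewrite (le_trans a us) (le_trans sv b).
  apply: le_Rintegral => //.
  - by apply: (@integrable_itv_bounded _ _ `|l0|).
  - by apply: (integrableS _ _ _ (integrable_intensity r dn0 intpsi th)).
have law := poisson_counts_pooled hX qin q_lt' mu0.
case: (boolP sg) => s.
  exists (fun i => n.+1%:R * mu i); split.
    apply: poisson_counts_eq law => // i w iN; apply: eq_bigr => j _.
    rewrite /increment /cell_count /q s -[LHS]addn0; congr (_ + _)%N.
    apply/esym/eqP; rewrite subn_eq0; apply: xle.
    - by have /andP[] := tin (ltnW iN); rewrite s.
    - by have := grid_le sg th M eta0 (leqnSn i); rewrite s.
    - by have /andP[] := tin iN; rewrite s.
  move=> m mN; split=> [|y e LU]; first by rewrite mulr_gt0// mu0.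
  apply: muLU => // u; rewrite /q s => um; apply: LU.
  by rewrite /closed_cell ?s in_itv.
exists (fun i => n.+1%:R * mu (N - i.+1)%N); split.
  apply: poisson_counts_eq (poisson_counts_rev law) => // i w iN; apply: eq_bigr => j _.
  rewrite /increment /cell_count /q (negbTE s) subnSK// !subKn// 1?ltnW//.
  suff /eqP -> : (X j (grid false th eta M i.+1) w - X j (grid false th eta M i) w == 0)%N.
    by [].
  rewrite subn_eq0; apply: xle.
  - by have /andP[] := tin iN; rewrite (negbTE s).
  - by have := grid_le sg th M eta0 (leqnSn i); rewrite (negbTE s).
  - by have /andP[] := tin (ltnW iN); rewrite (negbTE s).
move=> m mN; have Nm : (N - m.+1 < N)%N by move: mN; clear; lia.
split=> [|y e LU]; first by rewrite mulr_gt0// mu0.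
apply: muLU => // u; rewrite /q (negbTE s) subnSK// !subKn// 1?ltnW// => um; apply: LU.
by rewrite /closed_cell ?(negbTE s) in_itv.
Qed.

End pooled_count_law.

(** * The limit process *)

Section near_argsup.
Context {R : realType}.
Implicit Types (f : R -> R) (x : R -> nat).

(** The default value of [lim] is 0, so a positive left limit certifies convergence. *)
Lemma lim_not_cvg f (u : R) :
  ~ (f s @[s --> u^'-] --> left_lim f u) -> left_lim f u = 0.
Proof.
by move=> ncv; rewrite /left_lim dvgP.
Qed.

(** The supremum may be approached only from the left of [u], so a nearby point reaching it up to
    the factor [expR e] stands in for [u]. Positivity of [f] makes the supremum positive, which
    excludes the default values 0 of [sup] for an unbounded range and of [lim] for a missing
    limit. *)
Lemma is_argsup_near f (u e h : R) : (forall v, 0 < f v) -> is_argsup f u ->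
  0 < e -> 0 < h ->
  exists s, `|s - u| <= h /\ forall v, f v <= f s * expR e.
Proof.
move=> f0 fu e0 h0.
have m0 : 0 < sup (range f).
  by rewrite -fu; apply: lt_le_trans (f0 u) _; rewrite le_max lexx orbT.
have hs : has_sup (range f).
  by apply: contrapT => /sup_out s0; move: m0; rewrite s0 ltxx.
have ub v : f v <= sup (range f) by apply: ub_le_sup; [case: hs|exists v].
have e1 : 1 < expR e by rewrite expR_gt1.
have case_u : sup (range f) <= f u ->
    exists s, `|s - u| <= h /\ forall v, f v <= f s * expR e.
  move=> su; exists u; rewrite subrr normr0 ltW//; split => // v.
  apply: le_trans (ub v) (le_trans su _).
  by rewrite -[leLHS]mulr1 ler_wpM2l ?ltW.
have [/case_u//|fus] := leP (sup (range f)) (f u).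
have lm : left_lim f u = sup (range f).
  by move: fu; rewrite /is_argsup; case: leP => // _ fu; move: fus; rewrite fu ltxx.
have cv : f s @[s --> u^'-] --> left_lim f u.
  by apply: contrapT => /lim_not_cvg; rewrite lm => s0; move: m0; rewrite s0 ltxx.
have d0 : 0 < sup (range f) * (1 - expR (- e)).
  by rewrite mulr_gt0// subr_gt0 expR_lt1 oppr_lt0.
have [s /andP[/andP[su us] fs]] : exists s, (u - h < s < u) &&
    (`|left_lim f u - f s| < sup (range f) * (1 - expR (- e))).
  have /cvgrPdist_lt /(_ _ d0) near1 := cv.
  near (u^'-) => s; exists s; apply/andP; split; last by near: s; exact: near1.
  apply/andP; split; near: s; first by apply: nbhs_left_gt; lra.
  exact: nbhs_left_lt.
exists s; split; first by rewrite ltr0_norm; lra.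
move=> v; rewrite -ler_pdivrMr ?expR_gt0// -expRN.
have := ub v; move: fs; rewrite lm ltr_norml => /andP[_ fs] fv.
apply: (@le_trans _ _ (sup (range f) * expR (- e))).
  by rewrite ler_wpM2r// expR_ge0.
by move: fs; rewrite mulrBr mulr1; lra.
Unshelve. all: by end_near.
Qed.

(** The integer values taken before [y] are bounded by [x y]; the largest of them is attained and is
    the constant value just before [y]. *)
Lemma left_lim_counting x (y : R) : counting_path `[0, +oo[ x -> 0 < y ->
  (forall v, 0 <= v < y -> (x v)%:R <= left_lim (fun s => (x s)%:R) y) /\
  left_lim (fun s => (x s)%:R) y <= (x y)%:R :> R.
Proof.
move=> px y0.
have xle a b : 0 <= a -> a <= b -> (x a <= x b)%N.
  move=> a0 ab; apply: (counting_path_homo px) => //; rewrite /= in_itv /= andbT//.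
  exact: le_trans ab.
pose p := [pred n | `[< exists2 v, 0 <= v < y & x v = n >]].
have exp : exists n, p n by exists (x 0); apply/asboolP; exists 0; rewrite // lexx.
have bp n : p n -> (n <= x y)%N.
  by move=> /asboolP[v /andP[v0 vy] <-]; apply: xle => //; exact: ltW.
case: (ex_maxnP exp bp) => m /asboolP[v /andP[v0 vy] xv] mmax.
have cst u : v < u < y -> x u = m.
  move=> /andP[vu uy]; apply/eqP; rewrite eqn_leq -{2}xv xle ?(ltW vu)// andbT.
  by apply: mmax; apply/asboolP; exists u; rewrite // uy (le_trans v0) ?(ltW vu).
have -> : left_lim (fun s => (x s)%:R) y = m%:R.
  by apply: (@left_lim_cst _ _ v) => // u /cst ->.
split=> [u uy|]; rewrite ler_nat.
  by apply: mmax; apply/asboolP; exists u.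
by rewrite -xv xle// ltW.
Qed.

End near_argsup.

Section zstar_cells.
Context {R : realType}.
Variables (a b : R) (yp ym : R -> nat).
Hypothesis a0 : 0 < a.
Hypothesis b0 : 0 < b.
Hypothesis pyp : counting_path `[0, +oo[ yp.
Hypothesis pym : counting_path `[0, +oo[ ym.
Variables (h : R) (M : nat).
Hypothesis h0 : 0 < h.
Local Notation sg := (b < a).
Local Notation c := (ln (Num.max a b / Num.min a b)).

Let forward := if sg then yp else ym.
Let backward := if sg then ym else yp.

(** [Y^+] and [Y^-] glued into one nondecreasing function on the line. [two_sided_left] is the
    variant that occurs in [Zstar]; the two interlace. *)
Definition two_sided (u : R) : R :=
  if 0 <= u then (yp u)%:R else - (ym (- u))%:R.

Definition two_sided_left (u : R) : R :=
  if 0 <= u then (yp u)%:R else - left_lim (fun s => (ym s)%:R) (- u).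

(** Cells from [M] on lie after the origin in the oriented sense and count the jumps of [f]; those
    before count the jumps of [g], whose time runs away from the origin. *)
Definition limit_count (f g : R -> nat) (m : nat) : nat :=
  if (M <= m)%N then (f ((m - M)%N.+1%:R * h)%R - f ((m - M)%N%:R * h)%R)%N
  else (g ((M - m)%N%:R * h)%R - g ((M - m.+1)%N%:R * h)%R)%N.

Let xle (x : R -> nat) (s t : R) : counting_path `[0, +oo[ x -> 0 <= s -> s <= t -> (x s <= x t)%N.
Proof.
move=> px s0 st; apply: (counting_path_homo px) => //; rewrite /= in_itv /= andbT//.
exact: le_trans st.
Qed.

Lemma two_sided_le (u v : R) : u <= v -> two_sided u <= two_sided v.
Proof.
move=> uv; rewrite /two_sided; have [u0|u0] := leP 0 u.
  by rewrite (le_trans u0 uv) ler_nat xle.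
have [v0|v0] := leP 0 v; last first.
  by rewrite lerN2 ler_nat; apply: xle; rewrite // ?lerN2// oppr_ge0 ltW.
by apply: (@le_trans _ _ 0); rewrite ?oppr_le0.
Qed.

Lemma two_sided_leftP (u v : R) : u < v ->
  two_sided u <= two_sided_left u /\ two_sided_left u <= two_sided v.
Proof.
move=> uv; split; rewrite /two_sided_left.
  rewrite /two_sided; case: (leP 0 u) => u0 //; rewrite lerN2.
  by apply: (left_lim_counting pym _).2; rewrite oppr_gt0.
case: (leP 0 u) => u0; first by rewrite /two_sided (le_trans u0 (ltW uv)) ler_nat; apply: xle => //; exact: ltW.
have nu0 : 0 < - u by rewrite oppr_gt0.
have [L _] := left_lim_counting pym nu0.
rewrite /two_sided; have [v0|v0] := leP 0 v.
  apply: (@le_trans _ _ 0) => //; rewrite oppr_le0; apply: le_trans (L 0 _) => //.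
  by rewrite lexx.
by rewrite lerN2; apply: L; rewrite oppr_ge0 ltrN2 uv ltW.
Qed.

Let G i := orient sg * two_sided (orient sg * ((i%:R - M%:R) * h)).

Let G_ge i : (M <= i)%N -> G i = (forward ((i - M)%N%:R * h))%:R.
Proof.
move=> Mi; have p0 : 0 <= (i - M)%N%:R * h by rewrite mulr_ge0// ltW.
rewrite /G /forward /orient /two_sided -natrB//; case: ifP => _.
  by rewrite !mul1r p0.
rewrite !mulN1r oppr_ge0 opprK; case: ifPn => [n0|_]; last by rewrite opprK.
have /eqP -> : (i - M)%N%:R * h == 0 by rewrite eq_le n0 p0.
by rewrite oppr0 (counting_path0 pyp) (counting_path0 pym) oppr0.
Qed.

Let G_le i : (i <= M)%N -> G i = - (backward ((M - i)%N%:R * h))%:R.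
Proof.
move=> iM; have p0 : 0 <= (M - i)%N%:R * h by rewrite mulr_ge0// ltW.
rewrite /G /backward /orient /two_sided -(opprB M%:R) -natrB// mulNr; case: ifP => _.
  rewrite !mul1r oppr_ge0 opprK; case: ifPn => [n0|//].
  have /eqP -> : (M - i)%N%:R * h == 0 by rewrite eq_le n0 p0.
  by rewrite oppr0 (counting_path0 pyp) (counting_path0 pym) oppr0.
by rewrite !mulN1r !opprK p0.
Qed.

Let countE m : (limit_count forward backward m)%:R = G m.+1 - G m.
Proof.
have pf : counting_path `[0, +oo[ forward by rewrite /forward; case: ifP.
have pb : counting_path `[0, +oo[ backward by rewrite /backward; case: ifP.
rewrite /limit_count; case: leqP => mM.
  rewrite natrB ?xle ?ler_wpM2r ?mulr_ge0 ?ler_nat ?(ltW h0)//.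
  by rewrite G_ge ?(leqW mM)// G_ge// subSn.
rewrite natrB ?xle ?ler_wpM2r ?mulr_ge0 ?ler_nat ?(ltW h0)//; last by lia.
by rewrite !G_le ?(ltnW mM)// opprK addrC.
Qed.

Let sum_countE m0 m1 : (m0 <= m1)%N ->
  \sum_(m0 <= m < m1) (limit_count forward backward m)%:R = G m1 - G m0.
Proof.
by move=> m01; rewrite (eq_bigr (fun m => G m.+1 - G m)) ?telescope_sumr.
Qed.

(** The shape of the log-likelihood again: a count weighted by [c] minus a linear drift, oriented by
    [b < a]. *)
Lemma ln_Zstar u : ln (Zstar a b yp ym u) =
  orient sg * (c * two_sided_left u - `|b - a| * u).
Proof.
have lnV : ln (b / a) = - ln (a / b) by rewrite -lnV ?posrE ?divr_gt0// invf_div.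
rewrite /Zstar /two_sided_left lnV.
case: (ltP b a) => ba; rewrite /orient.
  rewrite ltr0_norm ?subr_lt0//.
  by case: ifP => _; rewrite expRK; ring.
rewrite ger0_norm ?subr_ge0// -[ln (b / a)]opprK -lnV.
by case: ifP => _; rewrite expRK lnV; ring.
Qed.

Variables (s : R) (k : nat).
Hypothesis s_near : forall v, Zstar a b yp ym v <= Zstar a b yp ym s * expR (`|b - a| * h).
Hypothesis s_cell : (k%:R - M%:R) * h <= orient sg * s <= (k.+1%:R - M%:R) * h.

Let F u := orient sg * two_sided_left u.
Let x i := orient sg * ((i%:R - M%:R) * h).

Let c0 : 0 <= c.
Proof.
apply: ln_ge0; rewrite ler_pdivlMr ?lt_min ?a0// mul1r.
by rewrite ge_min !le_max lexx.
Qed.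

Let lt_step (u : R) : u < u + h. Proof. by rewrite ltrDl. Qed.

(** Passing from left limits to values at grid points costs one cell, whence [j.-1] here and [k.+2]
    in [F_upper]. *)
Let F_lower j : (0 < j)%N -> G j.-1 <= F (x j).
Proof.
move=> j0; have h0' := h0; have jR : (j.-1)%:R = j%:R - 1 :> R by rewrite -[j in RHS](prednK j0) -natr1 addrK.
rewrite /F /x /G jR /orient; case: ifP => _.
  rewrite !mul1r; apply: (le_trans _ (two_sided_leftP (lt_step _)).1).
  by apply: two_sided_le; nra.
rewrite !mulN1r lerN2; apply: (le_trans (two_sided_leftP (v := - ((j%:R - 1 - M%:R) * h)) _).2).
  by nra.
by [].
Qed.

Let F_upper : F s <= G k.+2.
Proof.
have h0' := h0; rewrite /F /G; move: s_cell; rewrite -!natr1 /orient; case: ifP => _ /andP[s1 s2].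
  rewrite !mul1r in s1 s2 *; have [_ H] := two_sided_leftP (lt_step s).
  apply: le_trans H _; apply: two_sided_le; nra.
rewrite !mulN1r in s1 s2 *; rewrite lerN2; have [H _] := two_sided_leftP (lt_step s).
apply: le_trans H; apply: two_sided_le; nra.
Qed.

Let near_ineq j : c * F (x j) - `|b - a| * ((j%:R - M%:R) * h) <=
  c * F s - `|b - a| * (orient sg * s) + `|b - a| * h.
Proof.
have Zp v : 0 < Zstar a b yp ym v by rewrite /Zstar; case: ifP => _; exact: expR_gt0.
have := s_near (x j); rewrite -ler_ln ?posrE ?mulr_gt0 ?expR_gt0//.
rewrite lnM ?posrE ?expR_gt0// expRK !ln_Zstar /F /x /orient.
by case: ifP => _; rewrite ?mul1r ?mulN1r; nra.
Qed.

(** The counts telescope to [G j.-1 - G k.+2]. The slack allowed by [s_near] is exactly one cell of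
    drift, which gives the [+ 1]; the result has the form of [mle_cell_right]. *)
Lemma argsup_cell_right j : (k < j)%N ->
  \sum_(k.+2 <= m < j.-1) c * (limit_count forward backward m)%:R <=
  `|b - a| * ((j%:R - k%:R + 1) * h).
Proof.
move=> kj; have [kj'|kj'] := leqP k.+2 j.-1; last first.
  rewrite big_geq ?(ltnW kj')// !mulr_ge0 ?(ltW h0)//.
  by have : k%:R <= j%:R :> R by [rewrite ler_nat ltnW]; lra.
rewrite -mulr_sumr sum_countE//; have j0 : (0 < j)%N by lia.
have fl := F_lower j0; have fu := F_upper; have ni := near_ineq j.
have /andP[s1 _] := s_cell; have d0 := normr_ge0 (b - a).
have : c * (G j.-1 - G k.+2) <= c * (F (x j) - F s) by rewrite ler_wpM2l// lerB.
move: ni; have : `|b - a| * ((k%:R - M%:R) * h) <= `|b - a| * (orient sg * s) by rewrite ler_wpM2l.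
move=> *; nra.
Qed.

Lemma argsup_cell_left j : (0 < j <= k)%N ->
  `|b - a| * ((k%:R - j%:R - 1) * h) <=
  \sum_(j.-1 <= m < k.+2) c * (limit_count forward backward m)%:R.
Proof.
move=> /andP[j0 jk]; rewrite -mulr_sumr sum_countE; last by lia.
have fl := F_lower j0; have fu := F_upper; have ni := near_ineq j.
have /andP[s1 _] := s_cell; have d0 := normr_ge0 (b - a).
have : c * (F s - F (x j)) <= c * (G k.+2 - G j.-1) by rewrite ler_wpM2l// lerB.
move: ni; have : `|b - a| * ((k%:R - M%:R) * h) <= `|b - a| * (orient sg * s) by rewrite ler_wpM2l.
move=> *; nra.
Qed.

End zstar_cells.

Section limit_count_law.
Context d (T : measurableType d) (R : realType) (Q : probability T R).
Variables (rf rb : R) (Yf Yb : R -> T -> nat).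
Hypothesis rf0 : 0 < rf.
Hypothesis rb0 : 0 < rb.
Hypothesis hYf : poisson_process Q `[0, +oo[ (cst rf) Yf.
Hypothesis hYb : poisson_process Q `[0, +oo[ (cst rb) Yb.
Hypothesis indep : forall A B, process_sigma_algebra `[0, +oo[ Yf A ->
  process_sigma_algebra `[0, +oo[ Yb B -> Q (A `&` B) = (Q A * Q B)%E.
Variables (h : R) (M N : nat).
Hypothesis h0 : 0 < h.
Hypothesis MN : (M <= N)%N.

Local Notation z := (fun m w => limit_count h M (Yf ^~ w) (Yb ^~ w) m).

Let tg (i : nat) : R := i%:R * h.

Let Dtg i : `[0, +oo[%classic (tg i).
Proof. by rewrite /= in_itv /= andbT mulr_ge0// ltW. Qed.

Let tg_lt i : tg i < tg i.+1.
Proof. by rewrite /tg ltr_pM2r// ltr_nat. Qed.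

Lemma measurable_limit_count m : measurable_fun setT (z m).
Proof.
rewrite /limit_count; case: leqP => _; apply: measurable_fun_subn.
- exact: (poisson_process_measurable hYf (Dtg _)).
- exact: (poisson_process_measurable hYf (Dtg _)).
- exact: (poisson_process_measurable hYb (Dtg _)).
- exact: (poisson_process_measurable hYb (Dtg _)).
Qed.

Let count_incr (c : R) Y n v : 0 < c -> poisson_process Q `[0, +oo[ (cst c) Y ->
  Q (counts n (increment Y tg) v) = (\prod_(i < n) poisson_pmf (c * h) (v i))%:E.
Proof.
move=> c0 hY; have := poisson_counts_increments hY (N := n) (fun i _ => Dtg i) (fun i _ => tg_lt i) v.
rewrite setTI mul1r => ->; congr EFin; apply: eq_bigr => i _; congr poisson_pmf.
rewrite (Rintegral_itv_cst c (ltW (tg_lt i))) /tg -natr1; congr (_ * _); ring.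
Qed.

(** The counts from cell [M] on are increments of [Yf], the earlier ones increments of [Yb] in
    reverse order, and the two groups are independent. *)
Lemma limit_count_law : poisson_counts Q N z (fun m => (if (M <= m)%N then rf else rb) * h).
Proof.
move=> v; rewrite setTI mul1r.
have -> : counts N z v = counts (N - M) (increment Yf tg) (fun i => v (M + i)%N) `&`
    counts M (increment Yb tg) (fun i => v (M - i.+1)%N).
  apply/seteqP; split => w.
    move=> H; split => i iN.
      have iMN : (M + i < N)%N by lia.
      by rewrite -(H _ iMN) /limit_count leq_addr addKn.
    have iMN : (M - i.+1 < N)%N by lia.
    rewrite -(H _ iMN) /limit_count.
    have -> : (M <= M - i.+1)%N = false by apply/negbTE; lia.
    by have [-> ->] : (M - (M - i.+1) = i.+1)%N /\ (M - (M - i.+1).+1 = i)%N by lia.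
  move=> [H1 H2] m mN; rewrite /limit_count; case: leqP => Mm.
    have mNM : (m - M < N - M)%N by lia.
    by have := H1 _ mNM; rewrite subnKC.
  have mM : (M - m.+1 < M)%N by lia.
  have := H2 _ mM; rewrite /increment /tg.
  by have [-> ->] : ((M - m.+1).+1 = M - m)%N /\ (M - (M - m.+1).+1 = m)%N by lia.
rewrite indep; last 2 first.
- by apply: increments_in_sigma_algebra => i _; exact: Dtg.
- by apply: increments_in_sigma_algebra => i _; exact: Dtg.
rewrite (count_incr _ _ rf0 hYf) (count_incr _ _ rb0 hYb) -EFinM mulrC; congr EFin.
rewrite -[RHS](big_mkord xpredT
  (fun m => poisson_pmf ((if (M <= m)%N then rf else rb) * h) (v m))).
rewrite (big_cat_nat _ MN)//=; congr (_ * _).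
  rewrite big_mkord (reindex_inj rev_ord_inj) /=; apply: eq_bigr => i _.
  rewrite leqNgt ltn_ord /=; congr (poisson_pmf _ (v _)).
  by have := ltn_ord i; lia.
rewrite [RHS](_ : _ = \prod_(0 + M <= i < N)
  poisson_pmf ((if (M <= i)%N then rf else rb) * h) (v i))// big_addn big_mkord; apply: eq_bigr => i _.
by rewrite leq_addl addnC.
Qed.

End limit_count_law.

(** * Exponential tails *)

Section exponents.
Context {R : realType}.
Variables (l0 H rho : R).
Hypothesis l00 : 0 < l0.
Hypothesis rho0 : 0 < rho.

(* A bound from below for half of the decay rate
   [(sqrt (lo + rho) - sqrt lo) ^+ 2 / 2]; the other half absorbs the errors. *)
Definition tail_rate : R := rho ^+ 2 / (16 * H).

(** The factor of [e] dominates the error terms of both exponent bounds below. *)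
Definition small_error (e : R) := 0 < e <= 1 /\ e * (H + 2 * (H / l0) + 1) <= tail_rate.

Variables (lo : R) (e : R).
Hypothesis l0lo : l0 <= lo.
Hypothesis hiH : lo + rho <= H.
Hypothesis he : small_error e.
Let c := ln ((lo + rho) / lo).
Let p := expR (c / 2).

Let lo0 : 0 < lo. Proof. exact: lt_le_trans l0lo. Qed.

Let H0 : 0 < H.
Proof. by apply: lt_le_trans hiH; apply: addr_gt0. Qed.

Let pE : lo * p ^+ 2 = lo + rho.
Proof.
rewrite /p expr2 -expRD -splitr /c lnK ?posrE ?divr_gt0 ?addr_gt0//.
by rewrite mulrC divfK// gt_eqF.
Qed.

Let p1 : 1 <= p.
Proof.
rewrite -expR0 ler_expR divr_ge0// ln_ge0// ler_pdivlMr// mul1r.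
by rewrite lerDl ltW.
Qed.

Let pH : p <= H / l0.
Proof.
have p2 : p <= p ^+ 2 by rewrite expr2 ler_peMl// (le_trans ler01).
apply: (le_trans p2); rewrite ler_pdivlMr// mulrC.
by apply: (le_trans _ hiH); rewrite -pE ler_wpM2r// sqr_ge0.
Qed.

(** Here [p] is the square root of [(lo + rho) / lo], so [rho = lo * (p - 1) * (p + 1)] and
    [lo * (p - 1) ^+ 2] equals [rho ^+ 2 / (lo * (p + 1) ^+ 2)], whose denominator is at most
    [4 * H]. *)
Let gap : 2 * tail_rate <= lo * (p - 1) ^+ 2 / 2.
Proof.
rewrite /tail_rate; have rE : rho = lo * (p - 1) * (p + 1).
  by have := pE; rewrite expr2 => h; lra.
rewrite mulrA ler_pdivrMr ?mulr_gt0// rE.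
have h1 : lo * (p + 1) ^+ 2 <= 4 * H.
  have : (p + 1) ^+ 2 <= 4 * p ^+ 2 by have := p1; nra.
  have := pE; have := lo0; have := hiH; nra.
have h2 : 0 <= lo * (p - 1) ^+ 2 by rewrite mulr_ge0 ?sqr_ge0// ltW.
have -> : 2 * (lo * (p - 1) * (p + 1)) ^+ 2 =
  2 * (lo * (p - 1) ^+ 2) * (lo * (p + 1) ^+ 2) by ring.
have : lo * (p - 1) ^+ 2 * (lo * (p + 1) ^+ 2) <= lo * (p - 1) ^+ 2 * (4 * H).
  by rewrite ler_wpM2l.
lra.
Qed.

Let expe : expR (e / 2) <= 1 + e.
Proof.
have [/andP[e0 e1] _] := he.
rewrite -[e / 2]opprK expRN -[leRHS]invrK lef_pV2 ?posrE ?invr_gt0 ?expR_gt0 ?addr_gt0//.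
apply: (le_trans _ (expR_ge1Dx _)).
by rewrite -[(1 + e)^-1]mul1r ler_pdivrMr ?addr_gt0//; nra.
Qed.

Let err_e : e * (H + 2 * (H / l0) + 1) <= tail_rate.
Proof. by case: he. Qed.

(** The factor 1/2 is the Hellinger choice: without errors the left-hand side is [lo * (p - 1) = rho
    / 2 - lo * (p - 1) ^+ 2 / 2], half of the drift less a gain of at least [2 * tail_rate]. The
    errors consume one [tail_rate]. *)
Lemma exponent_right mu wp : 0 <= mu -> mu <= lo + e -> wp <= c + e ->
  mu * (expR (wp / 2) - 1) <= rho / 2 - tail_rate.
Proof.
move=> mu0 mule wpe; have [/andP[e0 e1] _] := he.
have p1' := p1; have lo0' := lo0.
have E1 : expR (wp / 2) <= p * (1 + e).
  apply: (@le_trans _ _ (p * expR (e / 2))); last by rewrite ler_wpM2l ?expR_ge0.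
  by rewrite -expRD ler_expR -mulrDl ler_pM2r ?invr_gt0.
have E2 : 0 <= p * (1 + e) - 1 by nra.
apply: (@le_trans _ _ (mu * (p * (1 + e) - 1))); first by rewrite ler_wpM2l// lerB.
apply: (@le_trans _ _ ((lo + e) * (p * (1 + e) - 1))); first by rewrite ler_wpM2r.
have -> : (lo + e) * (p * (1 + e) - 1) =
  rho / 2 - lo * (p - 1) ^+ 2 / 2 + e * (lo * p + p * (1 + e) - 1).
  by have <- : lo * p ^+ 2 - lo = rho by [rewrite pE; ring]; field.
have lpH : lo * p <= H.
  apply: (le_trans _ hiH); rewrite -pE expr2 mulrA; apply: ler_peMr => //.
  by rewrite mulr_ge0 ?expR_ge0// ltW.
have b : lo * p + p * (1 + e) - 1 <= H + 2 * (H / l0) + 1.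
  have pe : p * e <= p by rewrite ler_piMr// expR_ge0.
  move: pH pe lpH; rewrite mulrDr mulr1.
  by move: (H / l0) (lo * p) (p * e) p => A B C D; lra.
have := gap; have := err_e.
have : e * (lo * p + p * (1 + e) - 1) <= e * (H + 2 * (H / l0) + 1).
  by rewrite ler_wpM2l// ltW.
lra.
Qed.

(** On the other side of the parameter the mean is [lo + rho] and the base [p^-1];
    [(lo + rho) * (p^-1 - 1)] equals [- (rho / 2) - lo * (p - 1) ^+ 2 / 2], the same gain. *)
Lemma exponent_left mu wm : lo + rho - e <= mu -> 0 <= mu -> c - e <= wm ->
  mu * (expR (- (wm / 2)) - 1) <= - (rho / 2) - tail_rate.
Proof.
move=> mule mu0 wme; have [/andP[e0 e1] _] := he.
have p1' := p1; have lo0' := lo0; have p0 : 0 < p by exact: expR_gt0.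
have H0' := H0; have gap' := gap; have err_e' := err_e.
have r0 : 0 <= H / l0 by rewrite divr_ge0 ?ltW.
have E1 : expR (- (wm / 2)) <= p^-1 * (1 + e).
  apply: (@le_trans _ _ (p^-1 * expR (e / 2))); last by rewrite ler_wpM2l ?invr_ge0 ?expR_ge0.
  by rewrite -expRN -expRD ler_expR; lra.
set y := p^-1 * (1 + e) - 1 in E1 *.
have hiy : (lo + rho) * y = - (rho / 2) - lo * (p - 1) ^+ 2 / 2 + e * (lo * p).
  have e2 : lo * p ^+ 2 - lo = rho by rewrite pE; ring.
  by rewrite -pE -e2 /y; field; rewrite gt_eqF.
have lpH : lo * p <= H.
  apply: (le_trans _ hiH); rewrite -pE expr2 mulrA; apply: ler_peMr => //.
  by rewrite mulr_ge0 ?expR_ge0// ltW.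
have elp : e * (lo * p) <= e * H by rewrite ler_wpM2l// ltW.
have e2H : 0 <= e * (2 * (H / l0)) by rewrite mulr_ge0 ?(ltW e0)// mulr_ge0.
have tr0 : 0 <= tail_rate by rewrite divr_ge0 ?sqr_ge0// mulr_ge0 ?(ltW H0').
have hiy0 : (lo + rho) * y <= - (rho / 2) - tail_rate - e.
  by rewrite hiy; move: err_e'; rewrite !mulrDr mulr1; lra.
have y0 : y <= 0.
  rewrite -(pmulr_rle0 _ (addr_gt0 lo0 rho0)); apply: (le_trans hiy0).
  by have := rho0; lra.
have ym1 : - 1 <= y.
  by rewrite /y; have : 0 <= p^-1 * (1 + e) by [rewrite mulr_ge0 ?invr_ge0 ?ltW// addr_gt0]; lra.
apply: (@le_trans _ _ (mu * y)); first by rewrite ler_wpM2l// /y lerB.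
apply: (@le_trans _ _ ((lo + rho - e) * y)); first by rewrite ler_wnM2r.
have -> : (lo + rho - e) * y = (lo + rho) * y - e * y by ring.
have : - e <= e * y by rewrite -[leLHS]mulr1 mulNr -mulrN ler_wpM2l// ltW.
lra.
Qed.

End exponents.

Section grid_models.
Context d (T : measurableType d) (R : realType) (P : probability T R).

(* What the statistical experiment and the limit process have in common, once
   oriented so that jumps go up and the drift goes down: cell counts on a grid,
   and near maximizers that satisfy the comparison with the grid points in [J]
   outside a null set [N0]. *)
Record grid_model (xi : T -> R) (N0 : set T) (rho h : R) (M N : nat)
    (z : nat -> T -> nat) (mu wm wp : nat -> R) (J : nat -> Prop) : Prop := {
  grid_measurable : forall i, (i < N)%N -> measurable_fun setT (z i) ;
  grid_law : poisson_counts P N z mu ;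
  grid_mu_gt0 : forall i, (i < N)%N -> 0 < mu i ;
  grid_near : forall w, ~ N0 w -> exists2 s, `|s - xi w| <= h &
    forall k, (k%:R - M%:R) * h <= s <= (k.+1%:R - M%:R) * h -> forall j, J j ->
      ((k < j <= N)%N -> \sum_(k.+2 <= m < j.-1) wm m * (z m w)%:R <=
         rho * ((j%:R - k%:R + 1) * h)) /\
      ((0 < j <= k)%N -> (k.+2 <= N)%N -> rho * ((k%:R - j%:R - 1) * h) <=
         \sum_(j.-1 <= m < k.+2) wp m * (z m w)%:R) }.

Variables (xi : T -> R) (N0 : set T) (rho kappa : R).
Hypothesis mxi : measurable_fun setT xi.
Hypothesis mN0 : measurable N0.
Hypothesis PN0 : P N0 = 0%E.
Hypothesis rho0 : 0 < rho.
Hypothesis kappa0 : 0 < kappa.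

Lemma measure_null_setD (A : set T) (b : \bar R) : measurable A ->
  (P (A `\` N0) <= b)%E -> (P A <= b)%E.
Proof.
move=> mA; apply: le_trans.
have : A `<=` (A `\` N0) `|` N0.
  by move=> w Aw; have [?|?] := pselect (N0 w); [right|left].
move=> /(le_measure P) le; apply: le_trans (le _ _) _; rewrite ?inE//.
  by apply: measurableU => //; exact: measurableD.
apply: le_trans (measureU2 _ _ _) _ => //; first exact: measurableD.
by rewrite [X in (_ + X)%E]PN0 adde0.
Qed.

Lemma cell_index (s : R) (M : nat) : - M%:R <= s ->
  exists k : nat, (k%:R - M%:R) * 1 <= s <= (k.+1%:R - M%:R) * 1.
Proof.
move=> sM; have s0 : 0 <= s + M%:R by lra.
exists (Num.truncn (s + M%:R)); have /andP[a b] := truncn_itv s0.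
by rewrite !mulr1; apply/andP; split; lra.
Qed.

Lemma expR_halfn (y : R) (n : nat) : expR (y / 2) ^+ n = expR (y * n%:R / 2).
Proof. by rewrite -expRM_natl; congr expR; rewrite -mulr_natl; ring. Qed.

Lemma prod_expR_half (w : nat -> R) (v : nat -> nat) N :
  \prod_(i < N) expR (w i / 2) ^+ v i = expR ((\sum_(i < N) w i * (v i)%:R) / 2).
Proof.
rewrite (eq_bigr (fun i : 'I_N => expR (w i * (v i)%:R / 2))); last first.
  by move=> i _; exact: expR_halfn.
by rewrite -expR_sum mulr_suml.
Qed.

(** Comparison with the origin, [j = 1]: if [xi] lies near [k0], the jumps in the cells 0 to [k + 1]
    outweigh nearly [k0] cells of drift. Cell 0 lies on the other side of the origin and has its own
    bound [C0]. For [k0 <= 3] the Chernoff condition holds without any jump. *)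
Lemma tail_right (k0 : nat) z mu wm wp J C0 :
  grid_model xi N0 rho 1 1 (k0 + 4) z mu wm wp J -> J 1%N ->
  (forall i, 0 <= wp i) ->
  (forall i, (0 < i < k0 + 4)%N -> mu i * (expR (wp i / 2) - 1) <= rho / 2 - kappa) ->
  mu 0%N * (expR (wp 0%N / 2) - 1) <= C0 ->
  (P [set w | (k0%:R <= xi w < k0%:R + 1)%R] <=
    (expR (C0 + 5 * rho) * expR (- kappa * k0%:R))%:E)%E.
Proof.
move=> gm J1 wp0 expo expo0.
have mB : measurable [set w | (k0%:R <= xi w < k0%:R + 1)%R].
  have -> : [set w | (k0%:R <= xi w < k0%:R + 1)%R] = xi @^-1` `[k0%:R, k0%:R + 1[.
    by apply/seteqP; split => w; rewrite /= in_itv.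
  by rewrite -[X in measurable X]setTI; exact: mxi.
apply: measure_null_setD => //.
apply: (@le_trans _ _ (expR (- (rho * (k0%:R - 3)) / 2) *
    expR (\sum_(i < k0 + 4) mu i * (expR (wp i / 2) - 1)))%:E).
  apply: (poisson_counts_chernoff (x := fun i => expR (wp i / 2)) _ (grid_measurable gm) (grid_mu_gt0 gm) _ _ (grid_law gm)).
  - exact: measurableD.
  - by move=> i; exact: expR_ge0.
  - exact: expR_ge0.
  move=> w [/= /andP[xi1 xi2] nN0]; rewrite (prod_expR_half wp (z ^~ w)) -expRD -[leLHS]expR0 ler_expR /=.
  have [s] := grid_near gm nN0; rewrite ler_norml => /andP[s1 s2] H.
  have [k kc] : exists k : nat, (k%:R - 1%:R) * 1 <= s <= (k.+1%:R - 1%:R) * 1.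
    by apply: cell_index; have := ler0n R k0; rewrite mulr1n; lra.
  have /andP[kc1 kc2] := kc; rewrite -natr1 in kc2; rewrite !mulr1 ?mulr1n in kc1 kc2.
  have [kl ku] : (k0 <= k + 1)%N /\ (k < k0 + 3)%N.
    by split; [rewrite -(ler_nat R)|rewrite -(ltr_nat R)]; rewrite natrD; lra.
  have [k0small|k0big] := leqP k0 3.
    have : \sum_(i < k0 + 4) wp i * (z i w)%:R >= 0.
      by apply: sumr_ge0 => i _; rewrite mulr_ge0.
    have : rho * (k0%:R - 3) <= 0 by rewrite pmulr_rle0// subr_le0 (ler_nat _ _ 3).
    by rewrite mulNr; lra.
  have k1 : (0 < 1 <= k)%N by move: kl k0big; clear; lia.
  have k2 : (k.+2 <= k0 + 4)%N by move: ku; clear; lia.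
  have [_ /(_ k1 k2)] := H k kc 1%N J1.
  have le : \sum_(0 <= m < k.+2) wp m * (z m w)%:R <= \sum_(i < k0 + 4) wp i * (z i w)%:R.
    rewrite -[leRHS](big_mkord xpredT (fun i => wp i * (z i w)%:R)).
    rewrite [leRHS](big_cat_nat (n := k.+2))//= lerDl; apply: sumr_ge0 => i _.
    by rewrite mulr_ge0.
  have klR : k0%:R <= k%:R + 1 :> R by rewrite natr1 ler_nat -addn1.
  have : rho * (k0%:R - 3) <= rho * ((k%:R - 1%:R - 1) * 1).
    by rewrite ler_wpM2l ?(ltW rho0)// mulr1 mulr1n; lra.
  by rewrite mulNr; lra.
rewrite lee_fin -!expRD ler_expR.
have -> : (k0 + 4)%N = (k0 + 3).+1 by rewrite addnS.
rewrite big_ord_recl.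
have : \sum_(i < k0 + 3) mu (lift ord0 i) * (expR (wp (lift ord0 i) / 2) - 1) <=
    \sum_(i < k0 + 3) (rho / 2 - kappa).
  apply: ler_sum => i _; apply: expo; rewrite lift0 /=.
  by case: i => i /= ik; rewrite !addnS ltnS -!addnS.
rewrite sumr_const card_ord -[_ *+ (k0 + 3)]mulr_natr natrD => le.
have := rho0; have := kappa0; have := expo0; move: le => /=; lra.
Qed.

(** The grid now ends at the origin, [j = k0 + 2]: a near maximizer far to the left means that few
    jumps occur in between, although the rate there is the high one. For [k0 <= 4] the bound exceeds
    1. *)
Lemma tail_left (k0 : nat) z mu wm wp J :
  grid_model xi N0 rho 1 (k0 + 2) (k0 + 2) z mu wm wp J -> J (k0 + 2)%N ->
  (forall i, 0 <= wm i) ->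
  (forall i, (i < k0 + 2)%N -> mu i * (expR (- (wm i / 2)) - 1) <= - (rho / 2) - kappa) ->
  (P [set w | (- (k0%:R + 1) < xi w <= - k0%:R)%R] <=
    (expR (5 * rho + 5 * kappa) * expR (- kappa * k0%:R))%:E)%E.
Proof.
move=> gm Jk wm0 expo.
have mB : measurable [set w | (- (k0%:R + 1) < xi w <= - k0%:R)%R].
  have -> : [set w | (- (k0%:R + 1) < xi w <= - k0%:R)%R] =
      xi @^-1` `]- (k0%:R + 1), - k0%:R].
    by apply/seteqP; split => w; rewrite /= in_itv.
  by rewrite -[X in measurable X]setTI; exact: mxi.
have [k0small|k0big] := leqP k0 4.
  apply: le_trans (probability_le1 P mB) _; rewrite lee_fin -expRD -[leLHS]expR0 ler_expR.
  have : kappa * k0%:R <= kappa * 4 by rewrite ler_pM2l// (ler_nat _ _ 4).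
  by have := rho0; have := kappa0; rewrite mulNr; lra.
apply: measure_null_setD => //.
(* The cell [k] of the near maximizer is random but at most 3; the cells 5 to [k0] enter the
   comparison for every such [k]. *)
pose W i := if (4 < i <= k0)%N then - wm i else 0.
have sumW (f : nat -> R) : (forall i, (i < k0 + 2)%N -> ~~ (4 < i <= k0)%N -> f i = 0) ->
    \sum_(i < k0 + 2) f i = \sum_(5 <= i < k0.+1) f i.
  move=> f0; rewrite -[LHS](big_mkord xpredT f).
  rewrite (big_cat_nat (n := 5))//=; last by rewrite addn2; move: k0big; clear; lia.
  rewrite (@big_cat_nat _ _ _ k0.+1 5)//=; [|exact: ltnW|by rewrite addn2].
  rewrite [X in X + _]big_nat_cond [X in X + _]big1 ?add0r; last first.
    move=> i /andP[/andP[_ i5] _]; apply: f0; first by rewrite addn2; move: i5 k0big; clear; lia.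
    by move: i5; clear; lia.
  rewrite [X in _ + X]big_nat_cond [X in _ + X]big1 ?addr0// => i /andP[/andP[ik i2] _].
  by apply: f0 => //; move: ik; clear; lia.
apply: (@le_trans _ _ (expR (rho * (k0%:R + 3) / 2) *
    expR (\sum_(i < k0 + 2) mu i * (expR (W i / 2) - 1)))%:E).
  apply: (poisson_counts_chernoff (x := fun i => expR (W i / 2)) _ (grid_measurable gm) (grid_mu_gt0 gm) _ _ (grid_law gm)).
  - exact: measurableD.
  - by move=> i; exact: expR_ge0.
  - exact: expR_ge0.
  move=> w [/= /andP[xi1 xi2] nN0]; rewrite (prod_expR_half W (z ^~ w)) -expRD -[leLHS]expR0 ler_expR /=.
  have [s] := grid_near gm nN0; rewrite ler_norml => /andP[s1 s2] H.
  have [k kc] : exists k : nat,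
      (k%:R - (k0 + 2)%:R) * 1 <= s <= (k.+1%:R - (k0 + 2)%:R) * 1.
    by apply: cell_index; rewrite natrD; lra.
  have /andP[kc1 kc2] := kc; rewrite -natr1 natrD in kc2; rewrite natrD in kc1.
  rewrite !mulr1 in kc1 kc2.
  have k3 : (k <= 3)%N by rewrite -(ler_nat R); lra.
  have kj : (k < k0 + 2 <= k0 + 2)%N by move: k3 k0big; clear; lia.
  have [/(_ kj) + _] := H k kc _ Jk.
  have le : \sum_(5 <= m < k0.+1) wm m * (z m w)%:R <=
      \sum_(k.+2 <= m < (k0 + 2).-1) wm m * (z m w)%:R.
    rewrite addn2 /= [leRHS](big_cat_nat (n := 5)) ?lerDr/=; last 2 first.
    - by move: k3; clear; lia.
    - by move: k0big; clear; lia.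
    by apply: sumr_ge0 => i _; rewrite mulr_ge0.
  have -> : \sum_(i < k0 + 2) W i * (z i w)%:R = - \sum_(5 <= m < k0.+1) wm m * (z m w)%:R.
    rewrite (sumW (fun i => W i * (z i w)%:R)) => [|i _ /negbTE Wi]; last first.
      by rewrite /W Wi mul0r.
    rewrite -sumrN; apply: eq_big_nat => i ik; rewrite /W ifT ?mulNr//.
  have : rho * (((k0 + 2)%:R - k%:R + 1) * 1) <= rho * (k0%:R + 3).
    by rewrite ler_wpM2l ?(ltW rho0)// natrD mulr1; have := ler0n R k; lra.
  lra.
rewrite lee_fin -!expRD ler_expR.
rewrite (sumW (fun i => mu i * (expR (W i / 2) - 1))) => [|i _ /negbTE Wi]; last first.
  by rewrite /W Wi mul0r expR0 subrr mulr0.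
have : \sum_(5 <= i < k0.+1) mu i * (expR (W i / 2) - 1) <=
    \sum_(5 <= i < k0.+1) (- (rho / 2) - kappa).
  apply: ler_sum_nat => i ik; rewrite /W ifT// mulNr; apply: expo.
  by rewrite addn2; move: ik; clear; lia.
have -> : \sum_(5 <= i < k0.+1) (- (rho / 2) - kappa) = (- (rho / 2) - kappa) * (k0%:R - 4).
  rewrite sumr_const_nat subSS -[LHS]mulr_natr natrB//; exact: ltnW.
have := rho0; have := kappa0; lra.
Qed.

End grid_models.

Section exponential_moments.
Context d (T : measurableType d) (R : realType) (P : probability T R).
Variables (xi : T -> R).
Hypothesis mxi : measurable_fun setT xi.

Let mabs : measurable_fun setT (fun w => `|xi w|).
Proof. exact: measurableT_comp. Qed.

Lemma measurable_exp_abs (k : R) : measurable_fun setT (fun w => expR (k * `|xi w|)).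
Proof. by apply: measurableT_comp => //; apply: measurable_funM. Qed.

Lemma exp_moment (C kappa : R) : 0 < kappa -> 0 <= C ->
  (forall k : nat, (P [set w | (k%:R <= `|xi w| < k%:R + 1)%R] <=
     (C * expR (- kappa * k%:R))%:E)%E) ->
  (\int[P]_w (expR (kappa / 2 * `|xi w|))%:E <=
   (C * expR (kappa / 2) / (1 - expR (- (kappa / 2))))%:E)%E.
Proof.
move=> k0 C0 tail; pose F (k : nat) := [set w | (k%:R <= `|xi w| < k%:R + 1)%R].
have mF k : measurable (F k).
  have -> : F k = (fun w => `|xi w|) @^-1` `[k%:R, k%:R + 1[.
    by apply/seteqP; split => w; rewrite /F /= in_itv.
  by rewrite -[X in measurable X]setTI; exact: mabs.
have FT : setT = \bigcup_k F k.
  apply/seteqP; split => // w _; exists (Num.truncn `|xi w|) => //.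
  by have := truncn_itv (normr_ge0 (xi w)); rewrite /F /= natr1.
rewrite [in leLHS]FT ge0_integral_bigcup//; last 2 first.
- by rewrite -FT; apply/measurable_EFinP; exact: measurable_exp_abs.
- apply/trivIsetP => i j _ _ ij; apply/seteqP; split => w // [/= /andP[a b] /andP[a' b']].
  have : (i.+1 <= j)%N \/ (j.+1 <= i)%N by move: ij; clear; lia.
  by move=> []; rewrite -(ler_nat R) -natr1 => h;
    [move: (lt_le_trans b h)|move: (lt_le_trans b' h)]; lra.
pose z := expR (- (kappa / 2)).
have z1 : `|z| < 1.
  by rewrite gtr0_norm ?expR_gt0// expR_lt1 oppr_lt0 divr_gt0.
have -> : ((C * expR (kappa / 2) / (1 - z))%:E =
    \sum_(k <oo) (C * expR (kappa / 2) * z ^+ k)%:E)%E.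
  have cg := @cvg_geometric_series R (C * expR (kappa / 2)) z z1.
  rewrite -(cvg_lim _ cg)// -EFin_lim; last by apply/cvg_ex; eexists; exact: cg.
  by apply/congr_lim/funext => n /=; rewrite /series /= -sumEFin.
apply: lee_nneseries => [k _ _|k _].
  by apply: integral_ge0 => w _; rewrite lee_fin expR_ge0.
apply: (@le_trans _ _ (\int[P]_(w in F k) (expR (kappa / 2 * (k%:R + 1)))%:E)%E).
  apply: ge0_le_integral => //.
  - apply/measurable_EFinP; apply: measurable_funS (subsetT _) _ => //.
    exact: measurable_exp_abs.
  - move=> w /andP[_ /ltW h]; rewrite lee_fin ler_expR ler_wpM2l// divr_ge0//; exact: ltW.
rewrite integral_cst// [leRHS]EFinM.
apply: (@le_trans _ _ ((expR (kappa / 2 * (k%:R + 1)))%:E * (C * expR (- kappa * k%:R))%:E)%E).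
  by rewrite lee_wpmul2l ?lee_fin ?expR_ge0//; exact: tail.
have zE : z ^+ k = expR (- (kappa / 2) * k%:R)
  by rewrite /z -expRM_natl mulrC.
have e : expR (kappa / 2 * (k%:R + 1)) * expR (- kappa * k%:R) =
    expR (kappa / 2) * expR (- (kappa / 2) * k%:R).
  by rewrite -!expRD; congr expR; field.
by rewrite -!EFinM lee_fin zE mulrCA e mulrA.
Qed.

Lemma exp_tail (l A Cm : R) : 0 < l ->
  (\int[P]_w (expR (l * `|xi w|))%:E <= Cm%:E)%E ->
  (P [set w | (A < `|xi w|)%R] <= (Cm * expR (- (l * A)))%:E)%E.
Proof.
move=> l0 hC.
have mA : measurable [set w | (A < `|xi w|)%R].
  have -> : [set w | (A < `|xi w|)%R] = (fun w => `|xi w|) @^-1` `]A, +oo[.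
    by apply/seteqP; split => w; rewrite /= in_itv /= andbT.
  by rewrite -[X in measurable X]setTI; exact: mabs.
have -> : (P [set w | (A < `|xi w|)%R] =
   \int[P]_(w in [set w | (A < `|xi w|)%R]) (cst 1%E w))%E by rewrite integral_cst ?mul1e.
rewrite mulrC EFinM; apply: (@le_trans _ _ ((expR (- (l * A)))%:E *
    \int[P]_w (expR (l * `|xi w|))%:E)%E); last first.
  by rewrite lee_wpmul2l ?lee_fin ?expR_ge0.
rewrite -ge0_integralZl_EFin ?expR_ge0//; last first.
  by apply/measurable_EFinP; exact: measurable_exp_abs.
have mE : measurable_fun setT (fun w => ((expR (- (l * A)))%:E * (expR (l * `|xi w|))%:E)%E).
  by apply: emeasurable_funM => //; apply/measurable_EFinP; exact: measurable_exp_abs.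
apply: (@le_trans _ _ (\int[P]_(w in [set w | (A < `|xi w|)%R])
   ((expR (- (l * A)))%:E * (expR (l * `|xi w|))%:E))%E); last first.
  exact: ge0_subset_integral.
apply: ge0_le_integral => //.
- exact: measurable_funS mE.
- move=> w /= h; rewrite -EFinM lee_fin -expRD -[leLHS]expR0 ler_expR -mulrN -mulrDr.
  by rewrite mulr_ge0 ?(ltW l0)// addrC subr_ge0 ltW.
Qed.

End exponential_moments.

(** * Uniform bounds for accurate grids *)

Section accurate_grids.
Context {R : realType}.
Variables (l0 H rho : R).

(** Meant for cells of step 1. [lo] may change from cell to cell with [psi]; [forward] marks the
    cells past the origin in the oriented sense, where the rate is the lower one. *)
Definition accurate_cell (e : R) (forward : bool) (lo mu wm wp : R) : Prop :=
  [/\ l0 <= lo, lo + rho <= H, `|mu - (if forward then lo else lo + rho)| <= e,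
      ln ((lo + rho) / lo) - e <= wm & wp <= ln ((lo + rho) / lo) + e].

Definition accurate_grid (e : R) (M N : nat) (mu wm wp : nat -> R) : Prop :=
  forall i, (i < N)%N -> exists lo, accurate_cell e (M <= i)%N lo (mu i) (wm i) (wp i).

(** The first term is for the right tail, with [(H + 1) * expR ((H / l0 + 1) / 2)] as bound [C0] for
    cell 0, the second for the left tail. *)
Definition tail_constant : R :=
  expR ((H + 1) * expR ((H / l0 + 1) / 2) + 5 * rho) +
  expR (5 * rho + 5 * tail_rate H rho).

Definition exp_moment_constant : R :=
  tail_constant * expR (tail_rate H rho / 2) / (1 - expR (- (tail_rate H rho / 2))).

Hypothesis l00 : 0 < l0.
Hypothesis rho0 : 0 < rho.

Lemma ln_ratio_le (lo : R) : l0 <= lo -> lo + rho <= H -> ln ((lo + rho) / lo) <= H / l0.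
Proof.
move=> l0lo loH; have lo0 := lt_le_trans l00 l0lo.
have x0 : 0 < (lo + rho) / lo by rewrite divr_gt0// addr_gt0.
apply: (@le_trans _ _ ((lo + rho) / lo)).
  have := expR_ge1Dx (ln ((lo + rho) / lo)); rewrite lnK//.
  by apply: le_trans; rewrite lerDr.
rewrite ler_pM ?invr_ge0 ?(ltW lo0)// ?lef_pV2//.
by rewrite ltW// addr_gt0.
Qed.

Lemma ln_ratio_ge (lo : R) : l0 <= lo -> lo + rho <= H -> rho / H <= ln ((lo + rho) / lo).
Proof.
move=> l0lo loH; have lo0 := lt_le_trans l00 l0lo.
have hi0 : 0 < lo + rho by rewrite addr_gt0.
have H0 : 0 < H by apply: lt_le_trans loH.
have -> : (lo + rho) / lo = (lo / (lo + rho))^-1 by rewrite invf_div.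
rewrite lnV ?posrE ?divr_gt0//.
have := expR_ge1Dx (ln (lo / (lo + rho))); rewrite lnK ?posrE ?divr_gt0// => h.
have : rho / H <= rho / (lo + rho) by rewrite ler_pM2l// lef_pV2.
have : lo / (lo + rho) = 1 - rho / (lo + rho) by field; rewrite gt_eqF.
lra.
Qed.

Section exp_moment_of_grids.
Context d (T : measurableType d) (P : probability T R).
Variables (xi : T -> R) (N0 : set T) (e : R).
Hypothesis mxi : measurable_fun setT xi.
Hypothesis mN0 : measurable N0.
Hypothesis PN0 : P N0 = 0%E.
Hypothesis he : small_error l0 H rho e.
Hypothesis H0 : 0 < H.

(** A grid is requested only for the levels [k0] that [xi] actually reaches. For the estimator this
    keeps the grid inside [[0, tau]]; at the other levels the event is empty. *)
Lemma oriented_exp_moment :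
  (forall k0 : nat, (exists w, k0%:R <= xi w < k0%:R + 1) ->
    exists z mu wm wp J, [/\ grid_model P xi N0 rho 1 1 (k0 + 4) z mu wm wp J, J 1%N,
      forall i, 0 <= wp i & accurate_grid e 1 (k0 + 4) mu wm wp]) ->
  (forall k0 : nat, (exists w, - (k0%:R + 1) < xi w <= - k0%:R) ->
    exists z mu wm wp J, [/\ grid_model P xi N0 rho 1 (k0 + 2) (k0 + 2) z mu wm wp J,
      J (k0 + 2)%N, forall i, 0 <= wm i &
      accurate_grid e (k0 + 2) (k0 + 2) mu wm wp]) ->
  (\int[P]_w (expR (tail_rate H rho / 2 * `|xi w|))%:E <= exp_moment_constant%:E)%E.
Proof.
move=> right left; have k0 : 0 < tail_rate H rho.
  by rewrite divr_gt0 ?exprn_gt0// mulr_gt0.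
have [/andP[e0 e1] _] := he.
apply: exp_moment => // [|k]; first by rewrite /tail_constant addr_ge0 ?expR_ge0.
have mI (I : interval R) : measurable (xi @^-1` [set` I]).
  by rewrite -[X in measurable X]setTI; exact: mxi.
pose Ar := [set w | (k%:R <= xi w < k%:R + 1)%R].
pose Al := [set w | (- (k%:R + 1) < xi w <= - k%:R)%R].
have mAr : measurable Ar.
  have -> : Ar = xi @^-1` `[k%:R, k%:R + 1[ by apply/seteqP; split => w; rewrite /Ar /= in_itv.
  exact: mI.
have mAl : measurable Al.
  have -> : Al = xi @^-1` `]- (k%:R + 1), - k%:R].
    by apply/seteqP; split => w; rewrite /Al /= in_itv.
  exact: mI.
have PAr : (P Ar <= (expR ((H + 1) * expR ((H / l0 + 1) / 2) + 5 * rho) *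
    expR (- tail_rate H rho * k%:R))%:E)%E.
  have [ex|nex] := pselect (exists w, k%:R <= xi w < k%:R + 1); last first.
    have -> : Ar = set0 by apply/seteqP; split => // w Aw; apply: nex; exists w.
    by rewrite measure0 lee_fin mulr_ge0 ?expR_ge0.
  have [z [mu [wm [wp [J [gm J1 wp0 acc]]]]]] := right k ex.
  apply: (tail_right mxi mN0 PN0 rho0 k0 gm J1 wp0) => [i /andP[i0 iN]|].
    have [lo [l0lo loH hmu hwm hwp]] := acc i iN.
    have mui0 := grid_mu_gt0 gm iN.
    apply: (exponent_right l00 rho0 l0lo loH he (ltW mui0)) => //.
    by move: hmu; rewrite i0 ler_norml => /andP[_]; lra.
  have i0 : (0 < k + 4)%N by rewrite addnS.
  have [lo [l0lo loH hmu hwm hwp]] := acc 0%N i0.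
  have mui0 := grid_mu_gt0 gm i0.
  have muH : mu 0%N <= H + 1 by move: hmu; rewrite ler_norml /= => /andP[_]; lra.
  have ew : expR (wp 0%N / 2) <= expR ((H / l0 + 1) / 2).
    by rewrite ler_expR; have := ln_ratio_le l0lo loH; lra.
  apply: (@le_trans _ _ (mu 0%N * expR (wp 0%N / 2))).
    by rewrite ler_wpM2l ?(ltW mui0)// gerBl.
  by rewrite ler_pM ?expR_ge0// ltW.
have PAl : (P Al <= (expR (5 * rho + 5 * tail_rate H rho) *
    expR (- tail_rate H rho * k%:R))%:E)%E.
  have [ex|nex] := pselect (exists w, - (k%:R + 1) < xi w <= - k%:R); last first.
    have -> : Al = set0 by apply/seteqP; split => // w Aw; apply: nex; exists w.
    by rewrite measure0 lee_fin mulr_ge0 ?expR_ge0.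
  have [z [mu [wm [wp [J [gm J1 wm0 acc]]]]]] := left k ex.
  apply: (tail_left mxi mN0 PN0 rho0 k0 gm J1 wm0) => i iN.
  have [lo [l0lo loH hmu hwm hwp]] := acc i iN.
  have mui0 := grid_mu_gt0 gm iN.
  apply: (exponent_left l00 rho0 l0lo loH he) => //; last exact: ltW.
  by move: hmu; rewrite leqNgt iN /= ler_norml => /andP[h _]; lra.
have sub : [set w | (k%:R <= `|xi w| < k%:R + 1)%R] `<=` Ar `|` Al.
  move=> w /= /andP[a b]; have [x0|x0] := leP 0 (xi w).
    by left; rewrite /Ar /= -(ger0_norm x0) a b.
  by right; move: a b; rewrite ltr0_norm// /Al /= => a b; apply/andP; split; lra.
apply: (@le_trans _ _ (P (Ar `|` Al))).
  apply: le_measure => //; rewrite inE; last exact: measurableU.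
  have -> : [set w | (k%:R <= `|xi w| < k%:R + 1)%R] =
      (fun w => `|xi w|) @^-1` `[k%:R, k%:R + 1[.
    by apply/seteqP; split => w; rewrite /= in_itv.
  rewrite -[X in measurable X]setTI.
  by have : measurable_fun setT (fun w => `|xi w|) by [exact: measurableT_comp]; apply.
apply: le_trans (measureU2 _ mAr mAl) _.
by rewrite /tail_constant mulrDl EFinD leeD.
Qed.

End exp_moment_of_grids.

Section mean_of_grid.
Context d (T : measurableType d) (P : probability T R).
Variables (xi : T -> R) (N0 : set T).
Hypothesis mxi : measurable_fun setT xi.
Hypothesis mN0 : measurable N0.
Hypothesis PN0 : P N0 = 0%E.

(** Replacing the weights by the constant [ln ((lo + rho) / lo)] costs at most [N * e <= rho * h],
    one cell of drift, when no cell has two jumps; with the one cell of [grid_near] this stays below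
    the 3 of [argmax_cell]. The margin of 10 cells keeps [k] away from the ends of the grid. *)
Lemma mean_of_grid (g : R -> R) (B h e eps A t lo : R) (M N Q : nat) z mu wm wp (J : nat -> Prop)
    (m : R) :
  grid_model P xi N0 rho h M N z mu wm wp J ->
  (forall j, (j <= N)%N -> J j) -> N = (2 * M)%N ->
  measurable_fun setT g -> (forall x, `|g x| <= B) ->
  0 < h -> A + 10 * h <= M%:R * h -> 0 <= A ->
  l0 <= lo -> lo + rho <= H ->
  (forall i, (i < N)%N -> mu i <= m) -> m <= 1 ->
  (forall i, (i < N)%N -> ln ((lo + rho) / lo) - e <= wm i /\
     wp i <= ln ((lo + rho) / lo) + e) -> 0 <= e -> N%:R * e <= rho * h ->
  N%:R + 12 <= Q%:R * (ln ((lo + rho) / lo) / (rho * h)) ->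
  0 <= eps ->
  (forall x y, `|x| <= A -> `|y - x| <= 9 * h -> `|g x - g y| <= eps) ->
  (P [set w | (A < `|xi w|)%R] <= t%:E)%E ->
  (`|\int[P]_w (g (xi w))%:E -
     (cell_mean N M h (ln ((lo + rho) / lo) / (rho * h)) g mu)%:E| <=
   (eps + 2 * B * (t + (N%:R * (expR 2 * m ^+ 2) +
      N%:R * Q.+1%:R * 25 * (expR 2 * m ^+ 2))))%:E)%E.
Proof.
move=> gm JN N2M mg gB h0 AM A0 l0lo loH mum m1 hw e0 Ne NQ eps0 gc PA.
set c := ln _ in hw NQ *.
have lo0 := lt_le_trans l00 l0lo.
have c0 : 0 < c by apply: lt_le_trans (ln_ratio_ge l0lo loH); rewrite divr_gt0//;
  apply: lt_le_trans loH; rewrite addr_gt0.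
have rh0 : 0 < rho * h by rewrite mulr_gt0.
have mA : measurable [set w | (A < `|xi w|)%R].
  have -> : [set w | (A < `|xi w|)%R] = (fun w => `|xi w|) @^-1` `]A, +oo[.
    by apply/seteqP; split => w; rewrite /= in_itv /= andbT.
  rewrite -[X in measurable X]setTI.
  by have : measurable_fun setT (fun w => `|xi w|) by [exact: measurableT_comp]; apply.
apply: (mean_at_argmax (m := m) (A0 := [set w | (A < `|xi w|)%R] `|` N0)
  (grid_measurable gm) _ m1 (grid_law gm)) => //.
- by move=> i iN; rewrite (grid_mu_gt0 gm iN) mum.
- by rewrite divr_gt0.
- exact: measurableU.
- apply: le_trans (measureU2 _ _ _) _ => //.
  by rewrite [X in (_ + X)%E]PN0 adde0.
- move=> w nA z1; have nN0 : ~ N0 w by move=> ?; apply: nA; right.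
  have xA : `|xi w| <= A by rewrite leNgt; apply/negP => ?; apply: nA; left.
  have [s sx Hs] := grid_near gm nN0.
  have sM : 0 <= s / h + M%:R.
    rewrite -lerBlDr sub0r ler_pdivlMr//; move: xA sx; rewrite !ler_norml.
    by move=> /andP[a1 a2] /andP[b1 b2]; lra.
  have /andP[k1 k2] := truncn_itv sM; set k := Num.truncn _ in k1 k2.
  have kc : (k%:R - M%:R) * h <= s <= (k.+1%:R - M%:R) * h.
    apply/andP; split; first by rewrite -ler_pdivlMr// lerBlDr.
    by rewrite -ler_pdivrMr// lerBrDr ltW.
  have /andP[c1 c2] := kc.
  have [kl ku] : (4 < k)%N /\ (k + 3 <= N)%N.
    move: xA sx; rewrite !ler_norml => /andP[a1 a2] /andP[b1 b2].
    have h1 : (k%:R - M%:R) * h <= (M%:R - 9) * h by rewrite mulrBl; lra.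
    have h2 : (10 - M%:R) * h <= (k.+1%:R - M%:R + 1) * h by rewrite mulrBl mulrDl; lra.
    rewrite ler_pM2r// in h1; rewrite ler_pM2r// -natr1 in h2.
    split; first by rewrite -(ltr_nat R); lra.
    by rewrite N2M -(ler_nat R) natrD natrM; lra.
  exists k; split => //; last first.
    move: sx; rewrite -natr1 in c2; rewrite !ler_norml => /andP[b1 b2].
    by apply/andP; split; lra.
  have sumN (a b : nat) : (b <= N)%N -> e * (\sum_(a <= i < b) z i w)%:R <= rho * h.
    move=> bN; apply: le_trans Ne; rewrite mulrC ler_wpM2r// ler_nat.
    apply: (@leq_trans (\sum_(a <= i < b) 1)%N).
      rewrite big_nat_cond [leqRHS]big_nat_cond; apply: leq_sum => i /andP[/andP[_ ib] _].
      by apply: z1; exact: leq_trans bN.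
    by rewrite sum_nat_const_nat muln1 (leq_trans (leq_subr _ _)).
  move=> j /andP[j0 jN]; have [R1 R2] := Hs k kc j (JN _ jN); split => kj.
    have {}R1 : \sum_(k.+2 <= m0 < j.-1) wm m0 * (z m0 w)%:R <= rho * ((j%:R - k%:R + 1) * h).
      by apply: R1; rewrite kj.
    have jN' : (j.-1 <= N)%N by rewrite (leq_trans (leq_pred _)).
    have le : (c - e) * (\sum_(k.+2 <= i < j.-1) z i w)%:R <=
        \sum_(k.+2 <= i < j.-1) wm i * (z i w)%:R.
      rewrite natr_sum mulr_sumr; apply: ler_sum_nat => i /andP[_ ij].
      by rewrite ler_wpM2r//; have [] := hw i (leq_trans ij jN').
    have := sumN k.+2 _ jN'; rewrite mulrAC ler_pdivrMr//.
    by move: le R1; rewrite mulrBl /=; lra.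
  have {}R2 : rho * ((k%:R - j%:R - 1) * h) <= \sum_(j.-1 <= m0 < k.+2) wp m0 * (z m0 w)%:R.
    by apply: R2; [rewrite j0 ltnW|move: ku; clear; lia].
  have kN' : (k.+2 <= N)%N by move: ku; clear; lia.
  have le : \sum_(j.-1 <= i < k.+2) wp i * (z i w)%:R <=
      (c + e) * (\sum_(j.-1 <= i < k.+2) z i w)%:R.
    rewrite natr_sum mulr_sumr; apply: ler_sum_nat => i /andP[_ ij].
    by rewrite ler_wpM2r//; have [] := hw i (leq_trans ij kN').
  have := sumN j.-1 _ kN'; rewrite mulrAC ler_pdivlMr//.
  by move: le R2; rewrite mulrDl /=; lra.
- move=> w nA y yx; apply: gc => //.
  by rewrite leNgt; apply/negP => ?; apply: nA; left.
Qed.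

End mean_of_grid.

End accurate_grids.

(** * The change-point model *)

Section prelimit.
Context d (T : measurableType d) (R : realType) (P : probability T R).
Variables (alpha beta tau : R) (psi : R -> R) (r dn th : R).
Hypothesis tau0 : 0 <= tau.
Hypothesis dn0 : 0 < dn.
Hypothesis psi0 : forall t : R, 0 <= t <= tau -> 0 < psi t.
Hypothesis psir0 : forall t : R, 0 <= t <= tau -> 0 < psi t + r.
Hypothesis intpsi : lebesgue_measure.-integrable `[0, tau] (EFin \o psi).
Local Notation sg := (r < 0).

Lemma maximum_likelihood_ge n (X : 'I_n -> R -> T -> nat) (thetahat : T -> R) w t :
  maximum_likelihood alpha beta tau psi r dn X thetahat -> alpha < t < beta ->
  log_likelihood tau psi r dn (fun j u => X j u w) t <=
  log_likelihood tau psi r dn (fun j u => X j u w) (thetahat w).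
Proof.
move=> /(_ w)[_ Lsup] tab; rewrite -ler_expR.
change (likelihood tau psi r dn t (fun j u => X j u w) <=
  likelihood tau psi r dn (thetahat w) (fun j u => X j u w)).
rewrite Lsup; apply: ub_le_sup; last by exists t => //; rewrite /= in_itv.
(* An unbounded set of values would have [sup] equal to 0, against the positivity of the
   likelihood. *)
apply: contrapT => nub; have := expR_gt0 (log_likelihood tau psi r dn (fun j u => X j u w) (thetahat w)).
by rewrite [expR _]Lsup sup_out ?ltxx// => -[].
Qed.

(** In the oriented numbering the cells from [M] on carry the lower intensity whatever the sign of
    [r]; the indicator accounts for the ramp. *)
Lemma intensity_closed_cell eta M m s : 0 < eta ->
  s \in closed_cell sg th eta M m -> s <= tau ->
  `|intensity tau psi r dn th s - (if (M <= m)%N then lo psi r s else hi psi r s)| <=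
  `|r| * \1_(`[th, th + dn]) s.
Proof.
move=> eta0 sm st.
have before : s <= th -> intensity tau psi r dn th s = psi s.
  by move=> sth; rewrite intensityE ramp_eq0// mulr0 addr0.
have after : th <= s -> `|intensity tau psi r dn th s - (psi s + r)| <=
    `|r| * \1_(`[th, th + dn]) s.
  move=> ths; rewrite intensityE indicE mem_setE in_itv/= ths /=.
  have -> : psi s + r * ramp tau dn th s - (psi s + r) = r * (ramp tau dn th s - 1) by ring.
  rewrite normrM ler_wpM2l//; have [h|h] := leP s (th + dn); last first.
    by rewrite ramp_eq1 ?subrr ?normr0// ltW.
  by have /andP[a b] := ramp_itv dn0 th st; rewrite /= ?mulr1n ler_norml; apply/andP; split; lra.
have side : if (M <= m)%N then (if sg then th <= s else s <= th)
            else (if sg then s <= th else th <= s).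
  move: sm; rewrite /closed_cell /grid /orient.
  have [Mm|mM] := leqP M m.
    have : (M%:R : R) <= m%:R by rewrite ler_nat.
    rewrite -natr1 => Mm'; have e0 : 0 <= (m%:R - M%:R) * eta by rewrite mulr_ge0 ?subr_ge0 ?(ltW eta0).
    by case: sg; rewrite in_itv /= => /andP[a b]; lra.
  have : (m.+1%:R : R) <= M%:R by rewrite ler_nat.
  move=> Mm'; have e0 : 0 <= (M%:R - m.+1%:R) * eta by rewrite mulr_ge0 ?subr_ge0 ?(ltW eta0).
  by case: sg; rewrite in_itv /= => /andP[a b]; lra.
have i0 : 0 <= `|r| * \1_(`[th, th + dn]) s by rewrite mulr_ge0// indicE; case: (_ \in _).
move: side; rewrite /lo /hi; have [r0|r0] := ltP r 0.
  rewrite min_r ?gerDl ?(ltW r0)// max_l ?gerDl ?(ltW r0)//.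
  by case: ifP => _; [exact: after | move=> /before ->; rewrite subrr normr0].
rewrite min_l ?lerDl// max_r ?lerDl//.
by case: ifP => _; [move=> /before ->; rewrite subrr normr0 | exact: after].
Qed.

Variables (l0 : R).
Hypothesis l0_gt0 : 0 < l0.
Hypothesis l0_le : forall t : R, 0 <= t <= tau -> l0 <= lo psi r t.
Variables (n : nat) (X : 'I_n.+1 -> R -> T -> nat) (thetahat : T -> R).
Hypothesis hX : poisson_sample P tau (intensity tau psi r dn th) X.
Hypothesis hth : maximum_likelihood alpha beta tau psi r dn X thetahat.
Hypothesis a0 : 0 < alpha.
Hypothesis bt : beta < tau.
Variables (h : R) (M N : nat).
Hypothesis h0 : 0 < h.
Hypothesis dnh : n.+1%:R * dn <= h.
Local Notation eta := (h / n.+1%:R).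
Hypothesis tin : forall i, (i <= N)%N -> 0 <= grid sg th eta M i <= tau.
Variables (wm wp lv : nat -> R) (e : R).
Hypothesis wp0 : forall m, 0 <= wp m.
Hypothesis w_cell : forall m s, (m < N)%N -> 0 <= s <= tau ->
  s \in closed_cell sg th eta M m -> wm m <= log_jump psi r s <= wp m.
Hypothesis lv_cell : forall m s, (m < N)%N -> 0 <= s <= tau ->
  s \in closed_cell sg th eta M m -> `|lo psi r s - lv m| <= e.

Lemma closed_cell_itv m s : (m < N)%N -> s \in closed_cell sg th eta M m -> 0 <= s <= tau.
Proof.
move=> mN; have := tin mN; have := tin (ltnW mN); rewrite /closed_cell.
by case: sg => /andP[? ?] /andP[? ?]; rewrite in_itv /= => /andP[? ?]; apply/andP; split; lra.
Qed.

(** The estimator itself serves as near maximizer, without null set. It is compared with the grid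
    points of []alpha, beta[], where the likelihood is maximized. *)
Lemma prelimit_grid_model : exists mu,
  grid_model P (fun w => orient sg * (n.+1%:R * (thetahat w - th))) set0 `|r| h M N
    (fun m w => pooled_count r (fun j u => X j u w) th eta M m) mu wm wp
    (fun j => alpha < grid sg th eta M j < beta) /\
  forall m, (m < N)%N ->
    `|mu m - (if (M <= m)%N then lv m else lv m + `|r|) * h| <= e * h + `|r| * (n.+1%:R * dn).
Proof.
have n0 : 0 < n.+1%:R :> R by rewrite ltr0n.
have eta0 : 0 < eta by rewrite divr_gt0.
have neta : n.+1%:R * eta = h by rewrite mulrCA divff ?mulr1 ?lt0r_neq0.
have dneta : dn <= eta by rewrite ler_pdivlMr// mulrC.
have [mu [law muP]] := pooled_count_law dn0 intpsi l0_gt0 l0_le hX eta0 tin.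
exists mu; split; last first.
  move=> m mN; have [_ H] := muP m mN.
  have := H (if (M <= m)%N then lv m else lv m + `|r|) e; rewrite mulrCA neta.
  have -> : n.+1%:R * (e * eta + `|r| * dn) = e * (n.+1%:R * eta) + `|r| * (n.+1%:R * dn) by ring.
  rewrite neta; apply=> s sm.
  have sin := closed_cell_itv mN sm; have /andP[_ st] := sin.
  have h1 := intensity_closed_cell eta0 sm st; have h2 := lv_cell mN sin sm.
  have -> : intensity tau psi r dn th s - (if (M <= m)%N then lv m else lv m + `|r|) =
    (intensity tau psi r dn th s - (if (M <= m)%N then lo psi r s else hi psi r s)) +
    (lo psi r s - lv m) by rewrite hi_lo; case: ifP => _; ring.
  by apply: le_trans (ler_normD _ _) _; rewrite addrC lerD.
split=> //.
- by move=> i iN; apply: (measurable_pooled_count hX tin).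
- by move=> i /muP[].
move=> w _; exists (orient sg * (n.+1%:R * (thetahat w - th))).
  by rewrite subrr normr0 ltW.
move=> k xik j tj.
have [] := hth w => /andP[th1 th2] _.
have thin : 0 <= thetahat w <= tau by rewrite (le_trans (ltW a0))//= (le_trans th2)// ltW.
have px j' : counting_path `[0, tau] (fun u => X j' u w).
  by have [hP _] := hX; exact: (poisson_process_path (hP j') w).
have E q : q * h = n.+1%:R * (q * eta) by rewrite mulrCA neta.
have cell_k : (k%:R - M%:R) * eta <= orient sg * (thetahat w - th) <= (k.+1%:R - M%:R) * eta.
  by move: xik; rewrite mulrCA !E !ler_pM2l.
have w_cell' m u : (m < N)%N -> 0 < u <= tau -> u \in cell sg th eta M m ->
    wm m <= log_jump psi r u <= wp m.
  move=> mN /andP[u0 ut] um; apply: w_cell => //; first by rewrite (ltW u0).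
  move: um; rewrite /cell /closed_cell; case: (r < 0); rewrite !in_itv /= => /andP[g1 g2]; apply/andP; split => //; exact: ltW.
have Lj := maximum_likelihood_ge w hth tj.
split=> [kj|jk kN].
  have := mle_cell_right tau0 dn0 psi0 psir0 intpsi px eta0 dneta tin w_cell' thin cell_k kj Lj.
  by move=> H; apply: le_trans H _; rewrite E [leRHS]mulrCA [leRHS]mulrA.
have := mle_cell_left tau0 dn0 psi0 psir0 intpsi px eta0 dneta tin wp0 w_cell' thin cell_k jk kN Lj.
by apply: le_trans; rewrite E [leLHS]mulrCA [leLHS]mulrA.
Qed.

End prelimit.

Section limit.
Context d (T : measurableType d) (R : realType) (Q : probability T R).
Variables (a b : R) (Yp Ym : R -> T -> nat) (eta : T -> R).
Hypothesis a0 : 0 < a.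
Hypothesis b0 : 0 < b.
Hypothesis ab : a != b.
Hypothesis hQ : limit_argsup Q a b Yp Ym eta.

Lemma Zstar_gt0 yp ym u : 0 < Zstar a b yp ym u.
Proof. by rewrite /Zstar; case: ifP => _; exact: expR_gt0. Qed.

Lemma limit_independence (c : bool) A B :
  process_sigma_algebra `[0, +oo[ (if c then Yp else Ym) A ->
  process_sigma_algebra `[0, +oo[ (if c then Ym else Yp) B ->
  Q (A `&` B) = (Q A * Q B)%E.
Proof.
suff ind A' B' : process_sigma_algebra `[0, +oo[ Yp A' -> process_sigma_algebra `[0, +oo[ Ym B' ->
    Q (A' `&` B') = (Q A' * Q B')%E.
  by case: c => hA hB; [exact: ind | rewrite setIC muleC; exact: ind].
move=> hA hB; have := limit_indep hQ (J := [:: true; false]) isT.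
move=> /(_ (fun i => if i then A' else B')); rewrite !big_cons big_nil mule1 => <-.
  congr (Q _); apply/seteqP; split => w; first by move=> [wA wB] [].
  by move=> x; split; [exact: (x true) | exact: (x false)].
by case.
Qed.

(** The null set carries the points where [eta] fails to be an argsup. As the supremum may be only a
    left limit at [eta], a point within [h] replaces it, with one cell of drift as slack. *)
Lemma limit_grid_model : exists N0, [/\ measurable N0, Q N0 = 0%E &
  forall (h : R) (M N : nat), 0 < h -> (M <= N)%N -> exists z,
  grid_model Q (fun w => orient (b < a) * eta w) N0 `|b - a| h M N z
    (fun m => (if (M <= m)%N then Num.min a b else Num.max a b) * h)
    (fun=> ln (Num.max a b / Num.min a b)) (fun=> ln (Num.max a b / Num.min a b))
    (fun=> True)].
Proof.
have [N0 [mN0 QN0 subN0]] := limit_eta hQ; exists N0; split=> // h M N h0 MN.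
have ba0 : 0 < `|b - a| by rewrite normr_gt0 subr_eq0 eq_sym.
have hf : poisson_process Q `[0, +oo[ (cst (Num.min a b)) (if b < a then Yp else Ym).
  by have [ba|ba] := ltP b a; [exact: (limit_Yp hQ) | exact: (limit_Ym hQ)].
have hb : poisson_process Q `[0, +oo[ (cst (Num.max a b)) (if b < a then Ym else Yp).
  by have [ba|ba] := ltP b a; [exact: (limit_Ym hQ) | exact: (limit_Yp hQ)].
have min0 : 0 < Num.min a b by rewrite lt_min a0.
have max0 : 0 < Num.max a b by rewrite lt_max a0.
eexists; split.
- by move=> i iN; exact: (measurable_limit_count hf hb M h0).
- by apply: (limit_count_law min0 max0 hf hb) => // A B; exact: limit_independence.
- by move=> i _; rewrite mulr_gt0//; case: ifP.
move=> w nw; have arg : is_argsup (Zstar a b (Yp ^~ w) (Ym ^~ w)) (eta w).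
  by apply: contrapT => narg; apply: nw; exact: subN0.
have [s [sw s_near]] := is_argsup_near (Zstar_gt0 _ _) arg (mulr_gt0 ba0 h0) h0.
exists (orient (b < a) * s).
  by rewrite -mulrBr normr_orient.
move=> k s_cell j _.
have pyp := poisson_process_path (limit_Yp hQ) w.
have pym := poisson_process_path (limit_Ym hQ) w.
have R1 := argsup_cell_right a0 b0 pyp pym h0 s_near s_cell (j := j).
have R2 := argsup_cell_left a0 b0 pyp pym h0 s_near s_cell (j := j).
have E1 : (if b < a then Yp else Ym) ^~ w = if b < a then Yp ^~ w else Ym ^~ w by case: ifP.
have E2 : (if b < a then Ym else Yp) ^~ w = if b < a then Ym ^~ w else Yp ^~ w by case: ifP.
by split=> [/andP[kj _]|jk _]; rewrite E1 E2; [exact: R1 | exact: R2].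
Qed.

End limit.

(** * Compactness arguments and constants of the model *)

Lemma near_rectangle (R : realType) (P : R -> R -> Prop) (x d : R) : 0 < d ->
  (forall x' i, `|x' - x| < d -> 0 < i -> i < d -> P i x') ->
  \forall x' \near x & i \near (0 : R)^'+, P i x'.
Proof.
move=> d0 H; exists (ball x d, [set i | 0 < i /\ i < d]).
  split=> /=; first exact: nbhsx_ballx.
  near=> i; split; near: i; first exact: nbhs_right_gt.
  exact: nbhs_right_lt.
move=> [x' i] /= [bx [i0 id]]; apply: H => //.
by move: bx; rewrite -ball_normE /= distrC.
Unshelve. all: by end_near.
Qed.

Lemma continuous_modulus (R : realType) (f : R -> R) (a b e : R) : 0 < e ->
  {within `[a, b], continuous f} ->
  exists2 d, 0 < d & forall s t, a <= s <= b -> a <= t <= b -> `|s - t| <= d ->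
    `|f s - f t| <= e.
Proof.
move=> e0 cf; have e20 : 0 < e / 2 by rewrite divr_gt0.
have /compact_near_coveringP cover := @segment_compact R a b.
pose P d (s : R) := a <= s <= b -> forall t, a <= t <= b -> `|s - t| <= d -> `|f s - f t| <= e.
have /= := cover _ (0 : R)^'+ P _ _; case.
  move=> x xab; have /= := (subspace_continuousP _ _).1 cf x xab.
  move=> /cvgrPdist_le /(_ _ e20); rewrite /within /= => -[d /= d0 dP].
  have close t : a <= t <= b -> `|t - x| < d -> `|f x - f t| <= e / 2.
    by move=> tab tx; apply: (dP t); [rewrite /= distrC | rewrite /= in_itv].
  have d20 : 0 < d / 2 by rewrite divr_gt0.
  apply: (near_rectangle d20) => s i sx i0 id sab t tab st.
  have h1 := close s sab ltac:(lra).
  have : `|t - x| < d.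
    have -> : t - x = (s - x) - (s - t) by ring.
    by apply: le_lt_trans (ler_normB _ _) _; lra.
  move=> /(close t tab) h2.
  have -> : f s - f t = (f x - f t) - (f x - f s) by ring.
  by apply: le_trans (ler_normB _ _) _; lra.
move=> d /= d0 dP; exists (d / 2); first by rewrite divr_gt0.
move=> s t sab tab st.
have d20 : 0 < d / 2 by rewrite divr_gt0.
have := dP (d / 2); rewrite /= sub0r normrN ger0_norm ?(ltW d20)//.
by move=> /(_ ltac:(lra) d20 s ltac:(by rewrite /= in_itv)) H; exact: (H sab).
Qed.

Lemma compact_margin (R : realType) (K : set R) (a b : R) : compact K ->
  K `<=` `]a, b[ -> exists2 d, 0 < d & forall x, K x -> a + d <= x <= b - d.
Proof.
move=> /compact_near_coveringP cover Kab.
have /= := cover _ (0 : R)^'+ (fun d x => a + d <= x <= b - d) _ _; case.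
  move=> x /Kab; rewrite /= in_itv /= => /andP[ax xb].
  have d0 : 0 < Num.min (x - a) (b - x) / 2 by rewrite divr_gt0// lt_min !subr_gt0 ax.
  apply: (near_rectangle d0) => s i; rewrite ltr_norml => /andP[s1 s2] i0 id.
  have m1 : Num.min (x - a) (b - x) <= x - a by rewrite ge_min lexx.
  have m2 : Num.min (x - a) (b - x) <= b - x by rewrite ge_min lexx orbT.
  by apply/andP; split; lra.
move=> d /= d0 dP; exists (d / 2); first by rewrite divr_gt0.
have d20 : 0 < d / 2 by rewrite divr_gt0.
have := dP (d / 2); rewrite /= sub0r normrN ger0_norm ?(ltW d20)// => H x Kx.
by apply: H => //; lra.
Qed.

Section intensity_constants.
Context {R : realType}.
Variables (tau : R) (psi : R -> R) (r : R).
Hypothesis tau0 : 0 <= tau.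
Hypothesis psi_cont : {within `[0, tau], continuous psi}.
Hypothesis psi0 : forall t : R, 0 <= t <= tau -> 0 < psi t.
Hypothesis r_gt : - inf [set psi t | t in `[0, tau]] < r.

Lemma psir_gt0 (t : R) : 0 <= t <= tau -> 0 < psi t + r.
Proof.
move=> tin; have : inf [set psi t | t in `[0, tau]] <= psi t.
  apply: ge_inf; last by exists t => //; rewrite /= in_itv.
  by exists 0 => _ [s + <-]; rewrite /= in_itv => /psi0/ltW.
by have := r_gt; lra.
Qed.

Lemma loE (t : R) : lo psi r t = psi t + Num.min 0 r.
Proof. by rewrite /lo -{1}[psi t]addr0 -addr_minr. Qed.

Lemma lo_bounds : exists l0 H, [/\ 0 < l0, 0 < H &
  forall t : R, 0 <= t <= tau -> l0 <= lo psi r t /\ lo psi r t + `|r| <= H].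
Proof.
have [c + cmin] := EVT_min tau0 psi_cont; have [C + Cmax] := EVT_max tau0 psi_cont.
rewrite !in_itv /= => Cin cin.
have l0 : 0 < lo psi r c by apply: (lo_gt0 psi0) => //; exact: psir_gt0.
have lC : 0 < lo psi r C by apply: (lo_gt0 psi0) => //; exact: psir_gt0.
exists (lo psi r c), (lo psi r C + `|r|); split=> //; first by rewrite ltr_wpDr.
by move=> t tin; rewrite !loE !lerD2r cmin ?Cmax// in_itv.
Qed.

Lemma integrable_psi : lebesgue_measure.-integrable `[0, tau] (EFin \o psi).
Proof. by apply: continuous_compact_integrable => //; exact: segment_compact. Qed.

End intensity_constants.

(** Both [ln (x + rho)] and [ln x] increase, the former more slowly, so the variation is at most
    that of [ln], which is Lipschitz with constant [1 / l] from [l] on. *)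
Lemma ln_ratio_lip (R : realType) (l rho x y : R) : 0 < l -> 0 <= rho -> l <= x -> l <= y ->
  `|ln ((x + rho) / x) - ln ((y + rho) / y)| <= `|x - y| / l.
Proof.
move=> l0 rho0; wlog xy : x y / x <= y.
  move=> W lx ly; have [xy|/ltW yx] := leP x y; first exact: W.
  by rewrite distrC (distrC x); exact: W.
move=> lx ly; have x0 := lt_le_trans l0 lx; have y0 := lt_le_trans l0 ly.
have xr : 0 < x + rho by rewrite ltr_wpDr. have yr : 0 < y + rho by rewrite ltr_wpDr.
rewrite !ln_div ?posrE//.
have h1 : ln (x + rho) <= ln (y + rho) by rewrite ler_ln ?posrE// lerD2r.
have h2 : ln y - ln x <= (y - x) / l.
  rewrite -ln_div ?posrE//; apply: (@le_trans _ _ (y / x - 1)).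
    have := expR_ge1Dx (ln (y / x)); rewrite lnK ?posrE ?divr_gt0//; lra.
  have -> : y / x - 1 = (y - x) / x by rewrite mulrBl divff ?lt0r_neq0.
  by rewrite ler_wpM2l ?subr_ge0// lef_pV2.
have h3 : ln (y + rho) - ln (x + rho) <= ln y - ln x.
  rewrite -!ln_div ?posrE// ler_ln ?posrE ?divr_gt0// ler_pdivlMr// mulrAC ler_pdivrMr//.
  by nra.
rewrite (ler0_norm (x := x - y)) ?subr_le0// opprB.
have h0 : 0 <= (y - x) / l by rewrite divr_ge0 ?subr_ge0// ltW.
by rewrite ler_norml; apply/andP; split; lra.
Qed.

Section prelimit_models.
Context d (T : measurableType d) (R : realType) (P : probability T R).
Variables (alpha beta tau : R) (psi : R -> R) (r dn th : R).
Hypothesis tau0 : 0 <= tau.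
Hypothesis dn0 : 0 < dn.
Hypothesis psi0 : forall t : R, 0 <= t <= tau -> 0 < psi t.
Hypothesis psir0 : forall t : R, 0 <= t <= tau -> 0 < psi t + r.
Hypothesis intpsi : lebesgue_measure.-integrable `[0, tau] (EFin \o psi).
Local Notation sg := (r < 0).
Variables (l0 H : R).
Hypothesis l0_gt0 : 0 < l0.
Hypothesis lo_in : forall t : R, 0 <= t <= tau -> l0 <= lo psi r t /\ lo psi r t + `|r| <= H.
Variables (n : nat) (X : 'I_n.+1 -> R -> T -> nat) (thetahat : T -> R).
Hypothesis hX : poisson_sample P tau (intensity tau psi r dn th) X.
Hypothesis hth : maximum_likelihood alpha beta tau psi r dn X thetahat.
Hypothesis a0 : 0 < alpha.
Hypothesis bt : beta < tau.
Local Notation xi := (fun w => orient sg * (n.+1%:R * (thetahat w - th))).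
Local Notation jump_ratio u := (ln ((u + `|r|) / u)).

Lemma log_jump_ratio t : log_jump psi r t = jump_ratio (lo psi r t).
Proof. by rewrite /log_jump hi_lo. Qed.

Lemma lo_diff s t : lo psi r s - lo psi r t = psi s - psi t.
Proof. by rewrite !loE; ring. Qed.

(** Each cell is represented by the value of [lo] at its grid point [m], and the modulus of
    continuity of [psi] controls the rest. Truncating the weights at 0 makes them nonnegative and
    respects [log_jump], itself nonnegative. *)
Lemma local_grid_model (h e : R) (M N : nat) : 0 < h -> n.+1%:R * dn <= h ->
  (forall i, (i <= N)%N -> 0 <= grid sg th (h / n.+1%:R) M i <= tau) -> 0 <= e ->
  (forall s t, 0 <= s <= tau -> 0 <= t <= tau -> `|s - t| <= h / n.+1%:R ->
     `|psi s - psi t| <= e) ->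
  exists z mu wm wp,
  [/\ grid_model P xi set0 `|r| h M N z mu wm wp
        (fun j => alpha < grid sg th (h / n.+1%:R) M j < beta),
      forall m, 0 <= wm m, forall m, 0 <= wp m &
      forall m, (m < N)%N -> let u := lo psi r (grid sg th (h / n.+1%:R) M m) in
        [/\ `|mu m - (if (M <= m)%N then u else u + `|r|) * h| <=
              e * h + `|r| * (n.+1%:R * dn),
            jump_ratio u - e / l0 <= wm m & wp m <= jump_ratio u + e / l0]].
Proof.
move=> h0 dnh tin e0 psi_e; set eta := h / n.+1%:R in tin psi_e *.
have eta0 : 0 < eta by rewrite divr_gt0.
have el0 : 0 <= e / l0 by rewrite divr_ge0// ltW.
have l0_le t : 0 <= t <= tau -> l0 <= lo psi r t by move=> /lo_in[].
pose c m := jump_ratio (lo psi r (grid sg th eta M m)).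
have close m s : (m < N)%N -> s \in closed_cell sg th eta M m -> `|s - grid sg th eta M m| <= eta.
  move=> mN; rewrite /closed_cell; have := gridB sg th eta M m.+1 m.
  have -> : (m.+1%:R - m%:R) * eta = eta by rewrite -natr1; ring.
  rewrite /orient; case: sg => E; rewrite in_itv /= => /andP[s1 s2];
    by rewrite ler_norml; apply/andP; split; lra.
have tN m : (m < N)%N -> 0 <= grid sg th eta M m <= tau by move=> /ltnW/tin.
have lo_e m s : (m < N)%N -> 0 <= s <= tau -> s \in closed_cell sg th eta M m ->
    `|lo psi r s - lo psi r (grid sg th eta M m)| <= e.
  by move=> mN sin sm; rewrite lo_diff; apply: psi_e => //; [exact: tN | exact: close].
have c_e m s : (m < N)%N -> 0 <= s <= tau -> s \in closed_cell sg th eta M m ->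
    `|log_jump psi r s - c m| <= e / l0.
  move=> mN sin sm; rewrite log_jump_ratio.
  apply: le_trans (ln_ratio_lip l0_gt0 _ _ _) _ => //; [exact: l0_le | exact: l0_le (tN _ mN) |].
  by rewrite ler_pM2r ?invr_gt0//; exact: lo_e.
have c0 m : (m < N)%N -> 0 <= c m.
  by move=> mN; rewrite /c -log_jump_ratio; apply: (log_jump_ge0 psi0 psir0); exact: tN.
have [|||mu [gm muP]] := @prelimit_grid_model _ _ _ P alpha beta tau psi r dn th tau0 dn0 psi0 psir0
  intpsi l0 l0_gt0 l0_le n X thetahat hX hth a0 bt h M N h0 dnh tin
  (fun m => Num.max 0 (c m - e / l0)) (fun m => Num.max 0 (c m + e / l0))
  (fun m => lo psi r (grid sg th eta M m)) e.
- by move=> m; rewrite le_max lexx.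
- move=> m s mN sin sm; have := c_e m s mN sin sm; rewrite ler_norml => /andP[c1 c2].
  have := log_jump_ge0 psi0 psir0 sin => j0.
  by rewrite ge_max le_max j0; apply/andP; split; [lra | apply/orP; right; lra].
- exact: lo_e.
eexists; exists mu, (fun m => Num.max 0 (c m - e / l0)), (fun m => Num.max 0 (c m + e / l0)).
split; first exact: gm.
- by move=> m; rewrite le_max lexx.
- by move=> m; rewrite le_max lexx.
move=> m mN /=; split; first exact: muP.
- by rewrite le_max lexx orbT.
by rewrite ge_max lexx andbT addr_ge0// c0.
Qed.

Hypothesis th_in : alpha < th < beta.
Hypothesis mth : measurable_fun setT thetahat.
Hypothesis r0 : r != 0.
Hypothesis H0 : 0 < H.

Lemma measurable_xi : measurable_fun setT xi.
Proof. by apply: measurable_funM => //; apply: measurable_funM => //; exact: measurable_funB. Qed.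

(** Long grids are needed although the observation window is bounded. A level reached by [xi] comes
    from an estimator in [[alpha, beta]], and the margins between this interval and [[0, tau]] have
    room for four more cells. *)
Lemma prelimit_exp_moment (e e1 : R) : small_error l0 H `|r| e -> 0 <= e1 ->
  e1 <= e / 2 -> e1 / l0 <= e -> n.+1%:R * dn <= 1 -> `|r| * (n.+1%:R * dn) <= e / 2 ->
  4 / n.+1%:R <= alpha -> 4 / n.+1%:R <= tau - beta ->
  (forall s t, 0 <= s <= tau -> 0 <= t <= tau -> `|s - t| <= 1 / n.+1%:R ->
     `|psi s - psi t| <= e1) ->
  (\int[P]_w (expR (tail_rate H `|r| / 2 * `|xi w|))%:E <=
   (exp_moment_constant l0 H `|r|)%:E)%E.
Proof.
move=> he e10 e1e e1l dn1 rdn n1 n2 mod1.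
have ar0 : 0 < `|r| by rewrite normr_gt0.
have n0 : 0 < n.+1%:R :> R by rewrite ltr0n.
have thE w : thetahat w = th + orient sg * (xi w / n.+1%:R).
  by rewrite -mulrA orientK mulrC mulKf ?lt0r_neq0// addrC subrK.
have in_range (x : R) : (exists w, `|x - xi w| <= 4) \/ `|x| <= 4 ->
    0 <= th + orient sg * (x * (1 / n.+1%:R)) <= tau.
  have four (y : R) : `|y| <= 4 -> `|orient sg * (y / n.+1%:R)| <= 4 / n.+1%:R.
    move=> y4; rewrite normr_orient normrM [`|n.+1%:R^-1|]gtr0_norm ?invr_gt0// ler_pM2r ?invr_gt0//.
  rewrite mul1r => -[[w]|].
    have [/andP[t1 t2] _] := hth w.
    move: (thE w) => /=; move: (orient sg * (n.+1%:R * (thetahat w - th))) => y Ey /four.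
    have -> : orient sg * ((x - y) / n.+1%:R) = orient sg * (x / n.+1%:R) - orient sg * (y / n.+1%:R).
      by rewrite mulrBl mulrBr.
    by move: n1 n2 Ey t1 t2; rewrite ler_norml; move: (4 / _) (orient sg * _) (orient sg * _) => p q q' n1 n2 Ey t1 t2 /andP[x1 x2]; apply/andP; split; lra.
  move=> /four; rewrite ler_norml.
  by move: n1 n2 th_in; move: (4 / _) (orient sg * _) => p q n1 n2 /andP[t1 t2] /andP[x1 x2]; apply/andP; split; lra.
(* By convexity of [[0, tau]], in either orientation, it suffices to locate two points that enclose
   the grid. *)
have between u v x : u <= x <= v ->
    0 <= th + orient sg * (u * (1 / n.+1%:R)) <= tau ->
    0 <= th + orient sg * (v * (1 / n.+1%:R)) <= tau ->
    0 <= th + orient sg * (x * (1 / n.+1%:R)) <= tau.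
  rewrite mul1r; have i0 : 0 < n.+1%:R^-1 :> R by rewrite invr_gt0.
  rewrite -(ler_pM2r i0 u) -(ler_pM2r i0 x).
  move: (u / _) (x / _) (v / _) => u' x' v' /andP[ux xv].
  rewrite /orient; case: sg; rewrite ?mul1r ?mulN1r => /andP[? ?] /andP[? ?]; apply/andP; split; lra.
have accurate h M N z mu wm wp J : [/\ grid_model P xi set0 `|r| h M N z mu wm wp J,
      forall m, 0 <= wm m, forall m, 0 <= wp m &
      forall m, (m < N)%N -> let u := lo psi r (grid sg th (1 / n.+1%:R) M m) in
        [/\ `|mu m - (if (M <= m)%N then u else u + `|r|) * 1| <=
              e1 * 1 + `|r| * (n.+1%:R * dn),
            jump_ratio u - e1 / l0 <= wm m & wp m <= jump_ratio u + e1 / l0]] ->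
    (forall i, (i <= N)%N -> 0 <= grid sg th (1 / n.+1%:R) M i <= tau) ->
    accurate_grid l0 H `|r| e M N mu wm wp.
  move=> [_ _ _ acc] tin i iN; exists (lo psi r (grid sg th (1 / n.+1%:R) M i)).
  have [l1 l2] := lo_in (tin i (ltnW iN)); have [] := acc i iN; rewrite !mulr1 => m1 m2 m3.
  split=> //.
  - by apply: le_trans m1 _; rewrite [leRHS]splitr lerD.
  - by apply: le_trans m2; rewrite lerD2l lerN2.
  - by apply: le_trans m3 _; rewrite lerD2l.
have grid_th M : grid sg th (1 / n.+1%:R) M M = th by rewrite /grid subrr mul0r mulr0 addr0.
apply: (oriented_exp_moment l0_gt0 ar0 measurable_xi (measurable0) (measure0 P) he H0).
  move=> k0 [w /andP[w1 w2]].
  have tin i : (i <= k0 + 4)%N -> 0 <= grid sg th (1 / n.+1%:R) 1 i <= tau.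
    move=> ik; have : (i%:R : R) <= k0%:R + 4 by rewrite -natrD ler_nat.
    move=> ik'; have i0 : 0 <= i%:R :> R by [].
    apply: (between (- 4) (xi w + 4)).
    - by apply/andP; split; lra.
    - by apply: in_range; right; rewrite normrN ger0_norm.
    - by apply: in_range; left; exists w; rewrite addrAC subrr add0r ger0_norm.
  have [z [mu [wm [wp G]]]] := local_grid_model ltr01 dn1 tin e10 mod1.
  have acc := accurate _ _ _ _ _ _ _ _ G tin; have [gm _ wp0 _] := G.
  by exists z, mu, wm, wp; eexists; split; [exact: gm | rewrite /= grid_th | exact: wp0 | exact: acc].
move=> k0 [w /andP[w1 w2]].
have tin i : (i <= k0 + 2)%N -> 0 <= grid sg th (1 / n.+1%:R) (k0 + 2) i <= tau.
  move=> ik; have : (i%:R : R) <= k0%:R + 2 by rewrite -natrD ler_nat.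
  move=> ik'; have i0 : 0 <= i%:R :> R by [].
  rewrite /grid natrD; apply: (between (xi w - 4) 4).
  - by apply/andP; split; lra.
  - by apply: in_range; left; exists w; rewrite addrAC subrr add0r normrN ger0_norm.
  - by apply: in_range; right; rewrite ger0_norm.
have [z [mu [wm [wp G]]]] := local_grid_model ltr01 dn1 tin e10 mod1.
have acc := accurate _ _ _ _ _ _ _ _ G tin; have [gm wm0 _ _] := G.
by exists z, mu, wm, wp; eexists; split; [exact: gm | rewrite /= grid_th | exact: wm0 | exact: acc].
Qed.

End prelimit_models.

(** * Comparison of the experiment with its limit *)

Lemma abse_dist_triangle (R : realType) (x y u v : \bar R) (k k' l : R) :
  (`|x - u| <= k%:E)%E -> (`|y - v| <= k'%:E)%E -> (`|u - v| <= l%:E)%E ->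
  (`|x - y| <= (k + k' + l)%:E)%E.
Proof.
case: x => [x| |]; case: y => [y| |]; case: u => [u| |]; case: v => [v| |] //=.
rewrite !lee_fin => h1 h2 h3.
have -> : x - y = (x - u) - (y - v) + (u - v) by ring.
apply: le_trans (ler_normD _ _) _; apply: lerD => //.
by apply: le_trans (ler_normB _ _) _; exact: lerD.
Qed.

Lemma small_error_exists (R : realType) (l0 H rho : R) : 0 < l0 -> 0 < H -> 0 < rho ->
  exists2 e, 0 < e & small_error l0 H rho e.
Proof.
move=> l00 H0 rho0.
have k0 : 0 < tail_rate H rho by rewrite divr_gt0 ?exprn_gt0// mulr_gt0.
have D0 : 0 < H + 2 * (H / l0) + 1.
  by rewrite addr_gt0// addr_gt0// mulr_gt0// divr_gt0.
exists (Num.min 1 (tail_rate H rho / (H + 2 * (H / l0) + 1))).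
  by rewrite lt_min ltr01 divr_gt0.
split; first by rewrite lt_min ltr01 divr_gt0// ge_min lexx.
by rewrite -ler_pdivlMr// ge_min lexx orbT.
Qed.

Section limit_moments.
Context d (T : measurableType d) (R : realType) (Q : probability T R).
Variables (a b : R) (Yp Ym : R -> T -> nat) (eta : T -> R) (l0 H : R).
Hypothesis a0 : 0 < a.
Hypothesis b0 : 0 < b.
Hypothesis ab : a != b.
Hypothesis hQ : limit_argsup Q a b Yp Ym eta.
Hypothesis meta : measurable_fun setT eta.
Hypothesis l00 : 0 < l0.
Hypothesis H0 : 0 < H.
Hypothesis l0_le : l0 <= Num.min a b.
Hypothesis le_H : Num.max a b <= H.

Lemma max_minD : Num.max a b = Num.min a b + `|b - a|.
Proof.
by have [h|h] := leP a b; [rewrite ger0_norm ?subr_ge0//|rewrite ltr0_norm ?subr_lt0//]; ring.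
Qed.

Lemma limit_exp_moment :
  (\int[Q]_w (expR (tail_rate H `|b - a| / 2 * `|orient (b < a) * eta w|))%:E <=
   (exp_moment_constant l0 H `|b - a|)%:E)%E.
Proof.
have ba0 : 0 < `|b - a| by rewrite normr_gt0 subr_eq0 eq_sym.
have [e e0 he] := small_error_exists l00 H0 ba0.
have [N0 [mN0 QN0 gm]] := limit_grid_model a0 b0 ab hQ.
have c0 : 0 <= ln (Num.max a b / Num.min a b).
  by rewrite ln_ge0// max_minD ler_pdivlMr ?(lt_le_trans l00)// mul1r lerDl.
have acc M N : accurate_grid l0 H `|b - a| e M N
    (fun m => (if (M <= m)%N then Num.min a b else Num.max a b) * 1)
    (fun=> ln (Num.max a b / Num.min a b)) (fun=> ln (Num.max a b / Num.min a b)).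
  move=> i iN; exists (Num.min a b); rewrite /accurate_cell -max_minD; split=> //.
  - by rewrite mulr1 subrr normr0 ltW.
  - by rewrite gerBl ltW.
  - by rewrite lerDl ltW.
have mxi : measurable_fun setT (fun w => orient (b < a) * eta w) by exact: measurable_funM.
apply: (oriented_exp_moment l00 ba0 mxi mN0 QN0 he H0) => k0 _.
  have [z G] := gm 1 1%N (k0 + 4)%N ltr01 ltac:(by rewrite addn4).
  by exists z; do 4 eexists; split; [exact: G | | | exact: acc].
have [z G] := gm 1 (k0 + 2)%N (k0 + 2)%N ltr01 (leqnn _).
by exists z; do 4 eexists; split; [exact: G | | | exact: acc].
Qed.

End limit_moments.

Section mean_gap.
Context d (T : measurableType d) (R : realType) (P : probability T R).
Variables (alpha beta tau : R) (psi : R -> R) (r dn th : R).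
Hypothesis tau0 : 0 <= tau.
Hypothesis dn0 : 0 < dn.
Hypothesis psi0 : forall t : R, 0 <= t <= tau -> 0 < psi t.
Hypothesis psir0 : forall t : R, 0 <= t <= tau -> 0 < psi t + r.
Hypothesis intpsi : lebesgue_measure.-integrable `[0, tau] (EFin \o psi).
Variables (l0 H : R).
Hypothesis l0_gt0 : 0 < l0.
Hypothesis H0 : 0 < H.
Hypothesis lo_in : forall t : R, 0 <= t <= tau -> l0 <= lo psi r t /\ lo psi r t + `|r| <= H.
Variables (n : nat) (X : 'I_n.+1 -> R -> T -> nat) (thetahat : T -> R).
Hypothesis hX : poisson_sample P tau (intensity tau psi r dn th) X.
Hypothesis hth : maximum_likelihood alpha beta tau psi r dn X thetahat.
Hypothesis mth : measurable_fun setT thetahat.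
Hypothesis a0 : 0 < alpha.
Hypothesis bt : beta < tau.
Hypothesis r0 : r != 0.
Context d' (T' : measurableType d') (Q : probability T' R).
Variables (Yp Ym : R -> T' -> nat) (eta : T' -> R).
Hypothesis hQ : limit_argsup Q (psi th) (psi th + r) Yp Ym eta.
Hypothesis meta : measurable_fun setT eta.
Local Notation sg := (r < 0).
Local Notation xi := (fun w => orient sg * (n.+1%:R * (thetahat w - th))).
Local Notation zeta := (fun w => orient sg * eta w).

(** Both means are compared with [cell_mean] for the same [N], [M], [h] and [s], since both models
    have the same [lo psi r th] and jump size at [th]; the Poisson means alone differ. The value
    [m = 2 * (H * h)] lets the means of the experiment exceed [H * h] by the error. *)
Lemma mean_gap (g : R -> R) (B A eps h e t : R) (M K : nat) :
  let m := 2 * (H * h) in let N := (2 * M)%N in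
  let E := eps + 2 * B * (t + (N%:R * (expR 2 * m ^+ 2) +
      N%:R * K.+1%:R * 25 * (expR 2 * m ^+ 2))) in
  measurable_fun setT g -> (forall x, `|g x| <= B) ->
  0 < h -> 0 <= A -> A + 10 * h <= M%:R * h -> 0 <= eps ->
  (forall x y, `|x| <= A -> `|y - x| <= 9 * h -> `|g x - g y| <= eps) ->
  n.+1%:R * dn <= h -> 0 <= e ->
  (forall s u, 0 <= s <= tau -> 0 <= u <= tau -> `|s - u| <= M%:R * (h / n.+1%:R) ->
     `|psi s - psi u| <= e) ->
  M%:R * (h / n.+1%:R) < th - alpha -> M%:R * (h / n.+1%:R) < beta - th ->
  2 * (H * h) <= 1 -> e * h + e * h + `|r| * (n.+1%:R * dn) <= H * h ->
  (2 * M)%N%:R * (e / l0 + e / l0) <= `|r| * h ->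
  (2 * M)%N%:R + 12 <= K%:R / (H * h) ->
  (P [set w | (A < `|xi w|)%R] <= t%:E)%E -> (Q [set w | (A < `|zeta w|)%R] <= t%:E)%E ->
  (`|\int[P]_w (g (xi w))%:E - \int[Q]_w (g (zeta w))%:E| <=
   (E + E + (2 ^ N)%:R * (B * (N%:R * ((1 + m) *
      (e * h + e * h + `|r| * (n.+1%:R * dn))))))%:E)%E.
Proof.
move=> m N E mg gB h0 A0 AM eps0 g_eps dnh e0 psi_e tha thb m1 emu eN NK tP tQ.
have ar0 : 0 < `|r| by rewrite normr_gt0.
have n0 : 0 < n.+1%:R :> R by rewrite ltr0n.
have hn0 : 0 < h / n.+1%:R by rewrite divr_gt0.
have Mh0 : 0 <= M%:R * (h / n.+1%:R) by rewrite mulr_ge0// ltW.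
have el0 : 0 <= e / l0 by rewrite divr_ge0// ltW.
have M1 : 1 <= M%:R :> R.
  by rewrite -(ler_pM2r h0) mul1r; apply: le_trans AM; have h0' := h0; lra.
have thin : 0 <= th <= tau.
  by move: tha thb Mh0 a0 bt; move: (M%:R * _) => q *; apply/andP; split; lra.
have th_near i : (i <= N)%N -> `|grid sg th (h / n.+1%:R) M i - th| <= M%:R * (h / n.+1%:R).
  move=> iN; rewrite /grid addrAC subrr add0r normr_orient normrM (gtr0_norm hn0) ler_pM2r//.
  have : (i%:R : R) <= 2 * M%:R by rewrite -natrM ler_nat.
  by have i0 : 0 <= i%:R :> R by []; rewrite ler_norml => ?; apply/andP; split; lra.
have tab i : (i <= N)%N -> alpha < grid sg th (h / n.+1%:R) M i < beta.
  move=> /th_near; move: tha thb; move: (M%:R * _) (grid _ _ _ _ _) => q u tha thb.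
  by rewrite ler_norml => /andP[u1 u2]; apply/andP; split; lra.
have tin i : (i <= N)%N -> 0 <= grid sg th (h / n.+1%:R) M i <= tau.
  by move=> /tab/andP[u1 u2]; rewrite (ltW (lt_trans a0 u1)) (ltW (lt_trans u2 bt)).
have psi_e' s u : 0 <= s <= tau -> 0 <= u <= tau -> `|s - u| <= h / n.+1%:R ->
    `|psi s - psi u| <= e.
  by move=> sin uin su; apply: psi_e => //; apply: le_trans su _; rewrite ler_peMl// ltW.
have [z [mu [wm [wp [gm wm0 wp0 acc]]]]] := local_grid_model tau0 dn0 psi0 psir0 intpsi
  l0_gt0 lo_in hX hth a0 bt h0 dnh tin e0 psi_e'.
have [l1 l2] := lo_in thin.
have lo_th i : (i < N)%N ->
    `|lo psi r (grid sg th (h / n.+1%:R) M i) - lo psi r th| <= e.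
  move=> iN; rewrite lo_diff; apply: psi_e => //; first exact: tin (ltnW iN).
  exact: th_near (ltnW iN).
pose mu' i := (if (M <= i)%N then lo psi r th else lo psi r th + `|r|) * h.
have lo0 : 0 < lo psi r th by exact: lt_le_trans l1.
have mu'0 i : 0 < mu' i by rewrite /mu' mulr_gt0//; case: ifP => _ //; rewrite addr_gt0.
have mu'H i : mu' i <= H * h.
  rewrite /mu' ler_pM2r//; case: ifP => _ //; apply: le_trans l2; by rewrite lerDl.
have mumu i : (i < N)%N -> `|mu i - mu' i| <= e * h + e * h + `|r| * (n.+1%:R * dn).
  move=> iN; have [h1 _ _] := acc i iN; have h2 := lo_th i iN.
  set u := lo psi r (grid sg th (h / n.+1%:R) M i) in h1 h2.
  have -> : mu i - mu' i = (mu i - (if (M <= i)%N then u else u + `|r|) * h) +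
      (u - lo psi r th) * h by rewrite /mu'; case: ifP => _; ring.
  apply: le_trans (ler_normD _ _) _; rewrite [leRHS]addrAC lerD// normrM (gtr0_norm h0).
  by rewrite ler_pM2r.
have mum i : (i < N)%N -> mu i <= m.
  move=> iN; have := mumu i iN; have := mu'H i; rewrite ler_norml /m => a1 /andP[_ a2].
  by move: a1 a2 emu; move: (mu i) (mu' i) (H * h) => x y q *; lra.
have acc_c i : (i < N)%N -> ln ((lo psi r th + `|r|) / lo psi r th) - (e / l0 + e / l0) <= wm i /\
    wp i <= ln ((lo psi r th + `|r|) / lo psi r th) + (e / l0 + e / l0).
  move=> iN; have [_ h1 h2] := acc i iN.
  have [l1' _] := lo_in (tin i (ltnW iN)).
  have := ln_ratio_lip l0_gt0 (normr_ge0 r) l1' l1.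
  have : `|lo psi r (grid sg th (h / n.+1%:R) M i) - lo psi r th| / l0 <= e / l0.
    by rewrite ler_pM2r ?invr_gt0// lo_th.
  move: h1 h2; set q := e / l0; set q' := _ / l0; set x := ln _; set y := ln _.
  by move=> h1 h2 h3; rewrite ler_norml => /andP[h4 h5]; split; lra.
have c_ge := ln_ratio_ge l0_gt0 ar0 l1 l2.
have NK' : N%:R + 12 <= K%:R * (ln ((lo psi r th + `|r|) / lo psi r th) / (`|r| * h)).
  apply: le_trans NK _; rewrite ler_wpM2l// -[(H * h)^-1](mulKf (lt0r_neq0 ar0)).
  have -> : `|r|^-1 * (`|r| * (H * h)^-1) = `|r| / H / (`|r| * h).
    by rewrite !invfM; ring.
  by rewrite ler_pM2r// invr_gt0 mulr_gt0.
have mxi : measurable_fun setT xi.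
  by apply: measurable_funM => //; apply: measurable_funM => //; exact: measurable_funB.
have G1 := mean_of_grid l0_gt0 ar0 mxi measurable0 (measure0 P) gm tab erefl
  mg gB h0 AM A0 l1 l2 mum m1 acc_c ltac:(by rewrite addr_ge0) eN NK' eps0 g_eps tP.
have ab : psi th != psi th + r by rewrite -{1}[psi th]addr0 (inj_eq (addrI _)) eq_sym.
have [N0 [mN0 QN0 lim]] := limit_grid_model (psi0 thin) (psir0 thin) ab hQ.
have MN : (M <= N)%N by rewrite /N mul2n -addnn leq_addr.
have [z' gm'] := lim h M N h0 MN.
have lohi : Num.max (psi th) (psi th + r) = lo psi r th + `|r| by rewrite -hi_lo.
move: gm'; rewrite -/(lo psi r th) lohi.
have -> : (psi th + r < psi th) = sg by rewrite gtrDl.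
have -> : psi th + r - psi th = r by rewrite addrAC subrr add0r.
move=> gm'.
have mzeta : measurable_fun setT zeta by exact: measurable_funM.
have G2 := mean_of_grid l0_gt0 ar0 mzeta mN0 QN0 gm' (fun _ _ => I) erefl
  mg gB h0 AM A0 l1 l2 (m := m) _ m1 (e := e / l0 + e / l0) _ _ eN NK' eps0 g_eps tQ.
apply: (abse_dist_triangle G1 (G2 _ _ _)).
- move=> i _; apply: le_trans (mu'H i) _.
  by rewrite /m; move: (mulr_gt0 H0 h0); move: (H * h) => q *; lra.
- by move=> i _; rewrite gerBl lerDl addr_ge0.
- by rewrite addr_ge0.
rewrite -EFinB lee_fin; apply: cell_mean_lip => // i iN.
- exact: (grid_mu_gt0 gm).
- rewrite mu'0 /=; apply: le_trans (mu'H i) _.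
  by rewrite /m; move: (mulr_gt0 H0 h0); move: (H * h) => q *; lra.
Qed.

End mean_gap.

(** * Truncated powers *)

Section moments.
Context {R : realType}.
Variables (p l A dl : R).
Hypothesis p0 : 0 < p.
Hypothesis l0 : 0 < l.
Hypothesis dl0 : 0 < dl.
Hypothesis dlA : dl <= A.

(* The clamp from below keeps the argument of [ln] away from 0. *)
Definition clamped_power (x : R) : R := expR (p * ln (Num.max dl (Num.min `|x| A))).

(** From [x <= c * expR (x / c)] with [c = 2 * p / l], raised to the power [p]: half of the
    exponential rate [l] is spent on the power. *)
Definition power_constant : R := (2 * p / l) `^ p.

Let A0 : 0 < A. Proof. exact: lt_le_trans dlA. Qed.

Lemma clamped_powerE x : clamped_power x = (Num.max dl (Num.min `|x| A)) `^ p.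
Proof. by rewrite /powR gt_eqF// lt_max dl0. Qed.

Lemma continuous_clamped_power : continuous clamped_power.
Proof.
move=> x; apply: (@continuous_comp _ _ _ (fun x => p * ln (Num.max dl (Num.min `|x| A))) expR);
  last exact: continuous_expR.
apply: cvgM; first exact: cvg_cst.
apply: (@continuous_comp _ _ _ (fun x => Num.max dl (Num.min `|x| A)) (@ln R)); last first.
  by apply: continuous_ln; rewrite lt_max dl0.
apply: continuous_max; first exact: cvg_cst.
by apply: continuous_min; [exact: norm_continuous | exact: cvg_cst].
Qed.

Lemma clamped_power_le x : `|clamped_power x| <= A `^ p.
Proof.
rewrite clamped_powerE ger0_norm ?powR_ge0// ge0_ler_powR ?nnegrE ?(ltW p0) ?(ltW A0)//.
  by rewrite le_max (ltW dl0).
by rewrite ge_max dlA ge_min lexx orbT.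
Qed.

Lemma power_le_exp (x : R) : `|x| `^ p <= power_constant * expR (l / 2 * `|x|).
Proof.
have c0 : 0 < 2 * p / l by rewrite divr_gt0// mulr_gt0.
have -> : l / 2 * `|x| = (`|x| / (2 * p / l)) * p.
  by rewrite invfM invrK invfM; field; rewrite !lt0r_neq0.
rewrite expRM /power_constant -powRM ?expR_ge0 ?(ltW c0)//.
have h : `|x| <= 2 * p / l * expR (`|x| / (2 * p / l)).
  rewrite -ler_pdivrMl// mulrC; apply: le_trans (expR_ge1Dx _); by rewrite lerDr.
by apply: ge0_ler_powR => //; rewrite ?nnegrE ?(ltW p0)// mulr_ge0 ?expR_ge0 ?(ltW c0).
Qed.

(** Below [dl] both terms lie between 0 and the [p]-th power of [dl]; from [dl] to [A] they agree;
    above [A] half of the rate [l] controls the power and the other half gives the factor decaying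
    in [A]. *)
Lemma clamped_power_near (x : R) : `| `|x| `^ p - clamped_power x| <=
  dl `^ p + power_constant * expR (- (l / 2 * A)) * expR (l * `|x|).
Proof.
have c0 : 0 <= power_constant by exact: powR_ge0.
have d0 : 0 <= dl `^ p by exact: powR_ge0.
have e0 : 0 <= power_constant * expR (- (l / 2 * A)) * expR (l * `|x|).
  by rewrite !mulr_ge0 ?expR_ge0.
rewrite clamped_powerE; have [xA|Ax] := leP `|x| A.
  have [xd|dx] := leP `|x| dl; last by rewrite subrr normr0 addr_ge0.
  apply: le_trans (_ : dl `^ p <= _); last by rewrite lerDl.
  have : `|x| `^ p <= dl `^ p by rewrite ge0_ler_powR ?nnegrE ?(ltW p0) ?(ltW dl0).
  have := powR_ge0 `|x| p => h1 h2.
  by rewrite ler_norml; apply/andP; split; lra.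
rewrite max_r// ger0_norm; last first.
  by rewrite subr_ge0 ge0_ler_powR ?nnegrE ?(ltW p0) ?(ltW A0) ?(ltW Ax).
apply: (@le_trans _ _ (`|x| `^ p)); first by rewrite gerBl powR_ge0.
apply: le_trans (power_le_exp x) _.
apply: le_trans (_ : power_constant * expR (- (l / 2 * A)) * expR (l * `|x|) <= _); last by rewrite lerDr.
rewrite -[leRHS]mulrA ler_wpM2l// -expRD ler_expR.
have l20 : 0 < l / 2 by rewrite divr_gt0.
by have := ler_wpM2l (ltW l20) (ltW Ax); lra.
Qed.

Context d (T : measurableType d) (P : probability T R) (xi : T -> R) (C : R).
Hypothesis mxi : measurable_fun setT xi.
Hypothesis PC : (\int[P]_w (expR (l * `|xi w|))%:E <= C%:E)%E.

Lemma moment_truncation :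
  (`|\int[P]_w (`|xi w| `^ p)%:E - \int[P]_w (clamped_power (xi w))%:E| <=
   (dl `^ p + power_constant * expR (- (l / 2 * A)) * C)%:E)%E.
Proof.
have mE := measurable_exp_abs mxi l.
have iE : P.-integrable setT (EFin \o (fun w => expR (l * `|xi w|))).
  apply/integrableP; split; first exact/measurable_EFinP.
  rewrite (eq_integral (fun w => (expR (l * `|xi w|))%:E)); last first.
    by move=> w _ /=; rewrite ger0_norm ?expR_ge0.
  exact: le_lt_trans PC (ltry _).
have mp : measurable_fun setT (fun w => `|xi w| `^ p).
  by apply: (measurableT_comp (measurable_powR p)); exact: measurableT_comp.
have mc : measurable_fun setT (fun w => clamped_power (xi w)).
  by apply: measurableT_comp mxi; exact: continuous_measurable_fun continuous_clamped_power.
have c0 : 0 <= power_constant by exact: powR_ge0.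
have ip : P.-integrable setT (EFin \o (fun w => `|xi w| `^ p)).
  apply: (le_integrable measurableT) (integrableZl measurableT power_constant iE).
    exact/measurable_EFinP.
  move=> w _ /=; rewrite lee_fin [`|_ `^ _|]ger0_norm ?powR_ge0// [`|_ * _|]ger0_norm ?mulr_ge0 ?expR_ge0//.
  apply: le_trans (power_le_exp _) _; rewrite ler_wpM2l// ler_expR ler_wpM2r//.
  by have l0' := l0; lra.
have ic : P.-integrable setT (EFin \o (fun w => clamped_power (xi w))).
  by apply: (@integrable_bounded _ _ _ P _ (A `^ p)) => // w; exact: clamped_power_le.
rewrite -integralB_EFin//; apply: le_trans (le_abse_integral _ _ _) _ => //.
  by apply/measurable_EFinP; exact: measurable_funB.
have mk c : measurable_fun setT (fun w => (c * expR (l * `|xi w|))%:E).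
  by apply/measurable_EFinP; exact: measurable_funM.
have H1 : (\int[P]_w `|(`|xi w| `^ p)%:E - (clamped_power (xi w))%:E| <=
    \int[P]_w ((dl `^ p)%:E +
      (power_constant * expR (- (l / 2 * A)) * expR (l * `|xi w|))%:E))%E.
  apply: ge0_le_integral => //.
  - by apply: measurableT_comp => //; apply/measurable_EFinP; exact: measurable_funB.
  - by apply: emeasurable_funD => //; exact: mk.
  - by move=> w _; rewrite -EFinB -EFinD lee_fin; exact: clamped_power_near.
apply: (le_trans H1); rewrite ge0_integralD//; last 2 first.
- by move=> w _; rewrite lee_fin powR_ge0.
- by move=> w _; rewrite lee_fin !mulr_ge0 ?expR_ge0.
have -> : (\int[P]__ (dl `^ p)%:E = (dl `^ p)%:E)%E.
  by rewrite integral_cst// [X in (_ * X)%E]probability_setT mule1.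
rewrite EFinD leeD2l//.
under eq_integral do rewrite EFinM.
rewrite ge0_integralZl_EFin ?mulr_ge0 ?expR_ge0//; last by apply/measurable_EFinP.
by rewrite [leRHS]EFinM lee_wpmul2l// lee_fin mulr_ge0 ?expR_ge0.
Qed.

End moments.

(** * Choice of the parameters and uniform convergence *)

Lemma expR_decay (R : realType) (c k x : R) : 0 < k -> c / k <= x -> c * expR (- x) <= k.
Proof.
move=> k0; rewrite ler_pdivrMr// => cx; rewrite expRN ler_pdivrMr ?expR_gt0//.
apply: le_trans cx _; rewrite mulrC ler_pM2l//; apply: le_trans (expR_ge1Dx x).
by rewrite lerDr.
Qed.

(** The bound [K] on the number of jumps in a resonance depends on [A] and [H] only and precedes
    [h]. With [h = 1 / L] and [M * h = A + 10], the number of cells is of order [L] and the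
    probability of a pair of order [1 / L ^ 2], so the error is [Z / L]. *)
Lemma mean_parameters (R : realType) (B H d e : R) (A : nat) :
  0 < B -> 0 < H -> 0 < d -> 0 < e -> exists (h : R) (M K : nat),
  let m := 2 * (H * h) in let N := (2 * M)%N in
  [/\ 0 < h, A%:R + 10 * h <= M%:R * h, 9 * h <= d, m <= 1 &
    N%:R + 12 <= K%:R / (H * h) /\
    2 * B * (N%:R * (expR 2 * m ^+ 2) + N%:R * K.+1%:R * 25 * (expR 2 * m ^+ 2)) <= e].
Proof.
move=> B0 H0 d0 e0.
pose K := (Num.truncn (H * (2 * A%:R + 32))).+1.
have HK : H * (2 * A%:R + 32) <= K%:R.
  have := truncn_itv (x := H * (2 * A%:R + 32)); rewrite mulr_ge0 ?(ltW H0)// => /(_ isT).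
  by move=> /andP[_ /ltW].
pose Z := 2 * B * (2 * (A%:R + 10) * (expR 2 * (4 * H ^+ 2)) * (1 + K.+1%:R * 25)).
have Z0 : 0 <= Z.
  by rewrite /Z !mulr_ge0 ?expR_ge0 ?exprn_ge0 ?(ltW B0) ?(ltW H0) ?addr_ge0.
(* The three terms are the lower bounds on [L] that give [9 * h <= d], [m <= 1] and [Z / L <= e]. *)
pose q := 9 / d + 2 * H + Z / e.
have [q1 q2 q3] : [/\ 9 / d <= q, 2 * H <= q & Z / e <= q].
  have i1 : 0 <= 9 / d by rewrite divr_ge0// ltW.
  have i3 : 0 <= Z / e by rewrite divr_ge0// ltW.
  have i2 : 0 <= 2 * H by rewrite mulr_ge0// ltW.
  by rewrite /q; split; move: i1 i2 i3; move: (9 / d) (2 * H) (Z / e) => u v w *; lra.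
pose L := (Num.truncn q).+1.
have qL : q <= L%:R.
  have i1 : 0 <= 9 / d by rewrite divr_ge0// ltW.
  have := truncn_itv (le_trans i1 q1).
  by move=> /andP[_ /ltW].
have L0 : 0 < L%:R :> R by rewrite ltr0n.
have L1 : 1 <= L%:R :> R by rewrite ler1n.
exists L%:R^-1, ((A + 10) * L)%N, K => m N.
have Mh : ((A + 10) * L)%:R * L%:R^-1 = A%:R + 10 :> R.
  by rewrite natrM mulfK ?lt0r_neq0// natrD.
have N2 : N%:R = 2 * (A%:R + 10) * L%:R :> R by rewrite /N !natrM natrD mulrA.
have iL : 0 < L%:R^-1 :> R by rewrite invr_gt0.
split; first exact: iL.
- by rewrite Mh lerD2l -[leRHS]mulr1 ler_pM2l// invf_le1.
- by rewrite ler_pdivrMr// mulrC -ler_pdivrMr//; exact: le_trans q1 qL.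
- by rewrite /m mulrA ler_pdivrMr// mul1r; exact: le_trans q2 qL.
split.
  rewrite invfM invrK mulrA N2.
  apply: (@le_trans _ _ ((2 * A%:R + 32) * L%:R)); first by nra.
  by rewrite ler_pM2r// ler_pdivlMr// mulrC.
rewrite N2 /m; apply: (@le_trans _ _ (Z / L%:R)).
  by rewrite le_eqVlt; apply/orP; left; apply/eqP; rewrite /Z; field; rewrite lt0r_neq0.
by rewrite ler_pdivrMr// mulrC -ler_pdivrMr//; exact: le_trans q3 qL.
Qed.

Section change_point.
Variables (R : realType) (alpha beta tau : R) (psi : R -> R) (r : R) (delta : nat -> R).
Hypothesis alpha_gt0 : 0 < alpha.
Hypothesis alpha_lt_beta : alpha < beta.
Hypothesis beta_lt_tau : beta < tau.
Hypothesis psi_cont : {within `[0, tau], continuous psi}.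
Hypothesis psi_gt0 : forall t : R, 0 <= t <= tau -> 0 < psi t.
Hypothesis r_neq0 : r != 0.
Hypothesis r_gt : - inf [set psi t | t in `[0, tau]] < r.
Hypothesis delta_gt0 : forall n, (0 < n)%N -> 0 < delta n.
Hypothesis n_delta_cvg0 : n%:R * delta n @[n --> \oo] --> 0.
Variables (d : nat -> measure_display) (Omega : forall n, measurableType (d n)).
Variables (P : forall n, R -> probability (Omega n) R).
Variables (X : forall n, 'I_n -> R -> Omega n -> nat).
Hypothesis X_model : forall n theta, (0 < n)%N -> alpha < theta < beta ->
  poisson_sample (P n theta) tau (intensity tau psi r (delta n) theta) (@X n).
Variables (thetahat : forall n, {mfun Omega n >-> R}).
Hypothesis thetahat_mle : forall n, (0 < n)%N ->
  maximum_likelihood alpha beta tau psi r (delta n) (@X n) (thetahat n).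
Variables (d' : R -> R -> measure_display).
Variables (Omega' : forall a b, measurableType (d' a b)).
Variables (Q : forall a b, probability (Omega' a b) R).
Variables (Yp Ym : forall a b, R -> Omega' a b -> nat).
Variables (eta : forall a b, {mfun Omega' a b >-> R}).
Hypothesis eta_argsup : forall a b : R, 0 < a -> 0 < b -> a != b ->
  limit_argsup (Q a b) a b (@Yp a b) (@Ym a b) (eta a b).
Variable (K : set R).
Hypothesis K_compact : compact K.
Hypothesis K_sub : K `<=` `]alpha, beta[.

Local Notation xi n th := (fun w => n%:R * (thetahat n w - th)).
Local Notation Qt th := (Q (psi th) (psi th + r)).
Local Notation zeta th := (eta (psi th) (psi th + r)).

Lemma tau_ge0 : 0 <= tau.
Proof. by apply/ltW; exact: lt_trans (lt_trans alpha_lt_beta _). Qed.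

Lemma K_itv th : K th -> alpha < th < beta.
Proof. by move=> /K_sub; rewrite /= in_itv. Qed.

Lemma K_tau th : K th -> 0 <= th <= tau.
Proof.
move=> /K_itv/andP[h1 h2].
by rewrite (ltW (lt_trans alpha_gt0 h1)) (ltW (lt_trans h2 beta_lt_tau)).
Qed.

Lemma limit_argsup_at th : K th ->
  limit_argsup (Qt th) (psi th) (psi th + r) (@Yp _ _) (@Ym _ _) (zeta th).
Proof.
move=> /K_tau thin; apply: eta_argsup; [exact: psi_gt0 | exact: psir_gt0 thin |].
by rewrite -{1}[psi th]addr0 (inj_eq (addrI _)) eq_sym.
Qed.

Lemma eventually_small (c1 c2 c3 : R) : 0 < c1 -> 0 < c3 ->
  \forall n \near \oo, [/\ (0 < n)%N, n%:R * delta n <= c1 & c2 / n%:R <= c3].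
Proof.
move=> c10 c30; near=> n.
have n0 : (0 < n)%N by near: n; exact: nbhs_infty_gt.
split => //.
  apply: le_trans (ler_norm _) _; rewrite -[n%:R * _]subr0 -normrN opprB.
  near: n; exact: (cvgrPdist_le _ _).1 n_delta_cvg0 _ c10.
rewrite ler_pdivrMr ?ltr0n// mulrC -ler_pdivrMr//.
by near: n; exact: nbhs_infty_ger.
Unshelve. all: by end_near.
Qed.

(** One rate and one constant serve all [theta] in [K] and the limit as well, being built from
    bounds [l0] and [H] valid on the whole of [[0, tau]]. *)
Lemma uniform_exp_moments : exists l C, [/\ 0 < l,
  \forall n \near \oo, forall th, K th ->
    (\int[P n th]_w (expR (l * `|xi n th w|))%:E <= C%:E)%E &
  forall th, K th -> (\int[Qt th]_w (expR (l * `|zeta th w|))%:E <= C%:E)%E].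
Proof.
have [l0 [H [l00 H0 lo_in]]] := lo_bounds tau_ge0 psi_cont psi_gt0 r_gt.
have ar0 : 0 < `|r| by rewrite normr_gt0.
have [e e0 he] := small_error_exists l00 H0 ar0.
have e20 : 0 < e / 2 by rewrite divr_gt0.
exists (tail_rate H `|r| / 2), (exp_moment_constant l0 H `|r|); split.
- by rewrite divr_gt0// divr_gt0 ?exprn_gt0// mulr_gt0.
- have e10 : 0 < Num.min (e / 2) (e * l0) by rewrite lt_min e20 mulr_gt0.
  have [dp dp0 psi_e] := continuous_modulus e10 psi_cont.
  have c10 : 0 < Num.min 1 (e / 2 / `|r|) by rewrite lt_min ltr01 divr_gt0.
  have c30 : 0 < Num.min dp (Num.min alpha (tau - beta)).
    by rewrite !lt_min dp0 alpha_gt0 subr_gt0.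
  apply: filterS (eventually_small 4 c10 c30) => n [n0 n1 n2] th Kth.
  move: n1 n2; rewrite !le_min => /andP[n11 n12] /and3P[n21 n22 n23].
  have Xn := X_model n0 (K_itv Kth); have tn := thetahat_mle n0; have dn0 := delta_gt0 n0.
  have mt := @measurable_funPT _ _ _ _ (thetahat n).
  rewrite (eq_integral (fun w => (expR (tail_rate H `|r| / 2 *
      `|orient (r < 0) * (n%:R * (thetahat n w - th))|))%:E)); last first.
    by move=> w _; rewrite normr_orient.
  case: n n0 n11 n12 n21 n22 n23 Xn tn dn0 mt => // n _ n11 n12 n21 n22 n23 Xn tn dn0 mt.
  apply: (prelimit_exp_moment tau_ge0 dn0 psi_gt0 (psir_gt0 psi_gt0 r_gt)
    (integrable_psi psi_cont) l00 lo_in Xn tn alpha_gt0 beta_lt_tau (K_itv Kth) mt r_neq0 H0 he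
    (ltW e10)) => //.
  + by rewrite ge_min lexx.
  + by rewrite ler_pdivrMr// ge_min lexx orbT.
  + by rewrite mulrC -ler_pdivlMr.
  move=> s t sin tin st; apply: psi_e => //; apply: le_trans st (le_trans _ n21).
  by rewrite ler_pM2r ?invr_gt0 ?ltr0n//; lra.
move=> th Kth; have thin := K_tau Kth; have [l1 l2] := lo_in _ thin.
have E : psi th + r - psi th = r by rewrite addrAC subrr add0r.
have := limit_exp_moment (psi_gt0 thin) (psir_gt0 psi_gt0 r_gt thin)
  (l0 := l0) (H := H) _ (limit_argsup_at Kth) (@measurable_funPT _ _ _ _ (zeta th)) l00 H0 l1.
rewrite E => h; apply: le_trans (h _ _); last 2 first.
- by rewrite -{1}[psi th]addr0 (inj_eq (addrI _)) eq_sym.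
- by have := hi_lo psi r th; rewrite /hi => ->.
by under [leRHS]eq_integral do rewrite normr_orient.
Qed.

(** [A] comes from the tails, then [h], [M] and [K'] from the accuracy wanted; only then, with [N]
    fixed, come the tolerance [e1] for [psi] and the index [n], which beat the factor [2 ^ N] in
    [W]. *)
Lemma weak_convergence (g : R -> R) : continuous g -> bounded_fun g ->
  cvg_unif_on K (fun n th => \int[P n th]_w (g (xi n th w))%:E)%E
    (fun th => \int[Qt th]_w (g (zeta th w))%:E)%E.
Proof.
move=> gc gb ep ep0.
have [B B0 gB'] := ex_strict_bound_gt0 gb.
have {gB'} gB x : `|g x| <= B by apply/ltW; exact: (gB' x I).
have [l0 [H [l00 H0 lo_in]]] := lo_bounds tau_ge0 psi_cont psi_gt0 r_gt.
have ar0 : 0 < `|r| by rewrite normr_gt0.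
have [l [C [l_gt0 tailP tailQ]]] := uniform_exp_moments.
(* Each model contributes at most [3 * e] and the difference of the cell means at most [e], seven
   tenths of [ep] in all. *)
pose e := ep / 10; have e0 : 0 < e by rewrite divr_gt0.
pose k := e / (2 * B); have k0 : 0 < k by rewrite divr_gt0// mulr_gt0.
pose A := (Num.truncn (l^-1 * `|C / k|)).+1.
have AC : C * expR (- (l * A%:R)) <= k.
  apply: expR_decay k0 _; apply: le_trans (ler_norm _) _; rewrite -ler_pdivrMl//.
  by have /andP[_ /ltW] := truncn_itv (x := l^-1 * `|C / k|) ltac:(by rewrite mulr_ge0// invr_ge0 ltW).
have [dg dg0 g_e] := continuous_modulus e0
  (continuous_subspaceT gc : {within `[- (A%:R + 1), A%:R + 1], continuous g}).
have dg10 : 0 < Num.min dg 1 by rewrite lt_min dg0 ltr01.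
have [h [M [K' [h0 AM hd m1 [NK ER]]]]] := mean_parameters A B0 H0 dg10 e0.
set m := 2 * (H * h) in m1 NK ER; set N := (2 * M)%N in NK ER.
have hd1 : 9 * h <= dg by apply: le_trans hd _; rewrite ge_min lexx.
have hd2 : 9 * h <= 1 by apply: le_trans hd _; rewrite ge_min lexx orbT.
have g_near x y : `|x| <= A%:R -> `|y - x| <= 9 * h -> `|g x - g y| <= e.
  move=> xA yx; have yA : `|y| <= A%:R + 1.
    rewrite -(subrK x y) addrC; apply: le_trans (ler_normD _ _) _.
    by rewrite lerD//; exact: le_trans yx hd2.
  apply: g_e; rewrite -?ler_norml//; first by rewrite (le_trans xA)// lerDl.
  by rewrite distrC; exact: le_trans yx hd1.
have M0 : 0 < M%:R :> R.
  rewrite -(pmulr_lgt0 _ h0); apply: lt_le_trans AM.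
  by rewrite ltr_wpDl// mulr_gt0.
have N0 : 0 < N%:R :> R by rewrite /N natrM mulr_gt0.
have m0 : 0 < m by rewrite !mulr_gt0.
pose W := (2 ^ N)%:R * (B * (N%:R * (1 + m))).
have W0 : 0 < W.
  by rewrite /W mulr_gt0 ?mulr_gt0 ?addr_gt0// ltr0n expn_gt0.
(* The error allowed in the Poisson means: half goes to the variation of [psi], through [e1], and
   half to the ramp, through [n * delta n]. *)
pose s := Num.min (e / W) (H * h).
have s0 : 0 < s by rewrite lt_min divr_gt0// mulr_gt0.
pose e1 := Num.min (s / (4 * h)) (`|r| * h / N%:R * l0 / 2).
have e10 : 0 < e1.
  have q0 : 0 < `|r| * h / N%:R by rewrite divr_gt0// mulr_gt0.
  by rewrite lt_min; apply/andP; split; rewrite divr_gt0// mulr_gt0.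
have e1s : e1 * h + e1 * h <= s / 2.
  have : e1 <= s / (4 * h) by rewrite ge_min lexx.
  rewrite ler_pdivlMr ?mulr_gt0// => q.
  by rewrite ler_pdivlMr// (_ : _ * 2 = e1 * (4 * h))//; ring.
have e1N : N%:R * (e1 / l0 + e1 / l0) <= `|r| * h.
  have : e1 <= `|r| * h / N%:R * l0 / 2 by rewrite ge_min lexx orbT.
  rewrite ler_pdivlMr// -ler_pdivrMr// ler_pdivlMr// => q.
  by apply: le_trans q; rewrite (_ : _ * (_ + _) = e1 * 2 / l0 * N%:R)//; ring.
have [dp dp0 psi_e] := continuous_modulus e10 psi_cont.
have [z z0 Kz] := compact_margin K_compact K_sub.
have z2 : z / 2 < z by rewrite ltr_pdivrMr// ltr_pMr// ltr1n.
have c10 : 0 < Num.min h (s / 2 / `|r|) by rewrite lt_min h0 !divr_gt0.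
have c30 : 0 < Num.min dp (z / 2) by rewrite lt_min dp0 divr_gt0.
apply: filterS2 (eventually_small (M%:R * h) c10 c30) tailP => n [n0 n1 n2] tailPn th Kth.
have {tailPn}tP := tailPn th Kth; have tQ := tailQ th Kth.
have lim := limit_argsup_at Kth.
move: n1 n2; rewrite !le_min => /andP[n11 n12] /andP[n21 n22].
have Xn := X_model n0 (K_itv Kth); have tn := thetahat_mle n0; have dn0 := delta_gt0 n0.
have mt := @measurable_funPT _ _ _ _ (thetahat n).
case: n n0 n11 n12 n21 n22 Xn tn dn0 mt tP => // n _ n11 n12 n21 n22 Xn tn dn0 mt tP.
have sgn th' : orient (r < 0) * (orient (r < 0) * th') = th' := orientK _ th'.
rewrite (eq_integral (fun w => (g (orient (r < 0) * (orient (r < 0) *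
    (n.+1%:R * (thetahat n.+1 w - th)))))%:E)); last by move=> w _; rewrite orientK.
rewrite (eq_integral (mu := Qt th) (fun w => (g (orient (r < 0) * (orient (r < 0) *
    zeta th w)))%:E)); last by move=> w _; rewrite orientK.
have gap := mean_gap tau_ge0 dn0 psi_gt0 (psir_gt0 psi_gt0 r_gt) (integrable_psi psi_cont)
  l00 H0 lo_in Xn tn mt alpha_gt0 beta_lt_tau r_neq0 lim (@measurable_funPT _ _ _ _ (zeta th))
  (g := fun x => g (orient (r < 0) * x)) (B := B) (A := A%:R) (eps := e) (h := h) (e := e1)
  (t := k) (M := M) (K := K').
apply: le_lt_trans (gap _ _ h0 _ AM (ltW e0) _ _ (ltW e10) _ _ _ m1 _ e1N NK _ _) _.
- apply: measurableT_comp; first exact: continuous_measurable_fun.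
  exact: measurable_funM.
- by move=> x; exact: gB.
- by [].
- by move=> x y xA yx; apply: g_near; rewrite ?normr_orient// -mulrBr normr_orient.
- exact: n11.
- move=> s' u sin uin su; apply: psi_e => //; apply: le_trans su _.
  by rewrite mulrA.
- rewrite mulrA; apply: le_lt_trans n22 _; have /andP[+ _] := Kz _ Kth.
  by rewrite -lerBrDl; apply: lt_le_trans.
- rewrite mulrA; apply: le_lt_trans n22 _; have /andP[_ +] := Kz _ Kth.
  by rewrite lerBrDr -lerBrDl; apply: lt_le_trans.
- rewrite [leRHS](_ : _ = H * h)//; apply: le_trans (_ : s <= _); last by rewrite ge_min lexx orbT.
  by rewrite [leRHS]splitr lerD// mulrC -ler_pdivlMr.
- under eq_set do rewrite normr_orient.
  by apply: le_trans (exp_tail _ _ l_gt0 tP) _; [apply: measurable_funM => //; exact: measurable_funB | rewrite lee_fin].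
- under eq_set do rewrite normr_orient.
  by apply: le_trans (exp_tail _ _ l_gt0 tQ) _; [exact: measurable_funPT | rewrite lee_fin].
rewrite lte_fin -/m -/N; move: ER.
set Y := N%:R * (expR 2 * m ^+ 2) + _; set v := e1 * h + e1 * h + _ => ER.
have vs : v <= s by rewrite [leRHS]splitr lerD// mulrC -ler_pdivlMr.
have Wv : (2 ^ N)%:R * (B * (N%:R * ((1 + m) * v))) <= e.
  rewrite !mulrA -(mulrA (2 ^ N)%:R) -(mulrA (2 ^ N)%:R) -(mulrA B) -/W.
  rewrite mulrC -ler_pdivlMr//; apply: le_trans vs _.
  by rewrite ge_min lexx.
have Bk : 2 * B * k = e by rewrite mulrC divfK// lt0r_neq0// mulr_gt0.
have EE : 10 * e = ep by rewrite mulrC divfK.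
rewrite mulrDr Bk; move: ER Wv e0; rewrite -EE.
move: (2 * B * Y) (e) ((2 ^ N)%:R * _) => u1 u2 u3 h1 h2 h3.
by lra.
Qed.

Lemma probability_far_small (eps : R) : 0 < eps ->
  cvg_unif_on K (fun n th => P n th [set w | eps < `|thetahat n w - th|]) (fun=> 0%E).
Proof.
move=> eps0 e e0; have [l [C [l0 tailP _]]] := uniform_exp_moments.
have e20 : 0 < e / 2 by rewrite divr_gt0.
have large : \forall n \near \oo, (0 < n)%N /\ (l * eps)^-1 * (C / (e / 2)) <= n%:R.
  near=> n; split; near: n; [exact: nbhs_infty_gt | exact: nbhs_infty_ger].
apply: filterS2 large tailP => n [n0 nl] tP th Kth.
have nR : 0 < n%:R :> R by rewrite ltr0n.
rewrite sube0 gee0_abs ?measure_ge0//.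
have -> : [set w | eps < `|thetahat n w - th|] = [set w | n%:R * eps < `|xi n th w|].
  by apply/seteqP; split => w /=; rewrite normrM (gtr0_norm nR) ltr_pM2l.
have mxi : measurable_fun setT (xi n th) by apply: measurable_funM => //; exact: measurable_funB.
apply: le_lt_trans (exp_tail mxi _ l0 (tP th Kth)) _; rewrite lte_fin.
apply: (@le_lt_trans _ _ (e / 2)); last by rewrite ltr_pdivrMr// ltr_pMr// ltr1n.
apply: expR_decay => //; rewrite (mulrC n%:R) mulrA.
by rewrite -ler_pdivrMl// mulr_gt0.
Unshelve. all: by end_near.
Qed.

(** Clamping costs [ep / 4] in each model, half of it below, through [dl], and half in the tail,
    through [A]; weak convergence for the clamped power takes another quarter. *)
Lemma moment_convergence (p : R) : 0 < p ->
  cvg_unif_on K (fun n th => \int[P n th]_w (`|xi n th w| `^ p)%:E)%E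
    (fun th => \int[Qt th]_w (`|zeta th w| `^ p)%:E)%E.
Proof.
move=> p0 ep ep0; have [l [C [l0 tailP tailQ]]] := uniform_exp_moments.
have ep80 : 0 < ep / 8 by rewrite divr_gt0.
pose dl := (ep / 8) `^ p^-1.
have dl0 : 0 < dl by rewrite powR_gt0.
have dlp : dl `^ p = ep / 8 by rewrite /dl -powRrM mulVf ?lt0r_neq0// powRr1// ltW.
have l20 : 0 < l / 2 by rewrite divr_gt0.
pose A := dl + `|power_constant p l * C / (ep / 8)| / (l / 2).
have dlA : dl <= A by rewrite lerDl divr_ge0// ltW.
have AC : power_constant p l * expR (- (l / 2 * A)) * C <= ep / 8.
  rewrite mulrAC; apply: expR_decay => //; apply: le_trans (ler_norm _) _.
  by rewrite -ler_pdivrMl// mulrC lerDr ltW.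
have trunc d0 (T : measurableType d0) (P0 : probability T R) (x : T -> R) :
    measurable_fun setT x -> (\int[P0]_w (expR (l * `|x w|))%:E <= C%:E)%E ->
    (`|\int[P0]_w (`|x w| `^ p)%:E - \int[P0]_w (clamped_power p A dl (x w))%:E| <=
     (ep / 4)%:E)%E.
  move=> mx hx; apply: le_trans (moment_truncation p0 l0 dl0 dlA mx hx) _.
  rewrite lee_fin dlp (_ : ep / 4 = ep / 8 + ep / 8); first exact: lerD.
  by field.
have bounded : bounded_fun (clamped_power p A dl).
  by exists (A `^ p); split => // M /ltW AM x _; exact: le_trans (clamped_power_le p0 dl0 dlA x) AM.
have ep40 : 0 < ep / 4 by rewrite divr_gt0.
have weak := weak_convergence (@continuous_clamped_power _ p A dl dl0) bounded ep40.
apply: filterS2 weak tailP => n wn tP th Kth.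
have mxi : measurable_fun setT (xi n th) by apply: measurable_funM => //; exact: measurable_funB.
apply: le_lt_trans (abse_dist_triangle (trunc _ _ _ _ mxi (tP th Kth))
  (trunc _ _ _ _ (@measurable_funPT _ _ _ _ (zeta th)) (tailQ th Kth)) (ltW (wn th Kth))) _.
by rewrite lte_fin; lra.
Qed.

End change_point.

Theorem theorem24 (R : realType) (alpha beta tau : R) (psi : R -> R) (r : R)
  (delta : nat -> R)
  (alpha_gt0 : 0 < alpha) (alpha_lt_beta : alpha < beta)
  (beta_lt_tau : beta < tau)
  (psi_cont : {within `[0, tau], continuous psi})
  (psi_gt0 : forall t : R, 0 <= t <= tau -> 0 < psi t)
  (r_neq0 : r != 0)
  (r_gt : - inf [set psi t | t in `[0, tau]] < r)
  (delta_gt0 : forall n, (0 < n)%N -> 0 < delta n)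
  (delta_decr : forall m n, (0 < m)%N -> (m <= n)%N -> delta n <= delta m)
  (delta_cvg0 : delta n @[n --> \oo] --> 0)
  (n_delta_cvg0 : n%:R * delta n @[n --> \oo] --> 0)
  (d : nat -> measure_display) (Omega : forall n, measurableType (d n))
  (P : forall n, R -> probability (Omega n) R)
  (X : forall n, 'I_n -> R -> Omega n -> nat)
  (X_model : forall n theta, (0 < n)%N -> alpha < theta < beta ->
     poisson_sample (P n theta) tau
       (intensity tau psi r (delta n) theta) (X n))
  (thetahat : forall n, {mfun Omega n >-> R})
  (thetahat_mle : forall n, (0 < n)%N ->
     maximum_likelihood alpha beta tau psi r (delta n) (X n) (thetahat n))
  (d' : R -> R -> measure_display)
  (Omega' : forall a b, measurableType (d' a b))
  (Q : forall a b, probability (Omega' a b) R)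
  (Yp Ym : forall a b, R -> Omega' a b -> nat)
  (eta : forall a b, {mfun Omega' a b >-> R})
  (eta_argsup : forall a b : R, 0 < a -> 0 < b -> a != b ->
     limit_argsup (Q a b) a b (Yp a b) (Ym a b) (eta a b))
  (K : set R) (K_compact : compact K) (K_sub : K `<=` `]alpha, beta[) :
  [/\ (forall eps : R, 0 < eps ->
         cvg_unif_on K
           (fun n theta =>
              P n theta [set w | eps < `|thetahat n w - theta|])
           (fun=> 0%E)),
      (forall g : R -> R, continuous g -> bounded_fun g ->
         cvg_unif_on K
           (fun n theta =>
              'E_(P n theta)[fun w => (g (n%:R * (thetahat n w - theta)))%R])%E
           (fun theta =>
              'E_(Q (psi theta) (psi theta + r)%R)[fun w =>
                g (eta (psi theta) (psi theta + r)%R w)])%E)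
    & (forall p : R, 0 < p ->
         cvg_unif_on K
           (fun n theta =>
              (n%:R `^ p)%R%:E *
              'E_(P n theta)[fun w => (`|thetahat n w - theta| `^ p)%R])%E
           (fun theta =>
              'E_(Q (psi theta) (psi theta + r)%R)[fun w =>
                (`|eta (psi theta) (psi theta + r) w| `^ p)%R])%E)].
Proof.
have weak := weak_convergence alpha_gt0 alpha_lt_beta beta_lt_tau psi_cont psi_gt0 r_neq0 r_gt
  delta_gt0 n_delta_cvg0 X_model thetahat_mle eta_argsup K_compact K_sub.
have moment := moment_convergence alpha_gt0 alpha_lt_beta beta_lt_tau psi_cont psi_gt0 r_neq0
  r_gt delta_gt0 n_delta_cvg0 X_model thetahat_mle eta_argsup K_compact K_sub.
split.
- exact: (probability_far_small alpha_gt0 alpha_lt_beta beta_lt_tau psi_cont psi_gt0 r_neq0 r_gt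
    delta_gt0 n_delta_cvg0 X_model thetahat_mle eta_argsup K_sub).
- by move=> g gc gb; rewrite unlock; exact: weak.
move=> p p0 e e0; rewrite unlock.
apply: filterS (moment p p0 e e0) => n H th Kth.
(* The normalizing power of [n] moves inside the expectation, which leaves the moment of the
   rescaled error. *)
rewrite (_ : (_ * _)%E = \int[P n th]_w (`|n%:R * (thetahat n w - th)| `^ p)%:E)%E.
  exact: H.
rewrite -ge0_integralZl_EFin ?powR_ge0//.
- apply: eq_integral => w _; rewrite -EFinM normrM ger0_norm//.
  by rewrite powRM.
- apply/measurable_EFinP; apply: (measurableT_comp (measurable_powR p)).
  by apply: measurableT_comp => //; exact: measurable_funB.
Qed.
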